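(* Fix an integer $d\ge 1$ and for every integer $q\ge d$ let $P=P^{(q)}$ be a Borel probability measure on $\mathbb{R}^q$, and let $\Gamma=\Gamma^{(q)}$ be uniformly distributed on the set of column-wise orthonormal matrices in $\mathbb{R}^{q\times d}$. The following two assertions on the sequence $(P^{(q)})_{q\ge d}$ are equivalent: (A1) There exists a probability measure $Q$ on $\mathbb{R}^d$ such that $\Gamma^\top P$ converges weakly in probability to $Q$ as $q\to\infty$. (A2) If $X=X^{(q)}$ and $\tilde X=\tilde X^{(q)}$ are independent random vectors with distribution $P=P^{(q)}$, then, as $q\to\infty$, the distribution of $\|X\|^2/q$ converges weakly to $R$ for some probability measure $R$ on $[0,\infty)$, and $X^\top\tilde X/q\to 0$ in probability. Moreover, the limit distribution $Q$ in (A1) is a normal mixture, precisely $$Q=\int \mathcal{N}_{d,v}\,R(dv)$$ with the limiting distribution $R$ in (A2).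
   Context: $\|\cdot\|$ is the Euclidean norm. $\mathcal{N}_{d,v}$ is the Gaussian distribution on $\mathbb{R}^d$ with mean vector $0$ and covariance matrix $vI_d$, for $v\ge 0$ (so $\mathcal{N}_{d,0}$ is the point mass at $0$). The dimension $d$ is fixed while $q\to\infty$. The random matrix $\Gamma^{(q)}$ takes values in $\{\gamma\in\mathbb{R}^{q\times d}:\gamma^\top\gamma=I_d\}$ and its law is the unique probability distribution on this set such that $U\Gamma$ has the same distribution as $\Gamma$ for every fixed orthogonal matrix $U\in\mathbb{R}^{q\times q}$. For $\gamma\in\mathbb{R}^{q\times d}$, $\gamma^\top P$ denotes the distribution of $\gamma^\top X$ on $\mathbb{R}^d$, where $X\sim P$. Thus $\Gamma^\top P$ is a random probability distribution on $\mathbb{R}^d$ (a function of $\Gamma$). A sequence $(\hat Q_k)_k$ of random distributions on a separable metric space $\mathbb{M}$ (i.e. maps from a probability space into the Borel probability measures on $\mathbb{M}$ such that $\int f\,d\hat Q_k$ is measurable for every bounded continuous $f:\mathbb{M}\to\mathbb{R}$) converges weakly in probability to a fixed distribution $Q$ if $\int f\,d\hat Q_k\to\int f\,dQ$ in probability for every bounded continuous $f:\mathbb{M}\to\mathbb{R}$. *)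

(* Defs.v *)
From HB Require Import structures.
From mathcomp Require Import all_boot all_order all_algebra.
From mathcomp Require Import all_classical all_reals all_analysis measurable_realfun.

Set Implicit Arguments.
Unset Strict Implicit.
Unset Printing Implicit Defensive.

Import Order.TTheory GRing.Theory Num.Theory.
Import numFieldNormedType.Exports.

Local Open Scope classical_set_scope.
Local Open Scope ring_scope.

(* Topological spaces whose measurable sets are the Borel sets. *)
HB.mixin Record isBorel d T & Measurable d T & Topological T := {
  borelE : @measurable d T = <<s @open T >> }.

#[short(type="borelType")]
HB.structure Definition Borel d :=
  { T of isBorel d T & Measurable d T & Topological T }.

Section real_borel.
Variable R : realType.

Lemma measurableR_borelE : @measurable _ R = <<s @open R >>.
Proof.
apply/seteqP; split.
  rewrite [X in X `<=` _]RGenOpens.measurableE.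
  apply: sub_smallest2r; first exact: smallest_sigma_algebra.
  move=> _ [x [y ->]].
  exact: (@interval_open R (BRight x) (BLeft y) isT isT).
apply: smallest_sub; first exact: sigma_algebra_measurable.
by move=> A; exact: open_measurable.
Qed.

HB.instance Definition _ := isBorel.Build _ R measurableR_borelE.
End real_borel.

Section matrix_borel.
Variables (R : realType) (m n : nat).

HB.instance Definition _ := @isMeasurable.Build
  (sigma_display (@open 'M[R]_(m, n))) 'M[R]_(m, n) <<s @open 'M[R]_(m, n) >>
  (@sigma_algebra0 _ setT _) (@sigma_algebraC _ _)
  (@sigma_algebra_bigcup _ setT _).

HB.instance Definition _ :=
  isBorel.Build _ 'M[R]_(m, n) erefl.
End matrix_borel.

Lemma continuous_borel_measurable d1 d2 (S : borelType d1) (T : borelType d2)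
  (f : S -> T) : continuous f -> measurable_fun setT f.
Proof.
move=> /continuousP cf; apply: (@measurability _ _ S T setT f open (@borelE _ T)) => _ [A oA <-].
by rewrite setTI borelE; apply: sub_sigma_algebra; exact: cf.
Qed.

Section matrix_measurable.
Variable R : realType.

Lemma measurable_coord m n i j :
  measurable_fun setT (fun M : 'M[R]_(m, n) => M i j).
Proof. by apply: continuous_borel_measurable; exact: coord_continuous. Qed.

Lemma measurable_fun_mx d (T : measurableType d) m n (f : T -> 'M[R]_(m, n)) :
  (forall i j, measurable_fun setT (fun x => f x i j)) -> measurable_fun setT f.
Proof.
move=> mf; apply: (@measurability _ _ T 'M[R]_(m, n) setT f open erefl) => _ [A oA <-].
pose B (c : 'M[rat]_(m, n)) (k : nat) : set 'M[R]_(m, n) :=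
  ball (map_mx ratr c : 'M[R]_(m, n)) k.+1%:R^-1.
have mB c k : measurable (f @^-1` B c k).
  have -> : f @^-1` B c k = \bigcap_(ij in [set: 'I_m * 'I_n])
      [set x | f x ij.1 ij.2 \in `]ratr (c ij.1 ij.2) - k.+1%:R^-1,
                                  ratr (c ij.1 ij.2) + k.+1%:R^-1[].
    apply/seteqP; split => [x [_ Bx] [i j] _ /=|x Bx].
      have /= := Bx i j.
      by rewrite !mxE /ball/= in_itv/= distrC ltr_distl.
    split => [|i j]; first by rewrite invr_gt0.
    have /= := Bx (i, j) Logic.I.
    by rewrite !mxE /ball/= in_itv/= distrC ltr_distl.
  apply: fin_bigcap_measurable; first exact: finite_finset.
  move=> [i j] _ /=; rewrite -[X in measurable X]setTI.
  exact: (mf i j measurableT _ (measurable_itv _)).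
have -> : setT `&` f @^-1` A = \bigcup_(ck : 'M[rat]_(m, n) * nat)
    [set x | B ck.1 ck.2 `<=` A /\ B ck.1 ck.2 (f x)].
  apply/seteqP; split => [x [_ Ax]|x [ck _ [BA]]]; last by split => //; exact: BA.
  have := oA; rewrite openE => /(_ _ Ax)/nbhs_ballP[e /= e0 eA].
  have [k ke] : exists k, k.+1%:R^-1 < e / 2 :> R.
    have := near_infty_natSinv_lt (PosNum (divr_gt0 e0 (ltr0n _ 2))).
    by case=> k _ /(_ k (leqnn k)) /= ?; exists k.
  have /(_ _ _)/cid hc i j : exists q : rat,
      ratr q \in `]f x i j - k.+1%:R^-1, f x i j + k.+1%:R^-1[.
    by apply: rat_in_itvoo; rewrite ltrBlDr -addrA ltrDl addr_gt0 ?invr_gt0.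
  pose c : 'M[rat]_(m, n) := \matrix_(i, j) sval (hc i j).
  have Bcx : ball (f x) k.+1%:R^-1 (map_mx ratr c : 'M[R]_(m, n)).
    split => [|i j]; first by rewrite invr_gt0.
    by rewrite !mxE /ball/= distrC ltr_distl; case: (hc i j) => q /=; rewrite in_itv.
  exists (c, k) => //; split => [y By|]; last exact: ball_sym.
  apply: eA; rewrite [e]splitr; apply: (@ball_triangle _ _ (map_mx ratr c : 'M[R]_(m, n))).
    exact: le_ball (ltW ke) _ Bcx.
  exact: le_ball (ltW ke) _ By.
apply: countable_bigcupT_measurable => // -[c k] /=.
have [BA|nBA] := pselect (B c k `<=` A).
  rewrite (_ : [set x | _] = f @^-1` B c k); first exact: mB.
  by apply/seteqP; split => [x []|x].
rewrite (_ : [set x | _] = set0); first exact: measurable0.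
by rewrite -subset0 => x [].
Qed.

End matrix_measurable.

Section linear_maps.
Variable R : realType.

Lemma measurable_mulmx m n p (A : 'M[R]_(m, n)) :
  measurable_fun [set: 'M[R]_(n, p)] (mulmx A).
Proof.
apply: measurable_fun_mx => i j.
rewrite (_ : (fun _ => _) =
    (fun x : 'M[R]_(n, p) => \sum_k A i k * x k j)); last first.
  by apply/funext => x; rewrite mxE.
by apply: measurable_sum => k; apply: measurable_funM => //; exact: measurable_coord.
Qed.

HB.instance Definition _ m n p (A : 'M[R]_(m, n)) :=
  isMeasurableFun.Build _ _ _ _ (@mulmx R m n p A) (measurable_mulmx A).

Lemma measurable_scalemx m n (a : R) :
  measurable_fun setT (fun x : 'M[R]_(m, n) => a *: x).
Proof.
apply: measurable_fun_mx => i j.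
rewrite (_ : (fun _ => _) = (fun x : 'M[R]_(m, n) => a * x i j)); last first.
  by apply/funext => x; rewrite mxE.
by apply: measurable_funM => //; exact: measurable_coord.
Qed.

HB.instance Definition _ m n (a : R) :=
  isMeasurableFun.Build _ _ _ _ ( *:%R a : 'M[R]_(m, n) -> 'M[R]_(m, n))
    (measurable_scalemx a).

(* The domain is [measurableTypeR R], the type on which the library's
   [normal_prob] is a probability measure. *)
Definition cons_cV n (x : measurableTypeR R * 'cV[R]_n) : 'cV[R]_n.+1 :=
  col_mx (x.1 : R)%:M x.2.

Lemma measurable_cons_cV n : measurable_fun setT (@cons_cV n).
Proof.
apply: measurable_fun_mx => i j; rewrite ord1 /cons_cV.
case: (@splitP 1 n i) => k ik.
  rewrite (_ : (fun _ => _) = (fst : measurableTypeR R * 'cV[R]_n -> R)).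
    exact: (@measurable_fst _ _ (measurableTypeR R) 'cV[R]_n).
  apply/funext => x.
  have -> : i = lshift n k by exact: val_inj.
  by apply: (etrans (col_mxEu ((x.1 : R)%:M : 'M[R]_1) x.2 k 0)); rewrite ord1 mxE.
rewrite (_ : (fun _ => _) = (fun x : measurableTypeR R * 'cV[R]_n => x.2 k 0)); last first.
  apply/funext => x.
  have -> : i = rshift 1 k by exact: val_inj.
  exact: (col_mxEd ((x.1 : R)%:M : 'M[R]_1) x.2 k 0).
by apply: (measurableT_comp (@measurable_coord R n 1 k 0)).
Qed.

HB.instance Definition _ n :=
  isMeasurableFun.Build _ _ _ _ (@cons_cV n) (@measurable_cons_cV n).

End linear_maps.

Section euclidean_norm.
Variable R : realType.

(* The library's norm on matrices is the sup norm. *)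
Definition enorm n (x : 'cV[R]_n) : R := Num.sqrt (\sum_i x i 0 ^+ 2).

Lemma measurable_enorm n : measurable_fun setT (@enorm n).
Proof.
apply: (measurableT_comp (f := Num.sqrt : R -> R)).
  by apply: continuous_measurable_fun; exact: sqrt_continuous.
by apply: measurable_sum => i; apply: measurable_funX; exact: measurable_coord.
Qed.

Definition scaled_sqnorm n (x : 'cV[R]_n) : R := enorm x ^+ 2 / n%:R.

Lemma measurable_scaled_sqnorm n : measurable_fun setT (@scaled_sqnorm n).
Proof.
by apply: measurable_funM => //; apply: measurable_funX; exact: measurable_enorm.
Qed.

HB.instance Definition _ n :=
  isMeasurableFun.Build _ _ _ _ (@scaled_sqnorm n) (@measurable_scaled_sqnorm n).

End euclidean_norm.

Section normal.
Variable R : realType.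

Fixpoint std_normal d : probability 'cV[R]_d R :=
  match d with
  | 0 => dirac (0 : 'cV[R]_0)
  | d'.+1 => distribution (normal_prob 0 1 \x std_normal d')%E (@cons_cV R d')
  end.

(* N_{d,v}, v >= 0, is the law of sqrt(v) Z for Z with independent standard
   normal coordinates; at v = 0 it is the point mass at 0. The library's
   [normal_prob 0 0] is not a point mass, hence the scaling. *)
Definition normal_cV d (v : R) : probability 'cV[R]_d R :=
  distribution (std_normal d) ( *:%R (Num.sqrt v) : 'cV[R]_d -> 'cV[R]_d).

Definition normal_mixture d (rho : probability R R) (A : set 'cV[R]_d) : \bar R :=
  (\int[rho]_(v in `[0%R, +oo[) normal_cV d v A)%E.

End normal.

Section random_measures.
Variable R : realType.

Definition weakly_cvg d (T : borelType d) (mu : nat -> probability T R)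
    (nu : probability T R) :=
  forall f : T -> R, continuous f -> bounded_fun f ->
    \int[mu k]_x f x @[k --> \oo] --> \int[nu]_x f x.

Definition cvg_in_probability (dO : nat -> measure_display)
    (Omega : forall k, measurableType (dO k))
    (Pr : forall k, probability (Omega k) R)
    (Y : forall k, Omega k -> R) (l : R) :=
  forall e : R, 0 < e ->
    Pr k [set w | e < `|Y k w - l|] @[k --> \oo] --> 0%E.

Definition random_distribution dO (Omega : measurableType dO)
    d (T : borelType d) (Qhat : Omega -> probability T R) :=
  forall f : T -> R, continuous f -> bounded_fun f ->
    measurable_fun setT (fun w => \int[Qhat w]_x f x).

Definition weakly_cvg_in_probability (dO : nat -> measure_display)
    (Omega : forall k, measurableType (dO k))
    (Pr : forall k, probability (Omega k) R) d (T : borelType d)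
    (Qhat : forall k, Omega k -> probability T R) (Q : probability T R) :=
  (forall k, random_distribution (Qhat k)) /\
  forall f : T -> R, continuous f -> bounded_fun f ->
    cvg_in_probability Pr (fun k w => \int[Qhat k w]_x f x) (\int[Q]_x f x).

Definition has_law dO (Omega : measurableType dO) (Pr : probability Omega R)
    d (T : measurableType d) (X : {RV Pr >-> T}) (mu : probability T R) :=
  forall A, measurable A -> distribution Pr X A = mu A.

Definition independent dO (Omega : measurableType dO) (Pr : probability Omega R)
    d1 d2 (T1 : measurableType d1) (T2 : measurableType d2)
    (X : {RV Pr >-> T1}) (Y : {RV Pr >-> T2}) :=
  forall A B, measurable A -> measurable B ->
    (Pr (X @^-1` A `&` Y @^-1` B) = Pr (X @^-1` A) * Pr (Y @^-1` B))%E.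

(* The rotation-invariant probability measure on {g | g^T g = I_d}, seen as a
   measure on all q x d matrices; it exists for d <= q and is unique. *)
Definition uniform_on_stiefel q d (mu : probability 'M[R]_(q, d) R) :=
  mu [set g | g^T *m g = 1%:M] = 1%E /\
  forall U : 'M[R]_q, U^T *m U = 1%:M ->
    forall A, measurable A -> distribution mu (mulmx U) A = mu A.

Definition projection q d (g : 'M[R]_(q, d)) (P : probability 'cV[R]_q R) :
    probability 'cV[R]_d R :=
  distribution P (mulmx g^T).

End random_measures.

Section assertions.
Variables (R : realType) (d : nat) (P : forall q, probability 'cV[R]_q R).

Definition projections_cvg (dO : nat -> measure_display)
    (Omega : forall q, measurableType (dO q))
    (Pr : forall q, probability (Omega q) R)
    (Gamma : forall q, {RV (Pr q) >-> 'M[R]_(q, d)})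
    (Q : probability 'cV[R]_d R) :=
  weakly_cvg_in_probability Pr (fun q w => projection (Gamma q w) (P q)) Q.

(* A probability measure on [0, +oo[ is a probability measure [rho] on R giving
   mass 1 to that set. The hypothesis on X and its copy is only about q >= d;
   for q < d they are irrelevant since q tends to infinity. *)
Definition norms_cvg (rho : probability R R) :=
  rho `[0, +oo[%classic = 1%E /\
  forall (dO : nat -> measure_display) (Omega : forall q, measurableType (dO q))
    (Pr : forall q, probability (Omega q) R)
    (X Xt : forall q, {RV (Pr q) >-> 'cV[R]_q}),
  (forall q, (d <= q)%N ->
    [/\ has_law (X q) (P q), has_law (Xt q) (P q) & independent (X q) (Xt q)]) ->
  weakly_cvg (fun q => distribution (Pr q) (@scaled_sqnorm R q \o X q)) rho /\
  cvg_in_probability Pr (fun q w => ((X q w)^T *m Xt q w) 0 0 / q%:R) 0.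

End assertions.

(* Main.v *)
(* Write s(x) = |x|^2/q. For a fixed vector x in R^q and t in R^d, Gamma t is
   uniform on a sphere, so that E cos(<t, Gamma^T x>) is close to
   exp(-|t|^2 s(x)/2) for large q, uniformly for s(x) bounded. Averaging over
   x = X controls the mean of the random characteristic function
   phi(t) of Gamma^T P; since cos a cos b is half of cos(a - b) + cos(a + b),
   its second moment is controlled by averaging over x = X + Xt and
   x = X - Xt, where s(X +- Xt) = s(X) + s(Xt) +- 2 <X, Xt>/q.

   Under (A2) both moments converge to those of a constant, the
   characteristic function of the normal mixture, and a continuity theorem
   for random measures, with Gaussian kernels as superpositions of
   characters, gives (A1). Under (A1) the laws of s(X) are tight and their
   Laplace transforms converge, which yields R; comparing the second moments,
   E exp(-s(X) - s(Xt)) (cosh(2 <X, Xt>/q) - 1) tends to 0, which forces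
   <X, Xt>/q to vanish in probability. *)
From HB Require Import structures.
Require Import Defs.
From mathcomp Require Import all_boot all_order all_algebra.
From mathcomp Require Import all_classical all_reals all_analysis.
From mathcomp Require Import measurable_realfun ring lra.

Set Implicit Arguments.
Unset Strict Implicit.
Unset Printing Implicit Defensive.

Import Order.TTheory GRing.Theory Num.Theory.
Import numFieldNormedType.Exports.

Local Open Scope classical_set_scope.
Local Open Scope ring_scope.

(** Characters are real: the functions [cos (dot t x + th)] carry a free phase [th] instead of a
    complex exponential, and the symmetry of the projected laws turns the phase into a factor
    [cos th].

    The Gaussian approximation on the sphere uses no density. Rotation invariance enters through
    reflections only, which determine the needed moments and factor a cosine of a sum into a product
    of cosines.

    For bounded integrands convergence in probability is convergence in L1, which Fubini carries
    through superpositions; random measures are therefore handled as images of fixed measures under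
    jointly measurable maps.

    The law [rho] is found without extracting subsequences. The function (y - s)^+ is a uniform
    limit of polynomials in exp (- s), so its means converge for each y, and their limit is a
    primitive of the distribution function sought.

    The uniform law on frames exists only for q >= d; limits are taken along dimensions [q k], which
    become [k + d] at the end. *)

Section elementary_bounds.
Context {R : realType}.
Implicit Types x y : R.

(** The Taylor bounds below come from successive integration: each difference vanishes at 0 and its
    derivative is already known to be nonnegative. *)
Lemma ge0_of_derive (f df : R -> R) : (forall x, is_derive x 1 f (df x)) ->
  (forall x, 0 <= x -> 0 <= df x) -> f 0 = 0 -> forall x, 0 <= x -> 0 <= f x.
Proof.
move=> fdf df0 f0 x x0; rewrite -f0.
apply: (@ger0_derive1_ndecry _ f 0) => //.
- by move=> y; rewrite in_itv/= andbT => /ltW y0; rewrite derive1E derive_val df0.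
- by apply: derivable_within_continuous => y _.
Qed.

Lemma sin_le x : 0 <= x -> sin x <= x.
Proof.
move=> x0; rewrite -subr_ge0.
have D y : is_derive y 1 (fun x : R => x - sin x) (1 - cos y).
  by apply: is_derive_eq; reflexivity.
apply: (ge0_of_derive D) => [y y0||//] /=.
- by rewrite subr_ge0 cos_le1.
- by rewrite sin0 subrr.
Qed.

Lemma cos_ge x : 1 - x ^+ 2 / 2 <= cos x.
Proof.
wlog x0 : x / 0 <= x.
  by move=> H; have [/H//|/ltW x0] := leP 0 x; rewrite -cosN -sqrrN H// oppr_ge0.
rewrite -subr_ge0.
have D y : is_derive y 1 (fun x => cos x - (1 - x ^+ 2 / 2))
    (y - sin y).
  by apply: is_derive_eq; rewrite /GRing.scale/=; field.
apply: (ge0_of_derive D) => [y y0||//] /=.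
- by rewrite subr_ge0 sin_le.
- by rewrite cos0; field.
Qed.

Lemma sin_ge x : 0 <= x -> x - x ^+ 3 / 6 <= sin x.
Proof.
move=> x0; rewrite -subr_ge0.
have D y : is_derive y 1 (fun x => sin x - (x - x ^+ 3 / 6))
    (cos y - (1 - y ^+ 2 / 2)).
  by apply: is_derive_eq; rewrite /GRing.scale/=; field.
apply: (ge0_of_derive D) => [y y0||//] /=.
- by rewrite subr_ge0 cos_ge.
- by rewrite sin0; field.
Qed.

Lemma cos_le x : cos x <= 1 - x ^+ 2 / 2 + x ^+ 4 / 24.
Proof.
wlog x0 : x / 0 <= x.
  move=> H; have [/H//|/ltW x0] := leP 0 x; rewrite -cosN.
  by apply: le_trans (H (- x) _) _; rewrite ?oppr_ge0// sqrrN (exprM _ 2 2) sqrrN -exprM.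
rewrite -subr_ge0.
have D y : is_derive y 1 (fun x => (1 - x ^+ 2 / 2 + x ^+ 4 / 24) - cos x)
    (sin y - (y - y ^+ 3 / 6)).
  by apply: is_derive_eq; rewrite /GRing.scale/=; field.
apply: (ge0_of_derive D) => [y y0||//] /=.
- by rewrite subr_ge0 sin_ge.
- by rewrite cos0; field.
Qed.

Lemma expRN_le x : 0 <= x -> expR (- x) <= 1 - x + x ^+ 2 / 2.
Proof.
move=> x0; rewrite -subr_ge0.
have D y : is_derive y 1 (fun x => (1 - x + x ^+ 2 / 2) - expR (- x))
    (expR (- y) - (1 - y)).
  by apply: is_derive_eq; rewrite /GRing.scale/=; field.
apply: (ge0_of_derive D) => [y y0||//] /=.
- by rewrite subr_ge0; exact: expR_ge1Dx.
- by rewrite oppr0 expR0; field.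
Qed.

(** Both functions agree with 1 - x^2/2 up to a multiple of x^4. The constants 1/24 and 1/8 are
    rounded up to 1, since only the order matters. *)
Lemma cos_expR x : `|cos x - expR (- (x ^+ 2 / 2))| <= x ^+ 4.
Proof.
have x20 : 0 <= x ^+ 2 / 2 by rewrite divr_ge0// sqr_ge0.
have := expRN_le x20; have := expR_ge1Dx (- (x ^+ 2 / 2)).
have := cos_ge x; have := cos_le x.
have : 0 <= x ^+ 4 by rewrite exprn_even_ge0.
rewrite ler_norml [(x ^+ 2 / 2) ^+ 2]expr_div_n -exprM/=.
by set a := x ^+ 4; set b := x ^+ 2; set c := cos x; set e := expR _; move=> *; apply/andP; split; lra.
Qed.

(** Telescoping: the factors are exchanged one at a time, and the remaining ones have absolute value
    at most 1. *)
Lemma dist_prod_le I (s : seq I) (a b : I -> R) :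
  (forall i, `|a i| <= 1) -> (forall i, `|b i| <= 1) ->
  `|\prod_(i <- s) a i - \prod_(i <- s) b i| <= \sum_(i <- s) `|a i - b i|.
Proof.
move=> a1 b1; elim: s => [|i s IH]; first by rewrite !big_nil subrr normr0.
rewrite !big_cons.
have -> : a i * \prod_(j <- s) a j - b i * \prod_(j <- s) b j =
  (a i - b i) * \prod_(j <- s) a j + b i * (\prod_(j <- s) a j - \prod_(j <- s) b j) by ring.
rewrite (le_trans (ler_normD _ _))// !normrM lerD//.
  rewrite ler_piMr// normr_prod.
  elim: s {IH} => [|j s IH]; first by rewrite big_nil.
  by rewrite big_cons mulr_ile1// prodr_ge0.
by rewrite (le_trans _ IH)// ler_piMl.
Qed.

Lemma expRN_dist x y : 0 <= x -> 0 <= y -> `|expR (- x) - expR (- y)| <= `|x - y|.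
Proof.
wlog xy : x y / x <= y.
  by move=> H x0 y0; have [xy|/ltW yx] := leP x y; [exact: H|rewrite distrC [leRHS]distrC H].
move=> x0 y0; rewrite ger0_norm ?subr_ge0 ?ler_expR ?lerN2//.
rewrite distrC ger0_norm ?subr_ge0//.
have -> : expR (- x) - expR (- y) = expR (- x) * (1 - expR (- (y - x))).
  by rewrite mulrBr mulr1 -expRD; congr (_ - expR _); ring.
have := expR_ge1Dx (- (y - x)).
have : 0 <= expR (- x) <= 1 by rewrite expR_ge0 -[leRHS]expR0 ler_expR oppr_le0.
have yx : 0 <= y - x by rewrite subr_ge0.
by nra.
Qed.

End elementary_bounds.

(** * Bounded measurable functions *)

Section bounded_measurable.
Context {R : realType}.

(** Against a probability such functions are always integrable, so real-valued integrals can be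
    manipulated freely; the closure rules below discharge the side conditions. *)
Definition bmeas d (T : measurableType d) (f : T -> R) :=
  measurable_fun setT f /\ exists M, forall x, `|f x| <= M.

Section closure.
Context d (T : measurableType d).
Implicit Types f g : T -> R.

Lemma bmeas_cst (c : R) : bmeas (fun _ : T => c).
Proof. by split; [exact: measurable_cst | exists `|c|]. Qed.

Lemma bmeasD f g : bmeas f -> bmeas g -> bmeas (fun x => f x + g x).
Proof.
move=> [mf [M fM]] [mg [N gN]]; split; first exact: measurable_funD.
by exists (M + N) => x; rewrite (le_trans (ler_normD _ _))// lerD.
Qed.

Lemma bmeasN f : bmeas f -> bmeas (fun x => - f x).
Proof.
move=> [mf [M fM]]; split; first exact: measurableT_comp.
by exists M => x; rewrite normrN.
Qed.

Lemma bmeasB f g : bmeas f -> bmeas g -> bmeas (fun x => f x - g x).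
Proof. by move=> bf bg; apply: bmeasD => //; exact: bmeasN. Qed.

Lemma bmeasM f g : bmeas f -> bmeas g -> bmeas (fun x => f x * g x).
Proof.
move=> [mf [M fM]] [mg [N gN]]; split; first exact: measurable_funM.
by exists (M * N) => x; rewrite normrM ler_pM.
Qed.

Lemma bmeas_norm f : bmeas f -> bmeas (fun x => `|f x|).
Proof.
move=> [mf [M fM]]; split; first exact: measurableT_comp.
by exists M => x; rewrite normr_id.
Qed.

Lemma bmeasX f n : bmeas f -> bmeas (fun x => f x ^+ n).
Proof.
move=> [mf [M fM]]; split; first exact: measurable_funX.
by exists (M ^+ n) => x; rewrite normrX lerXn2r// nnegrE (le_trans _ (fM x)).
Qed.

Lemma bmeas_sum I (s : seq I) (F : I -> T -> R) :
  (forall i, bmeas (F i)) -> bmeas (fun x => \sum_(i <- s) F i x).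
Proof.
move=> bF; elim: s => [|i s IH].
  by under eq_fun do rewrite big_nil; exact: bmeas_cst.
by under eq_fun do rewrite big_cons; exact: bmeasD.
Qed.

Lemma bmeas_prod I (s : seq I) (F : I -> T -> R) :
  (forall i, bmeas (F i)) -> bmeas (fun x => \prod_(i <- s) F i x).
Proof.
move=> bF; elim: s => [|i s IH].
  by under eq_fun do rewrite big_nil; exact: bmeas_cst.
by under eq_fun do rewrite big_cons; exact: bmeasM.
Qed.

Lemma bmeas_comp d' (T' : measurableType d') (h : T' -> R) (k : T -> T') :
  bmeas h -> measurable_fun setT k -> bmeas (fun x => h (k x)).
Proof.
by move=> [mh [M hM]] mk; split; [exact: measurableT_comp | exists M].
Qed.

Lemma bmeas_cos f : measurable_fun setT f -> bmeas (fun x => cos (f x)).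
Proof.
move=> mf; split; last by exists 1 => x; exact: cos_max.
apply: (measurableT_comp (f := cos)) => //.
by apply: continuous_measurable_fun; exact: continuous_cos.
Qed.

Lemma bmeas_expRN f : measurable_fun setT f -> (forall x, 0 <= f x) ->
  bmeas (fun x => expR (- f x)).
Proof.
move=> mf f0; split; first by do 2 apply: measurableT_comp => //.
by exists 1 => x; rewrite ger0_norm ?expR_ge0// -[leRHS]expR0 ler_expR oppr_le0.
Qed.

Lemma bmeas_bounded f M : measurable_fun setT f ->
  (forall x, 0 <= f x <= M) -> bmeas f.
Proof.
move=> mf fM; split => //; exists M => x.
by have /andP[f0 ?] := fM x; rewrite ger0_norm.
Qed.

Lemma bmeas_indic (A : set T) : measurable A -> bmeas (\1_A : T -> R).
Proof.
move=> mA; split; first exact: measurable_indic.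
by exists 1 => x; rewrite indicE normr_nat lern1 leq_b1.
Qed.

Lemma bmeas_min f M : measurable_fun setT f -> 0 <= M -> (forall x, 0 <= f x) ->
  bmeas (fun x => Num.min M (f x)).
Proof.
move=> mf M0 f0; apply: (@bmeas_bounded _ M).
  by apply: measurable_minr.
by move=> x; rewrite le_min M0 f0 ge_min lexx.
Qed.

Lemma bmeas_ext f g : f =1 g -> bmeas f -> bmeas g.
Proof. by move=> /funext ->. Qed.

End closure.

Lemma bmeas_continuous d (T : borelType d) (f : T -> R) :
  continuous f -> bounded_fun f -> bmeas f.
Proof.
move=> cf [M [_ fM]]; split; first exact: continuous_borel_measurable.
exists (`|M| + 1) => x.
by apply: fM => //; rewrite (le_lt_trans (ler_norm M))// ltrDl.
Qed.

Lemma bounded_fun_of d (T : borelType d) (f : T -> R) M :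
  (forall x, `|f x| <= M) -> bounded_fun f.
Proof.
move=> fM; exists `|M|; split; first exact: num_real.
by move=> y My x _; apply: le_trans (fM x) (le_trans (ler_norm M) (ltW My)).
Qed.

Section integral.
Context d (T : measurableType d) (P : probability T R).
Implicit Types f g : T -> R.

Lemma bmeas_integrable f : bmeas f -> P.-integrable setT (EFin \o f).
Proof.
move=> [mf [M fM]]; apply: measurable_bounded_integrable => //.
  exact: le_lt_trans (probability_le1 P measurableT) (ltry 1).
exists `|M|; split; first exact: num_real.
by move=> y My x _; apply: le_trans (fM x) (le_trans (ler_norm M) (ltW My)).
Qed.

Lemma EFin_Rintegral f : bmeas f ->
  (\int[P]_x f x)%:E = (\int[P]_x (f x)%:E)%E.
Proof.
move=> bf; rewrite /Rintegral fineK//; apply: integrable_fin_num => //.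
exact: bmeas_integrable.
Qed.

Lemma bint_cst (c : R) : \int[P]_x c = c.
Proof.
by rewrite Rintegral_cst// [X in fine X]probability_setT mulr1.
Qed.

Lemma bintD f g : bmeas f -> bmeas g ->
  \int[P]_x (f x + g x) = \int[P]_x f x + \int[P]_x g x.
Proof. by move=> bf bg; rewrite RintegralD//; exact: bmeas_integrable. Qed.

Lemma bintB f g : bmeas f -> bmeas g ->
  \int[P]_x (f x - g x) = \int[P]_x f x - \int[P]_x g x.
Proof. by move=> bf bg; rewrite RintegralB//; exact: bmeas_integrable. Qed.

Lemma bintZl (c : R) f : bmeas f -> \int[P]_x (c * f x) = c * \int[P]_x f x.
Proof. by move=> bf; rewrite RintegralZl//; exact: bmeas_integrable. Qed.

Lemma bintZr (c : R) f : bmeas f -> \int[P]_x (f x * c) = \int[P]_x f x * c.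
Proof. by move=> bf; rewrite RintegralZr//; exact: bmeas_integrable. Qed.

Lemma bint_sum I (s : seq I) (F : I -> T -> R) : (forall i, bmeas (F i)) ->
  \int[P]_x (\sum_(i <- s) F i x) = \sum_(i <- s) \int[P]_x F i x.
Proof.
move=> bF; elim: s => [|i s IH].
  under eq_Rintegral do rewrite big_nil.
  by rewrite big_nil bint_cst.
under eq_Rintegral do rewrite big_cons.
by rewrite big_cons bintD ?IH//; exact: bmeas_sum.
Qed.

Lemma le_bint f g : bmeas f -> bmeas g -> (forall x, f x <= g x) ->
  \int[P]_x f x <= \int[P]_x g x.
Proof.
by move=> bf bg fg; apply: le_Rintegral => //; exact: bmeas_integrable.
Qed.

Lemma normr_integral_le f : bmeas f -> `|\int[P]_x f x| <= \int[P]_x `|f x|.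
Proof. by move=> bf; apply: le_normr_Rintegral => //; exact: bmeas_integrable. Qed.

Lemma integral_le_cst f M : bmeas f -> (forall x, f x <= M) -> \int[P]_x f x <= M.
Proof.
move=> bf fM; rewrite -[leRHS]bint_cst; apply: le_bint => //.
exact: bmeas_cst.
Qed.

Lemma normr_integral_le_cst f M : bmeas f -> (forall x, `|f x| <= M) ->
  `|\int[P]_x f x| <= M.
Proof.
move=> bf fM; apply: le_trans (normr_integral_le bf) _.
by apply: integral_le_cst => //; exact: bmeas_norm.
Qed.

Lemma normr_integralB_le f g : bmeas f -> bmeas g ->
  `|\int[P]_x f x - \int[P]_x g x| <= \int[P]_x `|f x - g x|.
Proof.
by move=> bf bg; rewrite -bintB//; apply: normr_integral_le; exact: bmeasB.
Qed.

Lemma integral_indic1 (A : set T) : measurable A -> \int[P]_x (\1_A x : R) = fine (P A).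
Proof. by move=> mA; rewrite /Rintegral integral_indic// setIT. Qed.

Lemma EFin_prob (A : set T) : measurable A -> (fine (P A))%:E = P A.
Proof. by move=> mA; rewrite fineK// fin_num_measure. Qed.

Lemma markov_bmeas f (e : R) : bmeas f -> 0 < e -> (forall x, 0 <= f x) ->
  fine (P [set x | e < f x]) <= \int[P]_x f x / e.
Proof.
move=> bf e0 f0.
have mA : measurable [set x | e < f x].
  rewrite (_ : [set _ | _] = f @^-1` `]e, +oo[).
    by rewrite -[X in measurable X]setTI; apply: bf.1.
  by apply/seteqP; split => x /=; rewrite in_itv/= andbT.
rewrite -integral_indic1// ler_pdivlMr// -bintZr; last exact: bmeas_indic.
apply: le_bint => //.
  by apply: bmeasM; [exact: bmeas_indic|exact: bmeas_cst].
move=> x; rewrite indicE; case: (boolP (x \in _)) => [|_]; last by rewrite mul0r.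
by rewrite inE/= mul1r => /ltW.
Qed.

Lemma le_integral_on (D : set T) f g : measurable D -> P D = 1%E ->
  bmeas f -> bmeas g -> (forall x, D x -> f x <= g x) ->
  \int[P]_x f x <= \int[P]_x g x.
Proof.
move=> mD PD bf bg fg.
have bI : bmeas (\1_(~` D) : T -> R) by apply: bmeas_indic; exact: measurableC.
have [M fM] := bf.2; have [N gN] := bg.2.
(* Adding M + N off [D] does not change the integral and makes the inequality hold everywhere. *)
have -> : \int[P]_x g x = \int[P]_x (g x + (M + N) * \1_(~` D) x).
  rewrite bintD//; last by apply: bmeasM => //; exact: bmeas_cst.
  rewrite bintZl// integral_indic1; last exact: measurableC.
  by rewrite probability_setC// PD subee//= mulr0 addr0.
apply: le_bint => //.
  by apply: bmeasD => //; apply: bmeasM => //; exact: bmeas_cst.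
move=> x; rewrite indicE; have [Dx|nDx] := pselect (D x).
  by rewrite memNset ?mulr0 ?addr0 ?fg//; exact.
rewrite mem_set//= mulr1.
have := ler_norm (f x); have := fM x; have := gN x.
by have := ler_norm (- g x); rewrite normrN; lra.
Qed.

Lemma eq_integral_on (D : set T) f g : measurable D -> P D = 1%E ->
  bmeas f -> bmeas g -> (forall x, D x -> f x = g x) ->
  \int[P]_x f x = \int[P]_x g x.
Proof.
move=> mD PD bf bg fg; apply/eqP; rewrite eq_le.
by apply/andP; split; apply: (le_integral_on mD) => // x /fg ->.
Qed.

Lemma bounded_cvg_integral (F : nat -> T -> R) (f : T -> R) (M : R) :
  (forall n, measurable_fun setT (F n)) -> measurable_fun setT f ->
  (forall n x, `|F n x| <= M) ->
  (forall x, F n x @[n --> \oo] --> f x) ->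
  \int[P]_x F n x @[n --> \oo] --> \int[P]_x f x.
Proof.
move=> mF mf FM Ff.
have iM : P.-integrable setT (EFin \o cst M).
  by apply: bmeas_integrable; exact: bmeas_cst.
have fM x : `|f x| <= M.
  have h : `|F n x| @[n --> \oo] --> `|f x| by apply: cvg_norm; exact: Ff.
  rewrite -(cvg_lim _ h)//.
  by apply: limr_le; [apply/cvg_ex; eexists; exact: h | exact: nearW].
apply: fine_cvg; rewrite EFin_Rintegral; last by split => //; exists M.
have [] // := @dominated_convergence _ T R P setT measurableT
  (fun n x => (F n x)%:E) (EFin \o f) (EFin \o cst M).
- by move=> n; exact/measurable_EFinP.
- exact/measurable_EFinP.
- by apply: aeW => x _; apply: cvg_EFin; [exact: nearW|exact: Ff].
- by apply: aeW => x n _ /=; rewrite lee_fin.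
Qed.

End integral.

Lemma integral_distr d d' (T : measurableType d) (T' : measurableType d')
    (P : probability T R) (X : {mfun T >-> T'}) (f : T' -> R) : bmeas f ->
  \int[distribution P X]_x f x = \int[P]_x f (X x).
Proof.
move=> bf; rewrite /Rintegral integral_distribution//.
  exact/measurable_EFinP/bf.1.
exact: (bmeas_integrable P (bmeas_comp bf (measurable_funP X))).
Qed.

Section fubini.
Context d1 d2 (T1 : measurableType d1) (T2 : measurableType d2).
Variables (P1 : probability T1 R) (P2 : probability T2 R).
Variable f : T1 * T2 -> R.
Hypothesis bf : bmeas f.

Lemma bmeas_section1 x : bmeas (fun y => f (x, y)).
Proof. by apply: (bmeas_comp (k := fun y => (x, y)) bf); exact: pair1_measurable. Qed.

Lemma bmeas_section2 y : bmeas (fun x => f (x, y)).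
Proof. by apply: (bmeas_comp (k := fun x => (x, y)) bf); exact: pair2_measurable. Qed.

Lemma bmeas_integral2 : bmeas (fun x => \int[P2]_y f (x, y)).
Proof.
have [M fM] := bf.2; split; last first.
  by exists M => x; apply: normr_integral_le_cst => //; exact: bmeas_section1.
(* The measurability of partial integrals is obtained from integrability under a product measure; a
   Dirac mass supplies the first factor. *)
have inth : ((\d_ (point : T1) : probability T1 R) \x P2)%E.-integrable setT (EFin \o f).
  exact: bmeas_integrable bf.
apply/measurable_EFinP; rewrite (_ : _ \o _ = fubini_F P2 (EFin \o f)).
  exact: (measurable_fubini_F inth).
by apply/funext => x; rewrite /= EFin_Rintegral//; exact: bmeas_section1.
Qed.

Lemma bmeas_integral1 : bmeas (fun y => \int[P1]_x f (x, y)).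
Proof.
have [M fM] := bf.2; split; last first.
  by exists M => x; apply: normr_integral_le_cst => //; exact: bmeas_section2.
have inth : (P1 \x (\d_ (point : T2) : probability T2 R))%E.-integrable setT (EFin \o f).
  exact: bmeas_integrable bf.
apply/measurable_EFinP; rewrite (_ : _ \o _ = fubini_G P1 (EFin \o f)).
  exact: (measurable_fubini_G inth).
by apply/funext => x; rewrite /= EFin_Rintegral//; exact: bmeas_section2.
Qed.

Let intf : (P1 \x P2)%E.-integrable setT (EFin \o f).
Proof. exact: (bmeas_integrable (P1 \x P2)%E). Qed.

Lemma integral_prod12 :
  \int[(P1 \x P2)%E]_z f z = \int[P1]_x \int[P2]_y f (x, y).
Proof.
rewrite {1}/Rintegral -(integral12_prod_meas1 intf) /fubini_F.
by congr fine; apply: eq_integral => x _; rewrite EFin_Rintegral//; exact: bmeas_section1.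
Qed.

Lemma integral_prod21 :
  \int[(P1 \x P2)%E]_z f z = \int[P2]_y \int[P1]_x f (x, y).
Proof.
rewrite {1}/Rintegral -(integral21_prod_meas1 intf) /fubini_G.
by congr fine; apply: eq_integral => x _; rewrite EFin_Rintegral//; exact: bmeas_section2.
Qed.

Lemma integral_swap :
  \int[P1]_x \int[P2]_y f (x, y) = \int[P2]_y \int[P1]_x f (x, y).
Proof. by rewrite -integral_prod12 integral_prod21. Qed.

End fubini.

End bounded_measurable.

(** * Orthogonal invariance *)

Section dot_product.
Context {R : realType}.

Definition dot n (x y : 'cV[R]_n) : R := (x^T *m y) 0 0.

Section n_fixed.
Variable n : nat.
Implicit Types (x y z : 'cV[R]_n) (a : R).

Lemma dotE x y : dot x y = \sum_i x i 0 * y i 0.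
Proof. by rewrite /dot mxE; under eq_bigr do rewrite mxE. Qed.

Lemma dotC x y : dot x y = dot y x.
Proof. by rewrite !dotE; apply: eq_bigr => i _; rewrite mulrC. Qed.

Lemma dotDl x y z : dot (x + y) z = dot x z + dot y z.
Proof. by rewrite /dot raddfD/= mulmxDl mxE. Qed.

Lemma dotDr x y z : dot z (x + y) = dot z x + dot z y.
Proof. by rewrite dotC dotDl ![dot z _]dotC. Qed.

Lemma dotZl a x y : dot (a *: x) y = a * dot x y.
Proof. by rewrite /dot linearZ/= -scalemxAl mxE. Qed.

Lemma dotZr a x y : dot x (a *: y) = a * dot x y.
Proof. by rewrite dotC dotZl dotC. Qed.

Lemma dotNl x y : dot (- x) y = - dot x y.
Proof. by rewrite -scaleN1r dotZl mulN1r. Qed.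

Lemma dotNr x y : dot x (- y) = - dot x y.
Proof. by rewrite dotC dotNl dotC. Qed.

Lemma dotBl x y z : dot (x - y) z = dot x z - dot y z.
Proof. by rewrite dotDl dotNl. Qed.

Lemma dotBr x y z : dot z (x - y) = dot z x - dot z y.
Proof. by rewrite dotDr dotNr. Qed.

Lemma dot_ge0 x : 0 <= dot x x.
Proof. by rewrite dotE; apply: sumr_ge0 => i _; rewrite -expr2 sqr_ge0. Qed.

Lemma dot_eq0 x : (dot x x == 0) = (x == 0).
Proof.
apply/eqP/eqP => [|->]; last by rewrite /dot mulmx0 mxE.
rewrite dotE => /psumr_eq0P h; apply/matrixP => i j; rewrite ord1 mxE.
by apply/eqP; rewrite -sqrf_eq0 expr2 h// => k _; rewrite -expr2 sqr_ge0.
Qed.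

Lemma enorm_dot x : enorm x ^+ 2 = dot x x.
Proof.
rewrite /enorm sqr_sqrtr; first by rewrite dotE; apply: eq_bigr => i _; rewrite expr2.
by apply: sumr_ge0 => i _; rewrite sqr_ge0.
Qed.

Lemma dot_delta x i : dot x (delta_mx i 0) = x i 0.
Proof.
rewrite dotE (bigD1 i)//= big1 ?addr0 => [|j ji]; rewrite mxE !eqxx ?mulr1//=.
by rewrite (negbTE ji) mulr0.
Qed.

Lemma dot_const a x : dot x (const_mx a) = a * \sum_i x i 0.
Proof. by rewrite dotE mulr_sumr; apply: eq_bigr => i _; rewrite mxE mulrC. Qed.

End n_fixed.

Lemma dot_mulmx m n (A : 'M[R]_(m, n)) x y : dot (A *m x) y = dot x (A^T *m y).
Proof. by rewrite /dot trmx_mul mulmxA. Qed.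

Lemma dot_isometry m n (U : 'M[R]_(m, n)) x y : U^T *m U = 1%:M ->
  dot (U *m x) (U *m y) = dot x y.
Proof. by move=> UU; rewrite dot_mulmx mulmxA UU mul1mx. Qed.

Lemma measurable_dot n (x : 'cV[R]_n) : measurable_fun setT (fun y => dot y x).
Proof.
under eq_fun do rewrite dotE.
by apply: measurable_sum => i; apply: measurable_funM => //; exact: measurable_coord.
Qed.

Lemma measurable_dotr n (x : 'cV[R]_n) : measurable_fun setT (dot x).
Proof.
rewrite (_ : dot x = fun y => dot y x); first exact: measurable_dot.
by apply/funext => y; rewrite dotC.
Qed.

Lemma measurable_dot2 d (T : measurableType d) n (f g : T -> 'cV[R]_n) :
  measurable_fun setT f -> measurable_fun setT g ->
  measurable_fun setT (fun z => dot (f z) (g z)).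
Proof.
move=> mf mg; under eq_fun do rewrite dotE.
apply: measurable_sum => i; apply: measurable_funM.
  by apply: (measurableT_comp (@measurable_coord R n 1 i 0)).
by apply: (measurableT_comp (@measurable_coord R n 1 i 0)).
Qed.

(** Householder reflection in the hyperplane orthogonal to [v]. With [v = x - y] it exchanges two
    vectors of equal norm, with [v] a basis vector it flips a sign; these are the two ways in which
    invariance is exploited. *)
Definition reflection n (v : 'cV[R]_n) : 'M[R]_n :=
  1%:M - (2 / dot v v) *: (v *m v^T).

Lemma reflectionE n (v x : 'cV[R]_n) :
  reflection v *m x = x - (2 * dot v x / dot v v) *: v.
Proof.
rewrite /reflection mulmxBl mul1mx -scalemxAl -mulmxA.
rewrite (mx11_scalar (v^T *m x)) -/(dot v x) mul_mx_scalar scalerA.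
by rewrite mulrAC.
Qed.

Lemma reflection_isometry n (v : 'cV[R]_n) : v != 0 ->
  (reflection v)^T *m reflection v = 1%:M.
Proof.
move=> v0; have vv : dot v v != 0 by rewrite dot_eq0.
have -> : (reflection v)^T = reflection v.
  by rewrite /reflection linearB/= linearZ/= trmx_mul trmxK trmx1.
rewrite {2}/reflection mulmxBr mulmx1 -scalemxAr mulmxA reflectionE.
have -> : v - (2 * dot v v / dot v v) *: v = - v.
  by rewrite mulfK// scaler_nat mulr2n opprD addNKr.
by rewrite mulNmx scalerN opprK /reflection subrK.
Qed.

Lemma reflection_transitive n (x y : 'cV[R]_n) : dot x x = dot y y ->
  exists2 U : 'M[R]_n, U^T *m U = 1%:M & U *m x = y.
Proof.
move=> xy; have [->|xNy] := eqVneq x y.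
  by exists 1%:M; rewrite ?trmx1 mul1mx.
exists (reflection (x - y)).
  by apply: reflection_isometry; rewrite subr_eq0.
have vv : dot (x - y) (x - y) != 0 by rewrite dot_eq0 subr_eq0.
rewrite reflectionE.
have -> : 2 * dot (x - y) x / dot (x - y) (x - y) = 1.
  apply/eqP; rewrite -[X in _ == X](divff vv); apply/eqP; congr (_ / _).
  by rewrite !dotBl !dotBr xy (dotC y x); ring.
by rewrite scale1r subKr.
Qed.

Definition flip n (k : 'I_n) : 'M[R]_n := reflection (delta_mx k 0).

Lemma flip_isometry n (k : 'I_n) : (flip k)^T *m flip k = 1%:M.
Proof.
apply: reflection_isometry; apply/eqP => /matrixP/(_ k 0)/eqP.
by rewrite !mxE !eqxx oner_eq0.
Qed.

Lemma flipE n (k i : 'I_n) (x : 'cV[R]_n) :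
  (flip k *m x) i 0 = (if i == k then -1 else 1) * x i 0.
Proof.
rewrite reflectionE dotC !dot_delta !mxE !eqxx andbT divr1.
by case: eqVneq => [->|_] /=; rewrite ?mulr1 ?mulr0; ring.
Qed.

End dot_product.

Section rotation_invariance.
Context {R : realType}.

Definition rotation_invariant n (nu : probability 'cV[R]_n R) :=
  forall U : 'M[R]_n, U^T *m U = 1%:M ->
    forall A, measurable A -> distribution nu (mulmx U) A = nu A.

Variables (n : nat) (nu : probability 'cV[R]_n R).
Hypothesis nu_inv : rotation_invariant nu.

Lemma integral_rotation (U : 'M[R]_n) f : U^T *m U = 1%:M -> bmeas f ->
  \int[nu]_w f (U *m w) = \int[nu]_w f w.
Proof.
move=> UU bf; rewrite -(integral_distr nu (mulmx U) bf).
by congr fine; apply: eq_measure_integral => A mA _; exact: nu_inv.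
Qed.

(** A reflection carries [x] to [y] and preserves inner products when applied to both arguments, so
    the law of [dot w x] is a function of the norm of [x]. *)
Lemma integral_dot_norm (x y : 'cV[R]_n) (h : R -> R) : dot x x = dot y y ->
  bmeas h -> \int[nu]_w h (dot w x) = \int[nu]_w h (dot w y).
Proof.
move=> xy bh; have [U UU <-] := reflection_transitive xy.
have bhx z : bmeas (fun w : 'cV[R]_n => h (dot w z)).
  by apply: bmeas_comp => //; exact: measurable_dot.
rewrite -(integral_rotation UU (bhx (U *m x))).
by apply: eq_Rintegral => w _; rewrite dot_isometry.
Qed.

(** The law of [dot w x] is symmetric, so averaging over [x] and [- x] removes the sine term of the
    addition formula. *)
Lemma integral_cos_shift (x : 'cV[R]_n) th :
  \int[nu]_w cos (dot w x + th) = cos th * \int[nu]_w cos (dot w x).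
Proof.
have bc z s : bmeas (fun w : 'cV[R]_n => cos (dot w z + s)).
  by apply: bmeas_cos; apply: measurable_funD => //; exact: measurable_dot.
have bcx : bmeas (fun w : 'cV[R]_n => cos (dot w x)).
  by apply: bmeas_cos; exact: measurable_dot.
have E : \int[nu]_w cos (dot w (- x) + th) = \int[nu]_w cos (dot w x + th).
  apply: (@integral_dot_norm (- x) x (fun s => cos (s + th))).
    by rewrite dotNl dotNr opprK.
  by apply: bmeas_cos; apply: measurable_funD.
have -> : \int[nu]_w cos (dot w x + th) =
    2^-1 * (\int[nu]_w cos (dot w x + th) + \int[nu]_w cos (dot w (- x) + th)).
  by rewrite E; field.
rewrite -bintD// -bintZl// -bintZl; last exact: bmeasD.
by apply: eq_Rintegral => w _; rewrite dotNr !cosD cosN sinN; field.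
Qed.

End rotation_invariance.

(** * Moments and characteristic function of a rotation-invariant law on a sphere *)

Section sphere_moments.
Context {R : realType}.
Variables (n : nat) (nu : probability 'cV[R]_n R) (T : R).
Hypothesis nu_inv : rotation_invariant nu.

Let S : set 'cV[R]_n := [set w | dot w w = T].
Hypothesis nuS : nu S = 1%E.
Hypothesis n_gt0 : (0 < n)%N.

Lemma measurable_sphere : measurable S.
Proof.
rewrite (_ : S = (fun w => dot w w) @^-1` [set T])//.
by rewrite -[X in measurable X]setTI; apply: measurable_dot2.
Qed.

(* Bounded, and equal to [w] almost surely. *)
Let u (w : 'cV[R]_n) : 'cV[R]_n := \1_S w *: w.

Let u_rot (U : 'M[R]_n) w : U^T *m U = 1%:M -> u (U *m w) = U *m u w.
Proof.
move=> UU; rewrite /u -scalemxAr; congr (_ *: _).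
rewrite !indicE (_ : (U *m w \in S) = (w \in S))//.
by apply/idP/idP; rewrite !inE /S/= dot_isometry.
Qed.

Let bmeas_u i : bmeas (fun w => u w i 0).
Proof.
split.
  under eq_fun do rewrite mxE.
  apply: measurable_funM; last exact: measurable_coord.
  by apply: measurable_indic; exact: measurable_sphere.
exists (1 + `|T|) => w; rewrite /u mxE indicE.
have [|_] := boolP (w \in S); last by rewrite mul0r normr0 addr_ge0.
rewrite inE /S/= => wT; rewrite mul1r.
have wiT : w i 0 ^+ 2 <= T.
  rewrite -wT dotE (bigD1 i)//= -expr2 lerDl sumr_ge0// => j _.
  by rewrite -expr2 sqr_ge0.
have : w i 0 ^+ 2 <= `|T| := le_trans wiT (ler_norm T).
rewrite -real_normK ?num_real//.
by have := normr_ge0 (w i 0); set a := `|w i 0|; nra.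
Qed.

Let bmeas_dotu x : bmeas (fun w => dot (u w) x).
Proof.
under eq_fun do rewrite dotE.
by apply: bmeas_sum => i; apply: bmeasM => //; exact: bmeas_cst.
Qed.

Let pow_dotu k x y : dot x x = dot y y ->
  \int[nu]_w dot (u w) x ^+ k = \int[nu]_w dot (u w) y ^+ k.
Proof.
move=> xy; have [U UU <-] := reflection_transitive xy.
rewrite -(@integral_rotation _ _ _ nu_inv U (fun w => dot (u w) (U *m x) ^+ k))//; last first.
  exact: bmeasX.
by apply: eq_Rintegral => w _; rewrite u_rot// dot_isometry.
Qed.

Let dot_uu w : \sum_i u w i 0 ^+ 2 = T * \1_S w.
Proof.
have -> : \sum_i u w i 0 ^+ 2 = dot (u w) (u w).
  by rewrite dotE; apply: eq_bigr => i _; rewrite expr2.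
rewrite dotZl dotZr indicE; have [|_] := boolP (w \in S); last by rewrite !mul0r mulr0.
by rewrite inE /S/= => ->; rewrite !mul1r mulr1.
Qed.

Let int_S : \int[nu]_w (\1_S w : R) = 1.
Proof. by rewrite integral_indic1 ?nuS//; exact: measurable_sphere. Qed.

Let i0 := Ordinal n_gt0.

Let pow_dotu_scale k x :
  \int[nu]_w dot (u w) x ^+ k =
  Num.sqrt (dot x x) ^+ k * \int[nu]_w u w i0 0 ^+ k.
Proof.
rewrite (@pow_dotu k x (Num.sqrt (dot x x) *: delta_mx i0 0)).
  rewrite -bintZl; last exact: bmeasX.
  by apply: eq_Rintegral => w _; rewrite dotZr dot_delta exprMn.
by rewrite dotZl dotZr dot_delta mxE !eqxx mulr1 -expr2 sqr_sqrtr// dot_ge0.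
Qed.

Let coord_pow k i : \int[nu]_w u w i 0 ^+ k = \int[nu]_w u w i0 0 ^+ k.
Proof.
under eq_Rintegral do rewrite -dot_delta.
by rewrite pow_dotu_scale dot_delta mxE !eqxx sqrtr1 expr1n mul1r.
Qed.

Let n_neq0 : n%:R != 0 :> R.
Proof. by rewrite pnatr_eq0 -lt0n. Qed.

(** The coordinates have equal second moments and their squares add up to [T]. *)
Let moment2_coord : \int[nu]_w u w i0 0 ^+ 2 = T / n%:R.
Proof.
apply: (mulIf n_neq0); rewrite mulfVK//.
have <- : \int[nu]_w \sum_i u w i 0 ^+ 2 = T.
  under eq_Rintegral do rewrite dot_uu.
  by rewrite bintZl ?int_S ?mulr1//; apply: bmeas_indic; exact: measurable_sphere.
rewrite bint_sum; last by move=> i; exact: bmeasX.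
under eq_bigr do rewrite coord_pow.
by rewrite sumr_const card_ord mulr_natr.
Qed.

(** The directions e_i + e_j and e_i - e_j have norm sqrt 2, hence fourth moment 4 m, where m is
    that of a coordinate. Adding (a + b)^4 and (a - b)^4 gives 8 m = 4 m + 12 E (a^2 b^2). *)
Let moment4_mixed i j : i != j ->
  \int[nu]_w (u w i 0 ^+ 2 * u w j 0 ^+ 2) = (\int[nu]_w u w i0 0 ^+ 4) / 3.
Proof.
move=> ij; have b22 : bmeas (fun w => u w i 0 ^+ 2 * u w j 0 ^+ 2).
  by apply: bmeasM; exact: bmeasX.
pose x : 'cV[R]_n := delta_mx i 0 + delta_mx j 0.
pose y : 'cV[R]_n := delta_mx i 0 - delta_mx j 0.
have dd k l : dot (delta_mx k 0) (delta_mx l 0) = (k == l)%:R :> R.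
  by rewrite dot_delta mxE eqxx andbT eq_sym.
have xx : dot x x = 2.
  by rewrite dotDl !dotDr !dd !eqxx [j == i]eq_sym (negbTE ij) /=; ring.
have yy : dot y y = 2.
  by rewrite dotBl !dotBr !dd !eqxx [j == i]eq_sym (negbTE ij) /=; ring.
have s4 : Num.sqrt (2 : R) ^+ 4 = 4 by rewrite (exprM _ 2 2) sqr_sqrtr//; ring.
have bX k z : bmeas (fun w => dot (u w) z ^+ k) by exact: bmeasX.
have := pow_dotu_scale 4 x; rewrite xx s4 => ex.
have := pow_dotu_scale 4 y; rewrite yy s4 => ey.
have E : \int[nu]_w (dot (u w) x ^+ 4 + dot (u w) y ^+ 4) =
  \int[nu]_w (2 * u w i 0 ^+ 4 + 2 * u w j 0 ^+ 4
     + 12 * (u w i 0 ^+ 2 * u w j 0 ^+ 2)).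
  by apply: eq_Rintegral => w _; rewrite dotDr dotBr !dot_delta; ring.
have b4 k : bmeas (fun w => 2 * u w k 0 ^+ 4).
  by apply: bmeasM; [exact: bmeas_cst|exact: bmeasX].
have I4 k : \int[nu]_w (2 * u w k 0 ^+ 4) = 2 * \int[nu]_w u w i0 0 ^+ 4.
  by rewrite bintZl ?coord_pow//; exact: bmeasX.
rewrite bintD// ex ey bintD ?bintD// ?I4 in E; last 2 first.
- exact: bmeasD.
- by apply: bmeasM => //; exact: bmeas_cst.
rewrite bintZl// in E.
move: E; set a := Rintegral _ _ _; set b := Rintegral _ _ _ => E.
by lra.
Qed.

(** The square of the sum of the squared coordinates has mean T^2. Its n^2 terms have mean m / 3 off
    the diagonal and m >= m / 3 on it, so n^2 m / 3 <= T^2. The exact value is m = 3 T^2 / (n (n +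
    2)). *)
Let moment4_coord : \int[nu]_w u w i0 0 ^+ 4 <= 3 * (T / n%:R) ^+ 2.
Proof.
set m := Rintegral _ _ _.
have m0 : 0 <= m by apply: Rintegral_ge0 => w _; rewrite exprn_even_ge0.
have b22 i j : bmeas (fun w => u w i 0 ^+ 2 * u w j 0 ^+ 2).
  by apply: bmeasM; exact: bmeasX.
have E : \int[nu]_w \sum_i \sum_j (u w i 0 ^+ 2 * u w j 0 ^+ 2) = T ^+ 2.
  transitivity (\int[nu]_w (T ^+ 2 * \1_S w)).
    apply: eq_Rintegral => w _; rewrite -big_distrlr/= dot_uu indicE.
    by case: (w \in S) => /=; ring.
  by rewrite bintZl ?int_S ?mulr1//; apply: bmeas_indic; exact: measurable_sphere.
rewrite bint_sum in E; last by move=> i; exact: bmeas_sum.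
have : \sum_(i < n) \sum_(j < n) m / 3 <= T ^+ 2.
  rewrite -E; apply: ler_sum => i _; rewrite bint_sum//; apply: ler_sum => j _.
  have [<-|ij] := eqVneq i j; last by rewrite moment4_mixed.
  under [leRHS]eq_Rintegral do rewrite -exprD.
  rewrite coord_pow -/m; lra.
rewrite !sumr_const card_ord -mulrnA -[X in X <= _]mulr_natr natrM => h.
have n2 : 0 < (n%:R * n%:R : R) by rewrite mulr_gt0// ltr0n.
by rewrite expr_div_n mulrA [n%:R ^+ 2]expr2 ler_pdivlMr//; lra.
Qed.

Lemma sphere_moment2 x : \int[nu]_w dot (u w) x ^+ 2 = T * dot x x / n%:R.
Proof.
by rewrite pow_dotu_scale moment2_coord sqr_sqrtr ?dot_ge0//; ring.
Qed.

Lemma sphere_moment4 x :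
  \int[nu]_w dot (u w) x ^+ 4 <= 3 * (T * dot x x / n%:R) ^+ 2.
Proof.
rewrite pow_dotu_scale (exprM _ 2 2) sqr_sqrtr ?dot_ge0//.
rewrite (_ : _ * _ / _ = dot x x * (T / n%:R)); last by ring.
rewrite exprMn mulrCA ler_wpM2l ?exprn_even_ge0//; exact: moment4_coord.
Qed.

Let u_on w x : S w -> dot (u w) x = dot w x.
Proof. by move=> Sw; rewrite /u indicE mem_set// scale1r. Qed.

Let coord_on w i : S w -> u w i 0 = w i 0.
Proof. by move=> Sw; rewrite -!dot_delta u_on. Qed.

(* Flipping the sign of the [k]-th coordinate and averaging turns
   [cos (c w_k + s)] into [cos (c w_k) * cos s]. *)
Let integral_cos_prod c (k : nat) : (k <= n)%N ->
  \int[nu]_w cos (c * \sum_i w i 0) =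
  \int[nu]_w (\prod_(i < n | (i < k)%N) cos (c * w i 0) *
              cos (c * \sum_(i < n | (k <= i)%N) w i 0)).
Proof.
elim: k => [_|k IH kn].
  by apply: eq_Rintegral => w _; rewrite [X in _ = X * _]big_pred0 ?mul1r//.
rewrite (IH (ltnW kn)); pose k' := Ordinal kn.
pose s (w : 'cV[R]_n) := \sum_(i < n | (k < i)%N) w i 0.
pose p (w : 'cV[R]_n) := \prod_(i < n | (i < k)%N) cos (c * w i 0).
have sE (w : 'cV[R]_n) : \sum_(i < n | (k <= i)%N) w i 0 = w k' 0 + s w.
  rewrite (bigD1 k')//=; congr (_ + _); apply: eq_bigl => i.
  by rewrite ltn_neqAle andbC eq_sym.
have pE (w : 'cV[R]_n) : \prod_(i < n | (i < k.+1)%N) cos (c * w i 0) = cos (c * w k' 0) * p w.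
  rewrite (bigD1 k')//=; congr (_ * _); apply: eq_bigl => i.
  by rewrite ltnS [RHS]ltn_neqAle andbC.
have ms : measurable_fun setT s.
  rewrite /s; under eq_fun do rewrite big_mkcond/=.
  apply: measurable_sum => i; case: (k < i)%N; first exact: measurable_coord.
  exact: measurable_cst.
have bp : bmeas p.
  rewrite /p; under eq_fun do rewrite big_mkcond/=.
  apply: bmeas_prod => i; case: (i < k)%N; last exact: bmeas_cst.
  by apply: bmeas_cos; apply: measurable_funM => //; exact: measurable_coord.
pose F w := p w * cos (c * (w k' 0 + s w)).
have bF : bmeas F.
  apply: bmeasM => //; apply: bmeas_cos; apply: measurable_funM => //.
  by apply: measurable_funD => //; exact: measurable_coord.
have bFU : bmeas (fun w => F (flip k' *m w)).
  by apply: (bmeas_comp bF); exact: measurable_mulmx.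
transitivity (\int[nu]_w F w).
  by apply: eq_Rintegral => w _; rewrite sE.
have -> : \int[nu]_w F w = 2^-1 * \int[nu]_w (F w + F (flip k' *m w)).
  by rewrite bintD// (integral_rotation nu_inv (flip_isometry k') bF); field.
rewrite -bintZl; last exact: bmeasD.
apply: eq_Rintegral => w _; rewrite pE -/(s w) /F flipE eqxx.
have -> : s (flip k' *m w) = s w.
  by apply: eq_bigr => i ki; rewrite flipE -val_eqE/= gtn_eqF// mul1r.
have -> : p (flip k' *m w) = p w.
  by apply: eq_bigr => i ki; rewrite flipE -val_eqE/= ltn_eqF// mul1r.
have -> : c * (-1 * w k' 0 + s w) = c * s w - c * w k' 0 by ring.
by rewrite [c * (w k' 0 + s w)]mulrDr cosD cosB; field.
Qed.

(** By invariance [x] is traded for the vector with all coordinates [c], and sign flips turn the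
    integrand into a product of the cos (c w_i). The product of the Gaussian factors exp (- (c
    w_i)^2 / 2) equals exp (- a / 2) everywhere on the sphere, and [dist_prod_le] bounds the
    difference by c^4 times n fourth moments. *)
Lemma sphere_cos x a : a = T * dot x x / n%:R ->
  `|\int[nu]_w cos (dot w x) - expR (- (a / 2))| <= 3 * a ^+ 2 / n%:R.
Proof.
move=> aE; set c := Num.sqrt (dot x x / n%:R).
have c2 : c ^+ 2 = dot x x / n%:R.
  by rewrite sqr_sqrtr// divr_ge0// dot_ge0.
have bcosw i : bmeas (fun w : 'cV[R]_n => cos (c * w i 0)).
  by apply: bmeas_cos; apply: measurable_funM => //; exact: measurable_coord.
have -> : \int[nu]_w cos (dot w x) = \int[nu]_w \prod_i cos (c * w i 0).
  rewrite (@integral_dot_norm _ _ _ nu_inv _ (const_mx c) cos); first last.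
  - by apply: bmeas_cos.
  - rewrite [RHS]dotE; under [RHS]eq_bigr do rewrite !mxE.
    by rewrite sumr_const card_ord -expr2 c2 -[RHS]mulr_natr mulfVK.
  under eq_Rintegral do rewrite dot_const.
  rewrite (integral_cos_prod c (leqnn n)); apply: eq_Rintegral => w _.
  rewrite [X in cos (c * X)]big_pred0; last by move=> i; rewrite leqNgt ltn_ord.
  by rewrite mulr0 cos0 mulr1; apply: eq_bigl => i; rewrite ltn_ord.
have -> : expR (- (a / 2)) = \int[nu]_w expR (- (a / 2)) by rewrite bint_cst.
have bexp : bmeas (fun _ : 'cV[R]_n => expR (- (a / 2))) by exact: bmeas_cst.
have bprod := bmeas_prod (index_enum 'I_n) bcosw.
apply: le_trans (normr_integralB_le _ bprod bexp) _.
have bsum : bmeas (fun w => \sum_i c ^+ 4 * u w i 0 ^+ 4).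
  by apply: bmeas_sum => i; apply: bmeasM; [exact: bmeas_cst|exact: bmeasX].
apply: (@le_trans _ _ (\int[nu]_w \sum_i c ^+ 4 * u w i 0 ^+ 4)).
  apply: (le_integral_on measurable_sphere nuS) => //.
    by apply: bmeas_norm; exact: bmeasB.
  move=> w Sw; have -> : expR (- (a / 2)) = \prod_i expR (- ((c * w i 0) ^+ 2 / 2)).
    rewrite -expR_sum; congr expR; rewrite sumrN; congr (- _).
    rewrite -mulr_suml; congr (_ / 2); under eq_bigr do rewrite exprMn.
    rewrite -mulr_sumr c2 aE -(_ : dot w w = T)// [dot w w]dotE.
    by under [in RHS]eq_bigr do rewrite expr2; ring.
  apply: le_trans (@dist_prod_le R 'I_n (index_enum 'I_n) (fun i => cos (c * w i 0))
    (fun i => expR (- ((c * w i 0) ^+ 2 / 2))) _ _) _ => [i|i|].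
  - exact: cos_max.
  - by rewrite ger0_norm ?expR_ge0// expR_le1 oppr_le0 divr_ge0// sqr_ge0.
  - by apply: ler_sum => i _; rewrite coord_on// -exprMn; exact: cos_expR.
rewrite bint_sum => [|i]; last by apply: bmeasM; [exact: bmeas_cst|exact: bmeasX].
have I4 i : \int[nu]_w (c ^+ 4 * u w i 0 ^+ 4) = c ^+ 4 * \int[nu]_w u w i0 0 ^+ 4.
  by rewrite bintZl ?coord_pow//; exact: bmeasX.
under eq_bigr do rewrite I4.
rewrite sumr_const card_ord -[X in X <= _]mulr_natl (exprM c 2 2) c2.
set m := Rintegral _ _ _.
have -> : 3 * a ^+ 2 / n%:R = n%:R * ((dot x x / n%:R) ^+ 2 * (3 * (T / n%:R) ^+ 2)).
  by rewrite aE; field.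
rewrite ler_pM2l ?ltr0n//; apply: ler_wpM2l; first exact: sqr_ge0.
exact: moment4_coord.
Qed.

(* Paley-Zygmund type bound, from [min 1 t >= t - t^2 / 4]. *)
Lemma sphere_min x (kappa a : R) : 0 <= kappa -> a = kappa * (T * dot x x / n%:R) ->
  a - 3 / 4 * a ^+ 2 <= \int[nu]_w Num.min 1 (kappa * dot w x ^+ 2).
Proof.
move=> k0 aE.
have bmin (v : 'cV[R]_n -> 'cV[R]_n) : measurable_fun setT v ->
    bmeas (fun w => Num.min 1 (kappa * dot (v w) x ^+ 2)).
  move=> mv; apply: bmeas_min => //.
    apply: measurable_funM => //; apply: measurable_funX.
    by apply: measurable_dot2.
  by move=> w; rewrite mulr_ge0// sqr_ge0.
have b2 : bmeas (fun w => kappa * dot (u w) x ^+ 2).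
  by apply: bmeasM; [exact: bmeas_cst|exact: bmeasX].
have b4 : bmeas (fun w => kappa ^+ 2 / 4 * dot (u w) x ^+ 4).
  by apply: bmeasM; [exact: bmeas_cst|exact: bmeasX].
apply: (@le_trans _ _ (\int[nu]_w (kappa * dot (u w) x ^+ 2 - kappa ^+ 2 / 4 * dot (u w) x ^+ 4))).
  rewrite bintB// !bintZl; [|exact: bmeasX|exact: bmeasX].
  rewrite sphere_moment2 -aE; have := sphere_moment4 x.
  set m := Rintegral _ _ _ => h.
  have : kappa ^+ 2 / 4 * m <= kappa ^+ 2 / 4 * (3 * (T * dot x x / n%:R) ^+ 2).
    by apply: ler_wpM2l h; rewrite divr_ge0// sqr_ge0.
  have -> : a ^+ 2 = kappa ^+ 2 * (T * dot x x / n%:R) ^+ 2 by rewrite aE exprMn.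
  by move: (kappa ^+ 2) ((T * dot x x / n%:R) ^+ 2) => k2 t2; lra.
apply: (le_integral_on measurable_sphere nuS).
- exact: bmeasB.
- apply: (bmin id); exact: measurable_id.
move=> w Sw; rewrite u_on//.
rewrite (exprM _ 2 2) -[_ / 4 * _]mulrAC -exprMn; set t := kappa * _.
rewrite le_min; apply/andP; split; last by rewrite gerBl divr_ge0// sqr_ge0.
by have := sqr_ge0 (t / 2 - 1); rewrite sqrrB1 expr_div_n; lra.
Qed.

End sphere_moments.

(** * Gaussian kernels *)

Section normal_integral.
Context {R : realType}.
Notation mu := (@lebesgue_measure R).
Notation N := (normal_prob (0 : R) 1).

(** The Radon-Nikodym derivative of the normal law is determined almost everywhere by its integrals
    over measurable sets, hence equals the Gaussian density. *)
Lemma integral_normal_prob (f : R -> \bar R) : measurable_fun setT f ->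
  (\int[N]_x `|f x| < +oo)%E ->
  (\int[N]_x f x = \int[mu]_x (f x * (normal_pdf 0 1 x)%:E))%E.
Proof.
move=> mf finf; pose dom := @normal_prob_dominates R 0 1.
rewrite -(Radon_Nikodym_change_of_variables dom)//=; last first.
  by apply/integrableP; split.
apply: ae_eq_integral => //.
- exact: emeasurable_funM.
- apply: emeasurable_funM => //=; apply/measurableT_comp => //=.
  exact: measurable_normal_pdf.
- apply: ae_eqe_mul2l => /=.
  rewrite Radon_NikodymE//=; case: cid => /= h [h1 h2 h3].
  apply: integral_ae_eq => //=.
  + by apply/measurableT_comp =>//; exact: measurable_normal_pdf.
  + by move=> E E01 mE; rewrite -h3.
Qed.

Lemma normal_pdf01 x : normal_pdf 0 1 x = normal_peak 1 * expR (- (x ^+ 2 / 2)) :> R.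
Proof.
rewrite normal_pdfE ?oner_neq0// /normal_fun subr0 expr1n mulNr.
by rewrite mulr2n.
Qed.

Lemma integral_normal_bmeas (f : R -> R) : bmeas f ->
  \int[N]_x f x = \int[mu]_x (f x * normal_pdf 0 1 x).
Proof.
move=> bf; rewrite /Rintegral integral_normal_prob//.
- by apply/measurable_EFinP; case: bf.
- have bn := bmeas_norm bf.
  have -> : (\int[N]_x `|(f x)%:E| = (\int[N]_x `|f x|)%:E)%E by rewrite EFin_Rintegral.
  exact: ltry.
Qed.

(** Since |x| <= 1 + x^2/4 <= exp (x^2/4), the function |x| exp (- x^2/2) is dominated by exp (-
    x^2/4), a multiple of the density of variance 2. *)
Lemma integrable_abs_normal_pdf :
  mu.-integrable setT (fun x : R => (x * normal_pdf 0 1 x)%:E).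
Proof.
have s2 : Num.sqrt 2 != 0 :> R by rewrite sqrtr_eq0 -ltNge.
pose c : R := normal_peak 1 / normal_peak (Num.sqrt 2).
have c0 : 0 <= c by rewrite divr_ge0// normal_peak_ge0.
have := @integrable_normal_pdf R 0 (Num.sqrt 2).
move/(integrableZl measurableT c); apply: le_integrable => //.
  apply/measurable_EFinP; apply: measurable_funM => //.
  exact: measurable_normal_pdf.
move=> x _; rewrite -EFinM !abse_EFin lee_fin.
rewrite [leRHS]ger0_norm ?mulr_ge0 ?normal_pdf_ge0 ?normal_peak_ge0 ?invr_ge0 ?normal_peak_ge0//.
rewrite normrM [X in _ * X]ger0_norm ?normal_pdf_ge0// normal_pdf01.
rewrite (normal_pdfE _ s2) /normal_fun subr0 sqr_sqrtr// /c [leRHS]mulrA divfK; last first.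
  by rewrite gt_eqF// normal_peak_gt0.
rewrite mulrCA ler_wpM2l ?normal_peak_ge0//.
have -> : - x ^+ 2 / (2 *+ 2) = - (x ^+ 2 / 4) by rewrite mulr2n; field.
have -> : expR (- (x ^+ 2 / 2)) = expR (- (x ^+ 2 / 4)) * expR (- (x ^+ 2 / 4)).
  by rewrite -expRD; congr expR; field.
rewrite mulrA ler_piMl ?expR_ge0// expRN ler_pdivrMr ?expR_gt0// mul1r.
apply: le_trans (expR_ge1Dx _).
rewrite -(real_normK (num_real x)); have := sqr_ge0 (`|x| / 2 - 1).
by rewrite sqrrB1 expr_div_n; lra.
Qed.

Variable th : R.

Let p : R -> R := normal_pdf (0 : R) 1.

Let measurable_trig (f : R -> R) t : continuous f ->
  measurable_fun setT (fun x : R => f (t * x + th)).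
Proof.
move=> cf; apply: (measurableT_comp (continuous_measurable_fun cf)).
by apply: measurable_funD => //; exact: measurable_funM.
Qed.

Let integrable_trig (f : R -> R) t : continuous f -> (forall x, `|f x| <= 1) ->
  mu.-integrable setT (EFin \o (fun x => f (t * x + th) * p x)) /\
  mu.-integrable setT (EFin \o (fun x => x * f (t * x + th) * p x)).
Proof.
move=> cf f1; split.
- apply: le_integrable (@integrable_normal_pdf R 0 1) => //.
    apply/measurable_EFinP; apply: measurable_funM; first exact: measurable_trig.
    exact: measurable_normal_pdf.
  by move=> x _; rewrite /= lee_fin normrM ler_piMl.
- apply: le_integrable integrable_abs_normal_pdf => //.
    apply/measurable_EFinP; apply: measurable_funM; last exact: measurable_normal_pdf.
    by apply: measurable_funM => //; exact: measurable_trig.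
  by move=> x _; rewrite /= lee_fin 2!normrM [leRHS]normrM ler_wpM2r// ler_piMr.
Qed.

Let dp (x : R) : is_derive x (1 : R) p (- x * p x).
Proof.
have -> : p = fun x => normal_peak 1 * expR (- (x ^+ 2 / 2)).
  by apply/funext => y; exact: normal_pdf01.
by apply: is_derive_eq; rewrite /GRing.scale/=; field.
Qed.

Let dsin (t x : R) : is_derive x 1 (fun x => sin (t * x + th)) (t * cos (t * x + th)).
Proof. by apply: is_derive_eq; rewrite /GRing.scale/=; ring. Qed.

(** Stein's identity: the integrand is the derivative of sin (t x + th) p(x), which vanishes at both
    ends of the line. *)
Let by_parts t :
  \int[mu]_x (t * (cos (t * x + th) * p x) - x * sin (t * x + th) * p x) = 0.
Proof.
set f := fun x => _; pose F x := sin (t * x + th) * p x.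
have dF (x : R) : is_derive x (1 : R) F (f x).
  apply: is_derive_eq; first exact: (is_deriveM (dsin t x) (dp x)).
  by rewrite /GRing.scale/= /f; ring.
have [icos _] := integrable_trig t (@continuous_cos R) (@cos_max R).
have [_ isin] := integrable_trig t (@continuous_sin R) (@sin_max R).
have intf : mu.-integrable setT (EFin \o f).
  rewrite (_ : _ \o _ = fun x => ((t%:E * (cos (t * x + th) * p x)%:E)
      - (x * sin (t * x + th) * p x)%:E)%E).
    by apply: integrableB => //; apply: integrableZl.
  by apply/funext => x.
(* The intervals [- a n, a n] exhaust the line, and (a n)^2 / 2 >= n bounds the boundary terms by a
   multiple of exp (- n). *)
pose a n : R := n.+1%:R *+ 2.
have cvg0 : F (a n) - F (- a n) @[n --> \oo] --> (0 : R).
  have b0 : normal_peak 1 *+ 2 * expR (- n%:R) @[n --> \oo] --> (0 : R).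
    by rewrite -[X in _ --> X](mulr0 (normal_peak 1 *+ 2)); apply: cvgM; [exact: cvg_cst|exact: cvgn_expR].
  apply: norm_cvg0; apply: squeeze_cvgr (cvg_cst 0) b0.
  apply: nearW => n; rewrite normr_ge0 /= (le_trans (ler_normB _ _))//.
  have Fle s : s ^+ 2 = a n ^+ 2 -> `|F s| <= normal_peak 1 * expR (- n%:R).
    move=> sE; rewrite /F normrM (le_trans (ler_piMl _ (sin_max _)))//.
    rewrite ger0_norm ?normal_pdf_ge0// /p normal_pdf01 ler_wpM2l ?normal_peak_ge0//.
    rewrite ler_expR lerN2 sE /a -mulr_natr -natr1.
    by have := ler0n R n; nra.
  by rewrite mulr2n mulrDl lerD// Fle// sqrrN.
have FTC n : \int[mu]_(x in `[- a n, a n]) f x = F (a n) - F (- a n).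
  have an : 0 < a n by rewrite /a pmulrn_lgt0.
  have cF : continuous F.
    by move=> x; apply: differentiable_continuous; apply/derivable1_diffP; case: (dF x).
  have cf : continuous f.
    have cp : continuous p.
      by move=> x; apply: differentiable_continuous; apply/derivable1_diffP; case: (dp x).
    have cl (x : R) : {for x, continuous (fun x => t * x + th)}.
      by apply: cvgD; [apply: cvgM; [exact: cvg_cst|exact: cvg_id]|exact: cvg_cst].
    have cc (x : R) : {for x, continuous (fun x => cos (t * x + th))}.
      by apply: (continuous_comp (cl x)); exact: continuous_cos.
    have cs (x : R) : {for x, continuous (fun x => sin (t * x + th))}.
      by apply: (continuous_comp (cl x)); exact: continuous_sin.
    move=> x; apply: cvgB.
      by apply: cvgM; [exact: cvg_cst|apply: cvgM; [exact: cc|exact: cp]].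
    by apply: cvgM; [apply: cvgM; [exact: cvg_id|exact: cs]|exact: cp].
  rewrite /Rintegral (@continuous_FTC2 _ f F)//.
  - by rewrite (lt_trans _ an)// oppr_lt0.
  - exact: continuous_subspaceT.
  - split.
    + by move=> x _; case: (dF x).
    + by apply: cvg_at_right_filter; exact: cF.
    + by apply: cvg_at_left_filter; exact: cF.
  - by move=> x _; rewrite derive1E; apply: derive_val.
have lim : \int[mu]_(x in `[- a n, a n]) f x @[n --> \oo] --> \int[mu]_x f x.
  apply: fine_cvg; rewrite /Rintegral fineK; last exact: integrable_fin_num.
  under eq_fun do rewrite integral_mkcond.
  have mf : measurable_fun setT (EFin \o f) := measurable_int mu intf.
  have [] // := @dominated_convergence _ _ R mu setT measurableT
    (fun n => (EFin \o f) \_ `[- a n, a n]) (EFin \o f) (abse \o (EFin \o f)).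
  - by move=> n; apply/(measurable_restrictT _ _).1 => //; apply: measurable_funTS.
  - apply: aeW => x _; apply: cvg_near_cst; near=> n.
    rewrite patchE mem_set//= in_itv/= -ler_norml.
    have : `|x| <= n%:R by near: n; exact: nbhs_infty_ger.
    move=> /le_trans; apply; rewrite /a -mulr_natr -natr1.
    by have := ler0n R n; lra.
  - exact: integrable_abse.
  - apply: aeW => x n _; rewrite patchE; case: ifP => //= _.
    by rewrite normr0 lee_fin.
have lim0 : \int[mu]_(x in `[- a n, a n]) f x @[n --> \oo] --> (0 : R).
  by rewrite (_ : (fun _ => _) = (fun n => F (a n) - F (- a n))) //; apply/funext.
exact: (cvg_unique _ lim lim0).
Unshelve. all: by end_near. Qed.

(** As a function of t the integral solves h' = - t h, by differentiation under the integral sign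
    and [by_parts]; hence h(t) exp (t^2/2) keeps its value cos th at t = 0. *)
Lemma normal_cos_shift t : \int[N]_x cos (t * x + th) = cos th * expR (- (t ^+ 2 / 2)).
Proof.
pose h t := \int[mu]_x (cos (t * x + th) * p x).
have intc t' := (integrable_trig t' (@continuous_cos R) (@cos_max R)).1.
have ints t' := (integrable_trig t' (@continuous_sin R) (@sin_max R)).2.
pose fc (t x : R) : R := cos (t * x + th) * p x.
have dcos (x t' : R) : is_derive t' (1 : R) (fc ^~ x) (- (x * sin (t' * x + th) * p x)).
  by rewrite /fc; apply: is_derive_eq; rewrite /GRing.scale/=; ring.
have dh (t' : R) : is_derive t' (1 : R) h (- t' * h t').
  have I0 : `]t' - 1, t' + 1[%classic t' by rewrite /= in_itv/= ltrBlDr ltrDl ltr01.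
  pose G (x : R) : R := `|x * p x|.
  have G0 x : 0 <= G x by exact: normr_ge0.
  have iG : mu.-integrable setT (EFin \o G).
    by have := integrable_abse integrable_abs_normal_pdf.
  have df (s x : R) : `]t' - 1, t' + 1[%classic s -> setT x -> derivable (fc ^~ x) s (1 : R).
    by move=> _ _; case: (dcos x s).
  have Gub (s x : R) : `]t' - 1, t' + 1[%classic s -> setT x -> `|partial1of2 fc s x| <= G x.
    move=> _ _; rewrite partial1of2E derive_val normrN /G !normrM.
    by rewrite ler_wpM2r// ler_piMr// sin_max.
  have intf s : `]t' - 1, t' + 1[%classic s -> mu.-integrable setT (EFin \o fc s).
    by move=> _; exact: intc.
  apply: DeriveDef.
    exact: (derivable_under_integral measurableT I0 intf df G0 iG Gub).
  rewrite -derive1E.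
  rewrite (differentiation_under_integral measurableT I0 intf df G0 iG Gub).
  under eq_Rintegral do rewrite partial1of2E derive_val.
  have := by_parts t'; rewrite RintegralB//; last first.
    rewrite (_ : _ \o _ = fun x => (t'%:E * (cos (t' * x + th) * p x)%:E)%E).
      exact: (integrableZl measurableT t' (intc t')).
    by apply/funext => x.
  rewrite RintegralZl// -/(h t') => /eqP; rewrite subr_eq0 => /eqP E.
  under eq_Rintegral do rewrite -mulN1r.
  by rewrite RintegralZl// -E; ring.
have h0 : h 0 = cos th.
  rewrite /h; under eq_Rintegral do rewrite mul0r add0r.
  rewrite RintegralZl//; last exact: integrable_normal_pdf.
  by rewrite /Rintegral integral_normal_pdf mulr1.
have bc : bmeas (fun x : R => cos (t * x + th)).
  by apply: bmeas_cos; apply: measurable_funD => //; exact: measurable_funM.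
rewrite integral_normal_bmeas//.
have D (s : R) : is_derive s (1 : R) (fun s : R => h s * expR (s ^+ 2 / 2)) 0.
  by apply: is_derive_eq; rewrite /GRing.scale/=; field.
have := is_derive_0_is_cst t 0 D.
rewrite expr0n mul0r expR0 mulr1 h0 -/(h t) => <-.
by rewrite -mulrA -expRD subrr expR0 mulr1.
Qed.

End normal_integral.

(** * The standard normal law on column vectors and its smoothing kernels *)

Section gaussian_vector.
Context {R : realType}.
Notation N := (normal_prob (0 : R) 1).

Lemma cons_cV0 d (x : measurableTypeR R * 'cV[R]_d) : cons_cV x 0 0 = x.1.
Proof.
have -> : (0 : 'I_d.+1) = lshift d (0 : 'I_1) by exact: val_inj.
by rewrite (@col_mxEu R 1 d 1) mxE eqxx.
Qed.

Lemma cons_cVS d (x : measurableTypeR R * 'cV[R]_d) i :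
  cons_cV x (lift ord0 i) 0 = x.2 i 0.
Proof.
have -> : lift ord0 i = rshift 1 i by exact: val_inj.
exact: (@col_mxEd R 1 d 1).
Qed.

Lemma integral_std_normalS d (f : 'cV[R]_d.+1 -> R) : bmeas f ->
  \int[std_normal R d.+1]_z f z =
  \int[N]_a \int[std_normal R d]_z f (cons_cV (a : measurableTypeR R, z)).
Proof.
move=> bf; rewrite [LHS](integral_distr _ (@cons_cV R d) bf).
by rewrite (integral_prod12 _ _ (bmeas_comp bf (measurable_funP (@cons_cV R d)))).
Qed.

(** The free phase closes the induction: the term of the first coordinate is absorbed into it while
    the other coordinates are integrated out. *)
Lemma std_normal_cos d (t : 'cV[R]_d) th :
  \int[std_normal R d]_z cos (dot t z + th) = cos th * expR (- (dot t t / 2)).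
Proof.
elim: d t th => [|d IH] t th.
  under eq_Rintegral do rewrite dotE big_ord0 add0r.
  by rewrite bint_cst dotE big_ord0 mul0r oppr0 expR0 mulr1.
pose t' : 'cV[R]_d := \col_i t (lift ord0 i) 0.
have bc : bmeas (fun z : 'cV[R]_d.+1 => cos (dot t z + th)).
  by apply: bmeas_cos; apply: measurable_funD => //; exact: measurable_dotr.
rewrite integral_std_normalS//.
have E a z : dot t (cons_cV (a, z)) = t 0 0 * a + dot t' z.
  rewrite !dotE big_ord_recl cons_cV0; congr (_ + _).
  by apply: eq_bigr => i _; rewrite cons_cVS mxE.
under eq_Rintegral => a _.
  under eq_Rintegral do rewrite E -addrA addrCA.
  rewrite IH; over.
have bt : bmeas (fun a : R => cos (t 0 0 * a + th)).
  by apply: bmeas_cos; apply: measurable_funD => //; exact: measurable_funM.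
rewrite bintZr// normal_cos_shift -mulrA -expRD; congr (_ * expR _).
have -> : dot t' t' = \sum_(i < d) t (lift ord0 i) 0 * t (lift ord0 i) 0.
  by rewrite dotE; apply: eq_bigr => i _; rewrite mxE.
by rewrite [dot t t]dotE big_ord_recl; field.
Qed.

Lemma std_normal_prod d (g : 'I_d -> R -> R) : (forall i, bmeas (g i)) ->
  \int[std_normal R d]_z \prod_i g i (z i 0) = \prod_i \int[N]_a g i a.
Proof.
elim: d g => [|d IH] g bg.
  by under eq_Rintegral do rewrite big_ord0; rewrite bint_cst big_ord0.
have bp n (h : 'I_n -> R -> R) : (forall i, bmeas (h i)) ->
    bmeas (fun z : 'cV[R]_n => \prod_i h i (z i 0)).
  move=> bh; apply: bmeas_prod => i.
  by apply: (bmeas_comp (bh i)); exact: measurable_coord.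
rewrite integral_std_normalS; last exact: bp.
pose h i := g (lift ord0 i); have bh i : bmeas (h i) by exact: bg.
transitivity (\int[N]_a (g ord0 a * \prod_i \int[N]_b h i b)).
  apply: eq_Rintegral => a _; rewrite -(IH h bh) -bintZl; last exact: bp.
  apply: eq_Rintegral => z _; rewrite big_ord_recl cons_cV0; congr (_ * _).
  by apply: eq_bigr => i _; rewrite cons_cVS.
by rewrite [RHS]big_ord_recl bintZr; [|exact: bg].
Qed.

(** Density at [y] of the law N(x, s^2) relative to N(0, 1). Smoothing thus becomes an integral
    against the probability [std_normal], to which the superposition lemma for random measures
    applies. *)
Definition gauss_kernel (s x y : R) := s^-1 * expR (- ((x - y) ^+ 2 / (s ^+ 2 *+ 2)) + y ^+ 2 / 2).

Section kernel.
Variable s : R.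
Hypothesis s01 : 0 < s < 1.

Let s_gt0 : 0 < s. Proof. by case/andP: s01. Qed.
Let s_neq0 : s != 0. Proof. by rewrite gt_eqF. Qed.

(** Completing the square in [y]: as s < 1, the exponent is a concave quadratic with maximum x^2 /
    (2 (1 - s^2)), reached at y = x / (1 - s^2). *)
Lemma bmeas_gauss_kernel x : bmeas (gauss_kernel s x).
Proof.
apply: (@bmeas_bounded _ _ _ _ (s^-1 * expR (x ^+ 2 / (1 - s ^+ 2) / 2))).
  apply: measurable_funM => //; apply: measurableT_comp => //.
  apply: measurable_funD; last by apply: measurable_funM => //; apply: measurable_funX.
  apply: measurableT_comp => //; apply: measurable_funM => //.
  by apply: measurable_funX; exact: measurable_funB.
move=> y; rewrite mulr_ge0 ?expR_ge0 ?invr_ge0 ?(ltW s_gt0)//=.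
rewrite ler_pM2l ?invr_gt0// ler_expR.
have s1 : 0 < 1 - s ^+ 2 by case/andP: s01 => ? ?; nra.
have s2 : 0 < s ^+ 2 by rewrite exprn_gt0.
rewrite -subr_ge0.
rewrite (_ : _ - _ = (y * (1 - s ^+ 2) - x) ^+ 2 / (s ^+ 2 * (1 - s ^+ 2)) / 2).
  by rewrite !divr_ge0 ?sqr_ge0// mulr_ge0// ltW.
by rewrite mulr2n; field; rewrite s_neq0 gt_eqF.
Qed.

Lemma gauss_kernel_pdf x y : gauss_kernel s x y * normal_pdf 0 1 y = normal_pdf x s y.
Proof.
rewrite normal_pdf01 (normal_pdfE _ s_neq0) /normal_fun /gauss_kernel.
have -> : normal_peak s = s^-1 * normal_peak 1.
  rewrite /normal_peak expr1n mul1r -mulrnAr sqrtrM ?sqr_ge0// sqrtr_sqr.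
  by rewrite invfM gtr0_norm.
rewrite mulrACA -expRD; congr (_ * expR _).
by rewrite -[s ^+ 2 *+ 2]mulr_natr; field; exact: s_neq0.
Qed.

Lemma integral_gauss_kernel x : \int[N]_y gauss_kernel s x y = 1.
Proof.
rewrite integral_normal_bmeas; last exact: bmeas_gauss_kernel.
under eq_Rintegral do rewrite gauss_kernel_pdf.
by rewrite /Rintegral integral_normal_pdf.
Qed.

(** The integrand, times the normal density, is a multiple of the density of N(x, s^2 / (1 + s^2)).
    A value close to 1 for small [s] expresses that the kernel concentrates near [x]. *)
Lemma integral_gauss_kernel_dist x :
  \int[N]_y (expR (- ((x - y) ^+ 2 / 2)) * gauss_kernel s x y) =
  (Num.sqrt (1 + s ^+ 2))^-1.
Proof.
have be : bmeas (fun y : R => expR (- ((x - y) ^+ 2 / 2))).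
  apply: bmeas_expRN => [|y]; last by rewrite divr_ge0// sqr_ge0.
  by apply: measurable_funM => //; apply: measurable_funX; exact: measurable_funB.
rewrite integral_normal_bmeas; last by apply: bmeasM => //; exact: bmeas_gauss_kernel.
set c := Num.sqrt (1 + s ^+ 2).
have c1 : 0 < 1 + s ^+ 2 by rewrite ltr_pwDl// sqr_ge0.
have c0 : 0 < c by rewrite sqrtr_gt0.
have c2 : c ^+ 2 = 1 + s ^+ 2 by rewrite sqr_sqrtr// ltW.
pose s' := s / c; have s'0 : s' != 0 by rewrite mulf_neq0// invr_eq0 gt_eqF.
have E y : expR (- ((x - y) ^+ 2 / 2)) * gauss_kernel s x y * normal_pdf 0 1 y =
    c^-1 * normal_pdf x s' y.
  rewrite -mulrA gauss_kernel_pdf (normal_pdfE _ s_neq0) (normal_pdfE _ s'0) /normal_fun.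
  have -> : normal_peak s' = c * normal_peak s.
    have pk r : 0 < r -> normal_peak r = r^-1 * (Num.sqrt (pi *+ 2))^-1.
      move=> r0; rewrite /normal_peak -mulrnAr sqrtrM ?sqr_ge0// sqrtr_sqr.
      by rewrite invfM gtr0_norm.
    by rewrite !pk ?divr_gt0// /s' invfM invrK; ring.
  rewrite mulrA mulKf ?gt_eqF// mulrCA -expRD; congr (_ * expR _).
  rewrite /s' expr_div_n c2 mulr2n; field.
  by rewrite s_neq0 gt_eqF.
under eq_Rintegral do rewrite E.
rewrite RintegralZl//; last exact: integrable_normal_pdf.
by rewrite /Rintegral integral_normal_pdf mulr1.
Qed.

Definition gauss_kernel_cV d (x y : 'cV[R]_d) := \prod_i gauss_kernel s (x i 0) (y i 0).

Lemma bmeas_gauss_kernel_cV d (x : 'cV[R]_d) : bmeas (gauss_kernel_cV x).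
Proof.
apply: bmeas_prod => i; apply: (bmeas_comp (bmeas_gauss_kernel (x i 0))).
exact: measurable_coord.
Qed.

Lemma gauss_kernel_cV_ge0 d (x y : 'cV[R]_d) : 0 <= gauss_kernel_cV x y.
Proof.
by apply: prodr_ge0 => i _; rewrite mulr_ge0 ?expR_ge0 ?invr_ge0 ?(ltW s_gt0).
Qed.

Lemma integral_gauss_kernel_cV d (x : 'cV[R]_d) :
  \int[std_normal R d]_y gauss_kernel_cV x y = 1.
Proof.
rewrite (std_normal_prod (fun i => bmeas_gauss_kernel (x i 0))).
by apply: big1 => i _; exact: integral_gauss_kernel.
Qed.

Lemma integral_gauss_kernel_cV_dist d (x : 'cV[R]_d) :
  \int[std_normal R d]_y (expR (- (dot (x - y) (x - y) / 2)) * gauss_kernel_cV x y) =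
  (Num.sqrt (1 + s ^+ 2))^-1 ^+ d.
Proof.
pose g (i : 'I_d) y := expR (- ((x i 0 - y) ^+ 2 / 2)) * gauss_kernel s (x i 0) y.
have bg i : bmeas (g i).
  apply: bmeasM; last exact: bmeas_gauss_kernel.
  apply: bmeas_expRN => [|y]; last by rewrite divr_ge0// sqr_ge0.
  by apply: measurable_funM => //; apply: measurable_funX; exact: measurable_funB.
transitivity (\int[std_normal R d]_y \prod_i g i (y i 0)).
  apply: eq_Rintegral => y _; rewrite big_split/= -expR_sum; congr (expR _ * _).
  rewrite dotE mulr_suml -sumrN; apply: eq_bigr => i _.
  by rewrite !mxE expr2.
rewrite (std_normal_prod bg).
under eq_bigr do rewrite integral_gauss_kernel_dist.
by rewrite prodr_const card_ord.
Qed.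

(* The Gaussian factor in [x - y] is a superposition of the characters
   [x |-> cos (t . x + th)]. *)
Lemma gauss_kernel_cVE d (x y : 'cV[R]_d) :
  gauss_kernel_cV x y = s^-1 ^+ d * expR (dot y y / 2) *
    \int[std_normal R d]_z cos (dot (s^-1 *: z) x + - dot (s^-1 *: z) y).
Proof.
under eq_Rintegral => z _.
  rewrite -dotBr dotZl -dotZr dotC -[X in cos X]addr0.
  over.
rewrite std_normal_cos cos0 mul1r dotZl dotZr.
rewrite /gauss_kernel_cV big_split/= prodr_const card_ord -mulrA; congr (_ * _).
rewrite -expRD -expR_sum; congr expR; rewrite big_split/= addrC; congr (_ + _).
  by rewrite dotE mulr_suml; apply: eq_bigr => i _; rewrite expr2.
rewrite dotE sumrN; congr (- _); rewrite mulrA mulrAC mulr_sumr.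
apply: eq_bigr => i _; rewrite !mxE -[s ^+ 2 *+ 2]mulr_natr.
by field; exact: s_neq0.
Qed.

End kernel.

End gaussian_vector.

Section null_sequences.
Context {R : realType}.
Implicit Types u v : nat -> R.

Lemma cvg0_le u v : (forall n, `|u n| <= v n) -> v n @[n --> \oo] --> (0 : R) ->
  u n @[n --> \oo] --> (0 : R).
Proof.
move=> uv v0; apply: norm_cvg0; apply: squeeze_cvgr (cvg_cst 0) v0.
by apply: nearW => n; rewrite normr_ge0 uv.
Qed.

Lemma cvg0_approx u : (forall e : R, 0 < e -> exists2 v, v n @[n --> \oo] --> (0 : R) &
    forall n, `|u n| <= v n + e) -> u n @[n --> \oo] --> (0 : R).
Proof.
move=> H; apply/cvgr0Pnorm_le => e e0.
have [v v0 uv] := H (e / 2) (divr_gt0 e0 (ltr0n _ 2)).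
have /cvgr0Pnorm_le/(_ _ (divr_gt0 e0 (ltr0n _ 2))) := v0.
apply: filterS => n vn; have := uv n; have := ler_norm (v n); lra.
Qed.

Lemma cvg0_addn u v : u n @[n --> \oo] --> (0 : R) -> v n @[n --> \oo] --> (0 : R) ->
  u n + v n @[n --> \oo] --> (0 : R).
Proof. by move=> u0 v0; rewrite -[X in _ --> X]addr0; exact: cvgD. Qed.

Lemma cvg0_scale u (c : R) : u n @[n --> \oo] --> (0 : R) ->
  c * u n @[n --> \oo] --> (0 : R).
Proof.
by move=> u0; rewrite -[X in _ --> X](mulr0 c); apply: cvgM => //; exact: cvg_cst.
Qed.

Lemma bernoulli_ineq (a : R) n : 0 <= a <= 1 -> 1 - a ^+ n <= n%:R * (1 - a).
Proof.
move=> /andP[a0 a1]; elim: n => [|n IH]; first by rewrite expr0 subrr mul0r.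
have an : 0 <= a ^+ n <= 1 by rewrite exprn_ge0//= exprn_ile1.
by rewrite exprS -natr1; nra.
Qed.

End null_sequences.

(** * Uniform continuity of functions with compact support *)

Section uniform_continuity.
Context {R : realType}.

Lemma continuous_dot n : continuous (fun x : 'cV[R]_n => dot x x).
Proof.
suff H (s : seq 'I_n) : continuous (fun x : 'cV[R]_n => \sum_(i <- s) x i 0 * x i 0 : R).
  rewrite (_ : (fun x => dot x x) = (fun x : 'cV[R]_n => \sum_i x i 0 * x i 0)); first exact: H.
  by apply/funext => y; rewrite dotE.
elim: s => [|i s IH].
  rewrite (_ : (fun _ => _) = cst 0); first exact: cst_continuous.
  by apply/funext => x; rewrite big_nil.
have cM : continuous (fun x : 'cV[R]_n => x i 0 * x i 0 : R).
  by move=> x; apply: (@continuousM _ _ (fun x : 'cV[R]_n => x i 0)); exact: coord_continuous.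
rewrite (_ : (fun _ => _) = (fun x : 'cV[R]_n => x i 0 * x i 0 + \sum_(j <- s) x j 0 * x j 0)).
  by move=> x; apply: (@continuousD _ _ _ (fun x : 'cV[R]_n => x i 0 * x i 0 : R^o)); [exact: cM|exact: IH].
by apply/funext => x; rewrite big_cons.
Qed.

Lemma ball_dot n (x y : 'cV[R]_n) (e : R) : 0 < e -> dot (x - y) (x - y) < e ^+ 2 -> ball x e y.
Proof.
move=> e0 xy; split=> // i j; rewrite ord1 /ball/=.
have : (x i 0 - y i 0) ^+ 2 < e ^+ 2.
  apply: le_lt_trans xy; rewrite dotE (bigD1 i)//= !mxE -expr2 lerDl.
  by apply: sumr_ge0 => k _; rewrite -expr2 sqr_ge0.
by rewrite -[_ ^+ 2]real_normK ?num_real// ltr_pXn2r// nnegrE// ltW.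
Qed.

Lemma compact_dot_le n (B : R) : compact [set x : 'cV[R]_n | dot x x <= B].
Proof.
(* Heine-Borel is applied to row vectors and transported by transposition. *)
pose A := [set v : 'rV[R]_n | dot v^T v^T <= B].
have ctr m k : continuous (@trmx R m k).
  move=> /= M s /= /nbhs_ballP[e e0 es]; apply/nbhs_ballP; exists e => //= M' [_ MM'].
  by apply: es; split => // i j; rewrite !mxE; exact: MM'.
have -> : [set x : 'cV[R]_n | dot x x <= B] = trmx @` A.
  apply/seteqP; split => [x /= xB|_ [v /= vB <-]//].
  by exists x^T; rewrite ?trmxK// /A/= trmxK.
apply: continuous_compact; first by apply: continuous_subspaceT; exact: ctr.
apply: bounded_closed_compact.
  exists (1 + `|B|); split; first exact: num_real.
  move=> M BM v /= vB; rewrite /Num.norm/= mx_normrE; apply/bigmax_leP; split.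
    by apply: le_trans (ltW BM); rewrite addr_ge0.
  move=> [i j] _ /=; rewrite ord1; apply: le_trans (ltW BM).
  have : v 0 j ^+ 2 <= `|B|.
    apply: le_trans (le_trans vB (ler_norm B)); rewrite dotE (bigD1 j)//= !mxE -expr2 lerDl.
    by apply: sumr_ge0 => k _; rewrite -expr2 sqr_ge0.
  rewrite -real_normK ?num_real//; have := normr_ge0 (v 0 j).
  by set a := `|v 0 j|; nra.
have cA : continuous (fun v : 'rV[R]_n => dot v^T v^T).
  move=> v; apply: (@continuous_comp _ _ _ trmx (fun x : 'cV[R]_n => dot x x)); [exact: ctr|exact: continuous_dot].
have -> : A = (fun v : 'rV[R]_n => dot v^T v^T) @^-1` [set r | r <= B] by [].
by apply: closed_comp => [v _|]; [exact: cA|exact: closed_le].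
Qed.

(** Heine-Cantor with only [x] confined to [K]: [y] may lie just outside, which spares later uses a
    discussion of the boundary. *)
Lemma compact_uniformly_continuous (V : pseudoMetricType R) (K : set V) (f : V -> R) :
  compact K -> continuous f ->
  forall e : R, 0 < e -> exists2 del : R, 0 < del &
    forall x y, K x -> ball x del y -> `|f x - f y| <= e.
Proof.
move=> cK cf e e0.
pose P (d : R) (x : V) := forall y, ball x d y -> `|f x - f y| <= e.
have e20 : 0 < e / 2 by rewrite divr_gt0.
have /compact_near_coveringP/(_ R (0^'+) P _) H := cK.
have /H KP : forall x, K x -> \forall x' \near x & d \near 0^'+, P d x'.
  move=> x _; have /cvgrPdist_lt/(_ _ e20)/nbhs_ballP[r /= r0 xr] := cf x.
  have r20 : 0 < r / 2 by rewrite divr_gt0.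
  exists (ball x (r / 2), [set d | d < r / 2]); first split => /=.
  - exact: nbhsx_ballx.
  - exact: nbhs_right_lt.
  move=> [x' d] /= [xx' dr] y x'y.
  have fx' : `|f x - f x'| < e / 2.
    have rr : r / 2 <= r by move: r0 => /= ?; lra.
    by apply: xr; apply: le_ball rr _ xx'.
  have fy : `|f x - f y| < e / 2.
    by apply: xr; rewrite [r]splitr; apply: ball_triangle xx' (le_ball (ltW dr) x'y).
  have -> : f x' - f y = (f x - f y) - (f x - f x') by ring.
  by apply: le_trans (ler_normB _ _) _; lra.
have [d Kd d0] : exists2 d : R, K `<=` P d & 0 < d.
  have d0 : \forall d \near (0 : R)^'+, 0 < d by exact: nbhs_right_gt.
  have PF := at_right_proper_filter (0 : R).
  by have [d [? ?]] := @filter_ex _ _ PF _ (@filterI _ _ PF _ _ KP d0); exists d.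
by exists d => // x y Kx; exact: (Kd x Kx).
Qed.

(** Closeness is measured by the squared Euclidean distance, the quantity on which the Gaussian
    kernel depends. *)
Lemma compact_support_uniformly_continuous n (f : 'cV[R]_n -> R) (B : R) :
  continuous f -> (forall x, B < dot x x -> f x = 0) ->
  forall e : R, 0 < e -> exists2 del : R, 0 < del &
    forall x y, dot (x - y) (x - y) < del -> `|f x - f y| <= e.
Proof.
move=> cf f0 e e0.
have [d d0 Kd] := compact_uniformly_continuous (@compact_dot_le n B) cf e0.
exists (d ^+ 2); first by rewrite exprn_gt0.
move=> x y /(ball_dot d0) xy.
have [xB|Bx] := leP (dot x x) B; first exact: (Kd x y xB).
have [yB|By] := leP (dot y y) B; last by rewrite !f0// subrr normr0 ltW.
by rewrite distrC; apply: (Kd y x yB); exact: ball_sym.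
Qed.

End uniform_continuity.

(** * Random measures *)

Section random_measures_L1.
Context {R : realType} (dO dS : nat -> measure_display).
Variables (Om : forall k, measurableType (dO k)) (S : forall k, measurableType (dS k)).
Variables (Pr : forall k, probability (Om k) R) (P : forall k, probability (S k) R).
Context dV (V : measurableType dV).
Variable Phi : forall k, Om k * S k -> V.
Hypothesis mPhi : forall k, measurable_fun setT (@Phi k).
Variable Q : probability V R.
Implicit Types g h : V -> R.

(** A random measure is encoded as the image of [P k] under [Phi (w, _)]; joint measurability of
    this map gives Fubini for its integrals. *)
Definition image_error (g : V -> R) k (w : Om k) :=
  \int[P k]_s g (Phi (w, s)) - \int[Q]_x g x.

Definition L1_cvg (g : V -> R) :=
  \int[Pr k]_w `|image_error g w| @[k --> \oo] --> (0 : R).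

Lemma bmeas_image g k : bmeas g -> bmeas (fun z => g (@Phi k z)).
Proof. by move=> bg; exact: bmeas_comp bg (@mPhi k). Qed.

Lemma bmeas_image_error g k : bmeas g -> bmeas (@image_error g k).
Proof.
move=> bg; apply: bmeasB; last exact: bmeas_cst.
exact: (bmeas_integral2 (P k) (bmeas_image k bg)).
Qed.

Lemma bmeas_section g k (w : Om k) : bmeas g -> bmeas (fun s => g (Phi (w, s))).
Proof.
by move=> bg; exact: (bmeas_section1 (bmeas_image k bg)).
Qed.

(** By Fubini the error of an average is the average of the errors, so its L1 norm is at most an
    average over [y] of norms that tend to 0 and stay bounded. *)
Lemma L1_cvg_superposition dY (Y : measurableType dY) (m : probability Y R)
    (g : Y * V -> R) : bmeas g ->
  (forall y, L1_cvg (fun x => g (y, x))) -> L1_cvg (fun x => \int[m]_y g (y, x)).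
Proof.
move=> bg Lg.
pose e k (z : Y * Om k) := image_error (fun x => g (z.1, x)) z.2.
have be k : @bmeas R _ _ (e k).
  apply: bmeasB.
    have b3 : bmeas (fun z : (Y * Om k) * S k => g (z.1.1, Phi (z.1.2, z.2)) : R).
      apply: (bmeas_comp bg); apply: measurable_fun_pair.
        exact: measurableT_comp measurable_fst measurable_fst.
      apply: (measurableT_comp (@mPhi k)); apply: measurable_fun_pair => //.
      exact: measurableT_comp measurable_snd measurable_fst.
    exact: (bmeas_integral2 (P k) b3).
  have b2 := bmeas_integral2 Q bg.
  by apply: (bmeas_comp b2); exact: measurable_fst.
have [M gM] := bg.2.
have eM k z : `|e k z| <= M + M.
  apply: le_trans (ler_normB _ _) _; apply: lerD; apply: normr_integral_le_cst => //.
    exact: (bmeas_section z.2 (bmeas_section1 bg z.1)).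
  exact: (bmeas_section1 bg z.1).
have bae k : bmeas (fun z => `|e k z|) by exact: bmeas_norm.
apply: (@cvg0_le _ _ (fun k => \int[m]_y \int[Pr k]_w `|e k (y, w)|)); last first.
  rewrite -(bint_cst m 0).
  apply: (@bounded_cvg_integral _ _ _ _ _ _ (M + M)).
  - by move=> k; have [] := bmeas_integral2 (Pr k) (bae k).
  - exact: measurable_cst.
  - move=> k y; apply: normr_integral_le_cst; first exact: (bmeas_section1 (bae k) y).
    by move=> w; rewrite normr_id.
  - by move=> y; exact: Lg.
move=> k; rewrite ger0_norm; last by apply: Rintegral_ge0.
rewrite (integral_swap m (Pr k) (bae k)); apply: le_bint => [|| w].
- by apply: bmeas_norm; exact: (bmeas_image_error k (bmeas_integral1 m bg)).
- exact: (bmeas_integral1 m (bae k)).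
have bgP : bmeas (fun z : Y * S k => g (z.1, Phi (w, z.2)) : R).
  apply: (bmeas_comp bg); apply: measurable_fun_pair; first exact: measurable_fst.
  apply: (measurableT_comp (@mPhi k)); apply: measurable_fun_pair => //.
have -> : image_error (fun x => \int[m]_y g (y, x)) w = \int[m]_y e k (y, w).
  rewrite /e /image_error bintB.
  - by rewrite -(integral_swap m (P k) bgP) -(integral_swap m Q bg).
  - exact: (bmeas_integral2 (P k) bgP).
  - exact: (bmeas_integral2 Q bg).
by apply: normr_integral_le; exact: (bmeas_section2 (be k) w).
Qed.

Lemma L1_cvgD g h : bmeas g -> bmeas h -> L1_cvg g -> L1_cvg h ->
  L1_cvg (fun x => g x + h x).
Proof.
move=> bg bh Lg Lh; apply: cvg0_le (cvg0_addn Lg Lh) => k.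
rewrite ger0_norm; last by apply: Rintegral_ge0.
have bE u : bmeas u -> bmeas (fun w => `|@image_error u k w|).
  by move=> bu; apply: bmeas_norm; exact: bmeas_image_error.
rewrite -bintD; [|exact: bE..].
apply: le_bint => [|| w]; first by apply: bE; exact: bmeasD.
  by apply: bmeasD; exact: bE.
rewrite /image_error !bintD//; [|exact: bmeas_section..].
by rewrite opprD addrACA ler_normD.
Qed.

Lemma L1_cvgZ c g : bmeas g -> L1_cvg g -> L1_cvg (fun x => c * g x).
Proof.
move=> bg Lg; apply: cvg0_le (cvg0_scale `|c| Lg) => k.
rewrite ger0_norm; last by apply: Rintegral_ge0.
rewrite -bintZl; last by apply: bmeas_norm; exact: bmeas_image_error.
apply: le_bint => [|| w].
- by apply: bmeas_norm; apply: bmeas_image_error; apply: bmeasM => //; exact: bmeas_cst.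
- by apply: bmeasM; [exact: bmeas_cst | apply: bmeas_norm; exact: bmeas_image_error].
rewrite /image_error !bintZl//; last exact: bmeas_section.
by rewrite -mulrBr normrM.
Qed.

(** The error of [g] is at most the errors of [h] and [v] plus twice the [Q]-integral of [v]. Since
    [v] is itself a convergent test function, its integral under the random measure is controlled by
    the one under [Q]. *)
Lemma L1_cvg_dominated g : bmeas g ->
  (forall e : R, 0 < e -> exists h v : V -> R, [/\ bmeas h /\ L1_cvg h, bmeas v /\ L1_cvg v,
    (forall x, `|g x - h x| <= v x) & \int[Q]_x v x <= e]) -> L1_cvg g.
Proof.
move=> bg H; apply: cvg0_approx => e e0.
have [h [v [[bh Lh] [bv Lv] ghv Qv]]] := H (e / 2) (divr_gt0 e0 (ltr0n _ 2)).
exists (fun k => \int[Pr k]_w `|image_error h w| + \int[Pr k]_w `|image_error v w|).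
  exact: (cvg0_addn Lh Lv).
move=> k; rewrite ger0_norm; last by apply: Rintegral_ge0.
have bE u : bmeas u -> bmeas (fun w => `|@image_error u k w|).
  by move=> bu; apply: bmeas_norm; exact: bmeas_image_error.
rewrite -bintD; [|exact: bE..].
rewrite -[e in leRHS](bint_cst (Pr k)) -bintD; last 2 first.
- by apply: bmeasD; exact: bE.
- exact: bmeas_cst.
apply: le_bint => [|| w]; first exact: bE.
  by apply: bmeasD; [apply: bmeasD; exact: bE | exact: bmeas_cst].
have bs (u : V -> R) : bmeas u -> bmeas (fun s => u (@Phi k (w, s))).
  by move=> bu; exact: (bmeas_section w bu).
have v0 x : 0 <= v x by apply: le_trans (ghv x).
have H1 : `|\int[P k]_s g (Phi (w, s)) - \int[P k]_s h (Phi (w, s))| <= \int[P k]_s v (Phi (w, s)).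
  apply: le_trans (normr_integralB_le _ (bs _ bg) (bs _ bh)) _.
  apply: le_bint; [|exact: bs|by []].
  by apply: bmeas_norm; apply: bmeasB; exact: bs.
have H2 : `|\int[Q]_x g x - \int[Q]_x h x| <= \int[Q]_x v x.
  apply: le_trans (normr_integralB_le _ bg bh) _.
  apply: le_bint => //; apply: bmeas_norm; exact: bmeasB.
have := ler_norm (image_error v w); rewrite /image_error.
move: H1 H2; set a := \int[P k]_s g _; set b := \int[P k]_s h _; set c := \int[P k]_s v _.
set a' := \int[Q]_x g x; set b' := \int[Q]_x h x; set c' := Rintegral Q _ v in Qv *.
have -> : a - a' = (a - b) - (a' - b') + (b - b') by ring.
move=> H1 H2 H3; apply: le_trans (ler_normD _ _) _.
by have := ler_normB (a - b) (a' - b'); lra.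
Qed.

End random_measures_L1.

(** * Continuity theorem for random measures *)

Section levy_continuity.
Context {R : realType} (dO dS : nat -> measure_display).
Variables (Om : forall k, measurableType (dO k)) (S : forall k, measurableType (dS k)).
Variables (Pr : forall k, probability (Om k) R) (P : forall k, probability (S k) R).
Variable d : nat.
Variable Phi : forall k, Om k * S k -> 'cV[R]_d.
Hypothesis mPhi : forall k, measurable_fun setT (@Phi k).
Variable Q : probability 'cV[R]_d R.
Local Notation L1_cvg := (L1_cvg Pr P Phi Q).
Hypothesis L1_cos : forall t th, L1_cvg (fun x => cos (dot t x + th)).

Lemma L1_cvg_gauss_kernel (s : R) (y : 'cV[R]_d) : 0 < s < 1 ->
  bmeas (fun x => gauss_kernel_cV s x y) /\ L1_cvg (fun x => gauss_kernel_cV s x y).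
Proof.
move=> s01.
have bc : bmeas (fun z : 'cV[R]_d * 'cV[R]_d => cos (dot (s^-1 *: z.1) z.2 + - dot (s^-1 *: z.1) y)).
  have m1 : measurable_fun setT (fun z : 'cV[R]_d * 'cV[R]_d => s^-1 *: z.1).
    by apply: (measurableT_comp (@measurable_scalemx R d 1 s^-1)); exact: measurable_fst.
  apply: bmeas_cos; apply: measurable_funD; first by apply: measurable_dot2.
  by apply: measurableT_comp => //; apply: (measurableT_comp (measurable_dot y)).
have bi : bmeas (fun x => \int[std_normal R d]_z cos (dot (s^-1 *: z) x + - dot (s^-1 *: z) y)).
  exact: (bmeas_integral1 _ bc).
rewrite (_ : (fun x => _) = (fun x => s^-1 ^+ d * expR (dot y y / 2) *
    \int[std_normal R d]_z cos (dot (s^-1 *: z) x + - dot (s^-1 *: z) y))); last first.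
  by apply/funext => x; rewrite gauss_kernel_cVE.
split; first by apply: bmeasM => //; exact: bmeas_cst.
apply: (L1_cvgZ mPhi) => //.
have /= H := @L1_cvg_superposition _ _ _ Om S Pr P _ _ Phi mPhi Q _ _ (std_normal R d) _ bc.
by apply: H => z; exact: L1_cos.
Qed.

(** [f] is compared with h(x) = E f(Y), Y of law N(x, s^2 I), a superposition of kernels. With r =
    |x - y|^2 one has |f x - f y| <= e/2 + C (1 - exp (- r/2)), whose mean against the kernel is
    explicit and tends to e/2 as s tends to 0. *)
Lemma L1_cvg_compact_support f (B : R) : continuous f ->
  (forall x, B < dot x x -> f x = 0) -> bmeas f -> L1_cvg f.
Proof.
move=> cf fB bf; have [M fM] := bf.2.
have M0 : 0 <= M by apply: le_trans (fM 0).
apply: (L1_cvg_dominated mPhi) => // e e0.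
have e20 : 0 < e / 2 by rewrite divr_gt0.
have [del del0 fdel] := compact_support_uniformly_continuous cf fB e20.
(* For r >= del one has 1 - exp (- r/2) >= q, so that C q = 2 M covers the trivial bound on |f x - f
   y|. *)
pose q : R := 1 - expR (- (del / 2)).
have q0 : 0 < q by rewrite subr_gt0 expR_lt1 oppr_lt0 divr_gt0.
pose C : R := 2 * M / q.
have C0 : 0 <= C by rewrite divr_ge0 ?mulr_ge0// ltW.
(* The mean of C (1 - exp (- r/2)) is at most C d s, by the Bernoulli inequality; the 1 in the
   denominator avoids a division by zero. *)
pose s := Num.min (1 / 2) (e / 2 / (C * d%:R + 1)).
have Cd : 0 < C * d%:R + 1 by rewrite ltr_wpDl// mulr_ge0.
have s01 : 0 < s < 1.
  rewrite lt_min divr_gt0//= divr_gt0//= gt_min; apply/orP; left.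
  by rewrite ltr_pdivrMr// mul1r ltr1n.
have /andP[s0 _] := s01.
pose K (x y : 'cV[R]_d) : R := gauss_kernel_cV s x y.
have bK x : bmeas (K x) by exact: bmeas_gauss_kernel_cV.
pose h x := \int[std_normal R d]_y (f y * K x y).
(* Jointly in both arguments the kernel is bounded only by a multiple of exp (|y|^2 / 2); the
   support of [f] keeps the product bounded. *)
have bfK : bmeas (fun z : 'cV[R]_d * 'cV[R]_d => f z.1 * K z.2 z.1).
  split.
    apply: measurable_funM; first exact: (measurableT_comp bf.1 measurable_fst).
    apply: measurable_prod => i _; apply: measurable_funM => //.
    have mc1 : measurable_fun setT (fun z : 'cV[R]_d * 'cV[R]_d => z.1 i 0).
      exact: (measurableT_comp (@measurable_coord R d 1 i 0) measurable_fst).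
    have mc2 : measurable_fun setT (fun z : 'cV[R]_d * 'cV[R]_d => z.2 i 0).
      exact: (measurableT_comp (@measurable_coord R d 1 i 0) measurable_snd).
    apply: measurableT_comp => //; apply: measurable_funD.
      apply: measurableT_comp => //; apply: measurable_funM => //.
      by apply: measurable_funX; exact: measurable_funB.
    by apply: measurable_funM => //; exact: measurable_funX.
  exists (M * (s^-1 ^+ d * expR (B / 2))) => z.
  have [zB|Bz] := leP (dot z.1 z.1) B; last first.
    by rewrite fB// mul0r normr0 mulr_ge0// mulr_ge0 ?expR_ge0 ?exprn_ge0 ?invr_ge0// ltW.
  rewrite normrM; apply: ler_pM => //; rewrite ger0_norm; last exact: gauss_kernel_cV_ge0.
  have sd : 0 <= s^-1 ^+ d by rewrite exprn_ge0// invr_ge0 ltW.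
  rewrite /K gauss_kernel_cVE// -mulrA; apply: ler_wpM2l => //.
  apply: (@le_trans _ _ (expR (dot z.1 z.1 / 2) * 1)).
    apply: ler_wpM2l; first exact: expR_ge0.
    apply: integral_le_cst => [|x]; last exact: cos_le1.
    apply: bmeas_cos; apply: measurable_funB.
      apply: (measurableT_comp (@measurable_dot R d z.2)).
      exact: measurable_scalemx.
    apply: (measurableT_comp (@measurable_dot R d z.1)).
    exact: measurable_scalemx.
  by rewrite mulr1 ler_expR; lra.
exists h, (fun=> e); split.
- split; first exact: (bmeas_integral1 _ bfK).
  have /= H := @L1_cvg_superposition _ _ _ Om S Pr P _ _ Phi mPhi Q _ _ (std_normal R d) _ bfK; apply: H => y.
  by have [? ?] := L1_cvg_gauss_kernel y s01; exact: (L1_cvgZ mPhi).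
- split; first exact: bmeas_cst.
  rewrite /L1_cvg (_ : (fun _ => _) = (fun=> 0)); first exact: cvg_cst.
  apply/funext => k; rewrite -[RHS](bint_cst (Pr k)); apply: eq_Rintegral => w _.
  by rewrite /image_error !bint_cst subrr normr0.
- move=> x.
  have bdist : bmeas (fun y : 'cV[R]_d => expR (- (dot (x - y) (x - y) / 2))).
    apply: bmeas_expRN => [|y]; last by rewrite divr_ge0// dot_ge0.
    have mB : measurable_fun setT (fun y : 'cV[R]_d => x - y).
      apply: measurable_fun_mx => i j; under eq_fun do rewrite !mxE.
      by apply: measurable_funB => //; exact: measurable_coord.
    by apply: measurable_funM => //; exact: measurable_dot2.
  have -> : f x - h x = \int[std_normal R d]_y ((f x - f y) * K x y).
    under [RHS]eq_Rintegral do rewrite mulrBl.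
    rewrite bintB; last 2 first.
    - by apply: bmeasM => //; exact: bmeas_cst.
    - exact: bmeasM.
    by rewrite bintZl// integral_gauss_kernel_cV// mulr1.
  apply: le_trans (normr_integral_le _ _) _.
    by apply: bmeasM => //; apply: bmeasB => //; exact: bmeas_cst.
  apply: (@le_trans _ _ (\int[std_normal R d]_y ((e / 2 + C) * K x y - C * (expR (- (dot (x - y) (x - y) / 2)) * K x y)))).
    apply: le_bint => [|| y].
    + by apply: bmeas_norm; apply: bmeasM => //; apply: bmeasB => //; exact: bmeas_cst.
    + apply: bmeasB; first by apply: bmeasM => //; exact: bmeas_cst.
      by apply: bmeasM; [exact: bmeas_cst|exact: bmeasM].
    rewrite normrM [X in _ * X]ger0_norm ?gauss_kernel_cV_ge0// mulrA -mulrBl.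
    apply: ler_wpM2r; first exact: gauss_kernel_cV_ge0.
    set r := dot (x - y) (x - y).
    have r0 : 0 <= r by exact: dot_ge0.
    have E1 : expR (- (r / 2)) <= 1 by rewrite expR_le1 oppr_le0 divr_ge0.
    have [rd|dr] := ltP r del; first by have := fdel x y rd; nra.
    have : `|f x - f y| <= 2 * M.
      by have := ler_normB (f x) (f y); have := fM x; have := fM y; lra.
    move/le_trans; apply.
    have : C * (1 - expR (- (r / 2))) >= C * q.
      by apply: ler_wpM2l => //; rewrite /q lerD2l lerN2 ler_expR; lra.
    by rewrite /C divfK ?gt_eqF//; lra.
  rewrite bintB; last 2 first.
  - by apply: bmeasM => //; exact: bmeas_cst.
  - by apply: bmeasM; [exact: bmeas_cst|exact: bmeasM].
  rewrite !bintZl//; last exact: bmeasM.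
  rewrite integral_gauss_kernel_cV// integral_gauss_kernel_cV_dist//.
  set a := (Num.sqrt (1 + s ^+ 2))^-1.
  have a01 : 0 <= a <= 1.
    rewrite invr_ge0 sqrtr_ge0/= invf_le1 ?sqrtr_gt0 ?ltr_pwDl ?sqr_ge0//.
    by rewrite -[leLHS]sqrtr1 ler_wsqrtr// lerDl sqr_ge0.
  have a1s : 1 - a <= s.
    rewrite lerBlDr -lerBlDl /a.
    have c1 : Num.sqrt (1 + s ^+ 2) <= 1 + s.
      have s1 : 0 <= 1 + s by lra.
      by rewrite -[leRHS](ger0_norm s1) -sqrtr_sqr ler_wsqrtr//; nra.
    have c0 : 0 < Num.sqrt (1 + s ^+ 2) by rewrite sqrtr_gt0 ltr_pwDl// sqr_ge0.
    rewrite -[leRHS]mul1r ler_pdivlMr//; nra.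
  have := bernoulli_ineq d a01.
  have sC : s * (C * d%:R + 1) <= e / 2.
    by rewrite -ler_pdivlMr// ge_min lexx orbT.
  have : d%:R * (1 - a) <= d%:R * s by apply: ler_wpM2l.
  by have := ler0n R d; nra.
- by rewrite bint_cst.
Qed.

(** Cutting off by [chi n] leaves a remainder below M (1 - chi n). Total masses being 1, this
    dominating function converges in L1 because [chi n] does: this is how tightness of the random
    measures is inherited from [Q]. *)
Lemma L1_cvg_bounded_continuous f : continuous f -> bounded_fun f -> L1_cvg f.
Proof.
move=> cf bdf; have bf := bmeas_continuous cf bdf; have [M fM] := bf.2.
have M0 : 0 <= M by apply: le_trans (fM 0).
pose chi (n : nat) (x : 'cV[R]_d) := Num.max 0 (Num.min 1 (n%:R + 1 - dot x x)).
have cchi n : continuous (chi n).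
  have c1 : continuous (fun x : 'cV[R]_d => n%:R + 1 - dot x x).
    move=> x; apply: (@continuousB _ R^o _ (cst (n%:R + 1)) (fun x => dot x x)).
      exact: cst_continuous.
    exact: continuous_dot.
  move=> x; apply: (@continuous_max _ _ (cst 0) (cst 1 \min (fun x : 'cV[R]_d => n%:R + 1 - dot x x))).
    exact: cst_continuous.
  by apply: continuous_min; [exact: cst_continuous|exact: c1].
have chi01 n x : 0 <= chi n x <= 1.
  by rewrite le_max lexx/= ge_max ler01/= ge_min lexx.
have bchi n : bmeas (chi n).
  by apply: bmeas_bounded (chi01 n); exact: continuous_borel_measurable.
have chi0 n x : n%:R + 1 < dot x x -> chi n x = 0.
  move=> nx; apply/max_idPl; rewrite ge_min; apply/orP; right.
  by rewrite subr_le0 ltW.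
have Lchi n : L1_cvg (chi n).
  exact: (L1_cvg_compact_support (@cchi n) (@chi0 n) (bchi n)).
apply: (L1_cvg_dominated mPhi) => // e e0.
have cvgQ : \int[Q]_x (M * (1 - chi n x)) @[n --> \oo] --> (0 : R).
  rewrite -(bint_cst Q 0); apply: (@bounded_cvg_integral _ _ _ _ _ _ M).
  - by move=> n; have [] : bmeas (fun x => M * (1 - chi n x)) by
      apply: bmeasM; [exact: bmeas_cst|apply: bmeasB => //; exact: bmeas_cst].
  - exact: measurable_cst.
  - move=> n x; have /andP[? ?] := chi01 n x.
    by rewrite ger0_norm ?mulr_ge0 ?subr_ge0// ler_piMr// lerBlDr lerDl.
  - move=> x; apply: cvg_near_cst; near=> n.
    rewrite (_ : chi n x = 1) ?subrr ?mulr0//.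
    have nx : dot x x <= n%:R by near: n; exact: nbhs_infty_ger.
    by rewrite /chi (min_idPl _) ?(max_idPr _)//; lra.
have /cvgr0Pnorm_le/(_ _ e0)[n _ /(_ n (leqnn n)) /= nQ] := cvgQ.
exists (fun x => f x * chi n x), (fun x => M * (1 - chi n x)); split.
- split; first exact: bmeasM.
  apply: (@L1_cvg_compact_support _ (n%:R + 1)) => [||//].
  + by move=> x; apply: (@continuousM _ _ f (chi n)); [exact: cf|exact: cchi].
  + by move=> x /chi0 ->; rewrite mulr0.
  + exact: bmeasM.
- split; first by apply: bmeasM; [exact: bmeas_cst|apply: bmeasB => //; exact: bmeas_cst].
  apply: (L1_cvgZ mPhi); first by apply: bmeasB => //; exact: bmeas_cst.
  apply: cvg0_le (Lchi n) => k; rewrite ger0_norm; last by apply: Rintegral_ge0.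
  rewrite le_eqVlt; apply/orP; left; apply/eqP; apply: eq_Rintegral => w _.
  rewrite /image_error !bintB ?bint_cst//; [|exact: bmeas_cst|exact: bmeas_cst|exact: bmeas_section].
  by rewrite -normrN; congr (`|_|); ring.
- move=> x; have /andP[? ?] := chi01 n x.
  rewrite -[X in X - _]mulr1 -mulrBr normrM [X in _ * X]ger0_norm ?subr_ge0//.
  by rewrite ler_wpM2r ?subr_ge0.
- exact: le_trans (ler_norm _) nQ.
Unshelve. all: by end_near. Qed.

End levy_continuity.

(** * Weak limits from Laplace transforms *)

Section bernstein.
Context {R : realType}.
Implicit Types (h : nat -> R) (u : R).

(* [bernstein n h].[u] is the mean of [h] under the binomial law of parameters [n] and [u]. *)
Fixpoint bernstein n h : {poly R} :=
  if n is n'.+1 then 'X * bernstein n' (h \o S) + (1 - 'X) * bernstein n' h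
  else (h 0%N)%:P.

Lemma bernsteinS n h u : (bernstein n.+1 h).[u] =
  u * (bernstein n (h \o S)).[u] + (1 - u) * (bernstein n h).[u].
Proof. by rewrite /= !hornerE. Qed.

Lemma bernstein_cst n (c u : R) : (bernstein n (fun=> c)).[u] = c.
Proof.
elim: n => [|n IH]; first by rewrite hornerC.
by rewrite bernsteinS (_ : (fun=> c) \o S = fun=> c)// !IH; ring.
Qed.

Lemma bernsteinD n h1 h2 u : (bernstein n (fun k => h1 k + h2 k)).[u] =
  (bernstein n h1).[u] + (bernstein n h2).[u].
Proof.
elim: n h1 h2 => [|n IH] h1 h2; first by rewrite !hornerC.
rewrite !bernsteinS (_ : _ \o S = fun k => (h1 \o S) k + (h2 \o S) k)//.
by rewrite !IH; ring.
Qed.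

Lemma bernsteinZ n (c : R) h u : (bernstein n (fun k => c * h k)).[u] = c * (bernstein n h).[u].
Proof.
elim: n h => [|n IH] h; first by rewrite !hornerC.
rewrite !bernsteinS (_ : _ \o S = fun k => c * (h \o S) k)//.
by rewrite !IH; ring.
Qed.

Lemma bernstein_le n h1 h2 u : 0 <= u <= 1 -> (forall k, h1 k <= h2 k) ->
  (bernstein n h1).[u] <= (bernstein n h2).[u].
Proof.
move=> /andP[u0 u1]; elim: n h1 h2 => [|n IH] h1 h2 h12; first by rewrite !hornerC.
rewrite !bernsteinS lerD// ler_wpM2l ?subr_ge0//; apply: IH => k //=.
Qed.

(** Squared bias plus variance of the binomial law; the centre [c] is arbitrary because the
    recursion shifts it by 1. *)
Lemma bernstein_var n (c u : R) : (bernstein n (fun k => (k%:R - c) ^+ 2)).[u] =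
  (n%:R * u - c) ^+ 2 + n%:R * u * (1 - u).
Proof.
elim: n c => [|n IH] c; first by rewrite hornerC; ring.
rewrite bernsteinS (_ : _ \o S = fun k => (k%:R - (c - 1)) ^+ 2); last first.
  by apply/funext => k /=; rewrite -natr1; congr (_ ^+ 2); ring.
by rewrite !IH -natr1; ring.
Qed.

(** The mean deviation of k/n from [u] is of order 1 / sqrt n; the degree m^2 turns this into 1/m
    without square roots. *)
Lemma bernstein_lipschitz (g : R -> R) (L : R) m u : 0 <= u <= 1 -> (0 < m)%N ->
  (forall v, `|g v - g u| <= L * `|v - u|) ->
  `|(bernstein (m ^ 2) (fun k => g (k%:R / (m ^ 2)%:R))).[u] - g u| <= L / m%:R.
Proof.
move=> u01 m0 gL; have /andP[u0 u1] := u01.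
have L0 : 0 <= L.
  by have := gL (u + 1); rewrite addrAC subrr add0r normr1 mulr1; apply: le_trans.
have mR : 0 < m%:R :> R by rewrite ltr0n.
set n := (m ^ 2)%N; have nE : n%:R = m%:R ^+ 2 :> R by rewrite natrX.
have nR : 0 < n%:R :> R by rewrite nE exprn_gt0.
(* AM-GM: [|t| <= (m + t^2 / m) / 2] with [t = k - n u]. *)
pose w k : R := (2^-1 * L / n%:R * m%:R) + (2^-1 * L / n%:R / m%:R) * (k%:R - n%:R * u) ^+ 2.
have gw k : `|g (k%:R / n%:R) - g u| <= w k.
  apply: le_trans (gL _) _.
  have -> : k%:R / n%:R - u = (k%:R - n%:R * u) / n%:R by field; rewrite gt_eqF.
  rewrite normrM [`|n%:R^-1|]ger0_norm ?invr_ge0 ?ler0n//.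
  rewrite /w -(real_normK (num_real (k%:R - n%:R * u))); set t := `|_|.
  rewrite -subr_ge0.
  rewrite (_ : _ - _ = L / n%:R * ((t - m%:R) ^+ 2 / m%:R / 2)).
    apply: mulr_ge0; first by rewrite divr_ge0// ltW.
    by rewrite divr_ge0// divr_ge0 ?sqr_ge0// ltW.
  by field; rewrite !gt_eqF.
have w_le : (bernstein n w).[u] <= L / m%:R.
  rewrite /w bernsteinD bernstein_cst bernsteinZ bernstein_var subrr expr0n add0r.
  have -> : L / m%:R = 2^-1 * L / n%:R * m%:R + 2^-1 * L / n%:R / m%:R * n%:R.
    by rewrite nE; field; rewrite gt_eqF.
  rewrite lerD2l; apply: ler_wpM2l; first by rewrite !divr_ge0 ?mulr_ge0 ?invr_ge0 ?ler0n.
  by rewrite -mulrA; apply: ler_piMr; [exact: ltW|nra].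
set h := fun k : nat => _.
have -> : (bernstein n h).[u] - g u = (bernstein n (fun k => h k + - g u)).[u].
  by rewrite bernsteinD bernstein_cst.
rewrite ler_norml; apply/andP; split; last first.
  by apply: le_trans w_le; apply: bernstein_le => // k; apply: le_trans (ler_norm _) (gw k).
rewrite lerNl; apply: le_trans w_le.
have -> : - (bernstein n (fun k => h k + - g u)).[u] = (bernstein n (fun k => -1 * (h k - g u))).[u].
  by rewrite (bernsteinZ n (-1) (fun k => h k - g u)) mulN1r.
apply: bernstein_le => // k; rewrite mulN1r.
by apply: le_trans (ler_norm _) _; rewrite normrN; exact: gw.
Qed.

End bernstein.

(** * Put payoffs and their approximation by exponentials *)

Section put_payoff.
Context {R : realType}.
Implicit Types x y u : R.

(** For a law on [0, +oo[ the mean of [put y] is, as a function of [y], a primitive of the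
    distribution function. Unlike indicators of half-lines these functions are continuous, so atoms
    of the limit cause no trouble. Clipping [x] at 0 makes them bounded on the whole line. *)
Definition put y x : R := Num.max 0 (y - Num.max x 0).

Lemma put_ge0 y x : 0 <= put y x.
Proof. by rewrite le_max lexx. Qed.

Lemma bmeas_put y : bmeas (put y).
Proof.
apply: (@bmeas_bounded _ _ _ _ (Num.max 0 y)).
  by apply: measurable_maxr => //; apply: measurable_funB => //; exact: measurable_maxr.
move=> x; rewrite put_ge0 /put ge_max le_max lexx/= le_max.
by apply/orP; right; rewrite gerBl le_max lexx orbT.
Qed.

Lemma put_le0 y x : y <= 0 -> put y x = 0.
Proof.
move=> y0; apply/max_idPl; rewrite subr_le0; apply: le_trans y0 _.
by rewrite le_max lexx orbT.
Qed.

Lemma put_dist y z x : `|put y x - put z x| <= `|y - z|.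
Proof.
rewrite /put; set t := Num.max x 0.
wlog yz : y z / y <= z.
  by move=> H; have [/H//|/ltW/H] := leP y z; rewrite distrC [leRHS]distrC.
rewrite [leRHS]distrC [leRHS]ger0_norm ?subr_ge0//.
have [a|a] := leP 0 (y - t); have [b|b] := leP 0 (z - t); rewrite ler_norml; lra.
Qed.

(* In the variable [u = exp (- x)] the payoff is Lipschitz. *)
Let g y u := y + ln (Num.max u (expR (- y))).

Let put_g y x : 0 <= y -> 0 <= x -> put y x = g y (expR (- x)).
Proof.
move=> y0 x0; rewrite /put /g (max_idPl x0).
have [xy|yx] := leP x y.
  by rewrite (max_idPr _) ?subr_ge0// (max_idPl _) ?ler_expR ?lerN2// expRK.
rewrite (max_idPl _) ?subr_le0 ?ltW// (max_idPr _) ?ler_expR ?lerN2 ?ltW//.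
by rewrite expRK subrr.
Qed.

(** The maximum with exp (- y) keeps the argument of [ln] in the region where its slope is at most
    exp y. *)
Let g_lipschitz y u v : `|g y v - g y u| <= expR y * `|v - u|.
Proof.
rewrite /g; set c := expR (- y).
have c0 : 0 < c by exact: expR_gt0.
wlog uv : u v / u <= v.
  by move=> H; have [/H//|/ltW/H] := leP u v; rewrite distrC [X in _ * X]distrC.
set a := Num.max u c; set b := Num.max v c.
have ca : c <= a by rewrite le_max lexx orbT.
have ab : a <= b by rewrite /a /b ge_max !le_max uv lexx !orbT.
have a0 : 0 < a := lt_le_trans c0 ca; have b0 : 0 < b := lt_le_trans a0 ab.
have bavu : b - a <= v - u.
  rewrite /a /b; have [?|?] := leP v c; have [?|?] := leP u c; lra.
have -> : y + ln b - (y + ln a) = ln b - ln a by ring.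
rewrite !ger0_norm ?subr_ge0 ?ler_ln ?posrE//.
rewrite -ln_div ?posrE//.
have -> : b / a = 1 + (b - a) / a by field; rewrite gt_eqF.
have d0 : 0 <= (b - a) / a by rewrite divr_ge0 ?subr_ge0// ltW.
apply: le_trans (le_ln1Dx (lt_le_trans _ d0)) _; first by rewrite ltrN10.
rewrite ler_pdivrMr// mulrAC; apply: le_trans bavu _.
rewrite ler_peMl ?subr_ge0//.
by rewrite -(expRxMexpNx_1 y) ler_wpM2l ?expR_ge0.
Qed.

(** The mean of a polynomial in exp (- x) is a combination of Laplace transforms at integers, and
    these are the quantities known to converge. *)
Lemma put_approx y e : 0 <= y -> 0 < e ->
  exists p : {poly R}, forall x, 0 <= x -> `|p.[expR (- x)] - put y x| <= e.
Proof.
move=> y0 e0.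
(* Large enough for expR y / m <= e. *)
pose m := (Num.truncn (expR y / e)).+1.
exists (bernstein (m ^ 2) (fun k => g y (k%:R / (m ^ 2)%:R))) => x x0.
rewrite put_g//; apply: le_trans (@bernstein_lipschitz _ (g y) (expR y) m (expR (- x)) _ _ _) _ => //.
- by rewrite expR_ge0 expR_le1 oppr_le0.
- rewrite ler_pdivrMr ?ltr0n// mulrC -ler_pdivrMr//.
  by apply: ltW; rewrite /m real_truncnS_gt// num_real.
Qed.

End put_payoff.

(** * A law recovered from the means of its put payoffs *)

Section put_primitive.
Context {R : realType}.

(* [put_spread h y] is [1] on [[0, y]], [0] on [[y + h, +oo[] and affine in between. *)
Definition put_spread (h y x : R) : R := (put (y + h) x - put y x) / h.

Lemma put_spread_bounds (h y x : R) : 0 < h -> 0 <= put_spread h y x <= 1.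
Proof.
move=> h0; rewrite /put_spread ler_pdivrMr// ler_pdivlMr// mul0r mul1r /put.
set t := Num.max x 0.
have [?|?] := leP 0 (y + h - t); have [?|?] := leP 0 (y - t); lra.
Qed.

Lemma put_spread_eq1 h y x : 0 < h -> Num.max x 0 <= y -> put_spread h y x = 1.
Proof.
move=> h0; rewrite /put_spread /put; set t := Num.max x 0 => ty.
have [a|a] := leP 0 (y + h - t); last by lra.
have [b|b] := leP 0 (y - t); last by lra.
have -> : y + h - t - (y - t) = h by ring.
by rewrite divff// gt_eqF.
Qed.

Lemma put_spread_eq0 h y x : 0 < h -> y + h <= Num.max x 0 -> put_spread h y x = 0.
Proof.
move=> h0; rewrite /put_spread /put; set t := Num.max x 0 => ty.
have [a|a] := leP 0 (y + h - t); have [b|b] := leP 0 (y - t);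
  rewrite ?subrr ?mul0r//; try lra.
have -> : y + h - t = 0 by lra.
by rewrite subrr mul0r.
Qed.

Lemma bmeas_put_spread h y : bmeas (put_spread h y).
Proof.
apply: bmeasM; last exact: bmeas_cst.
by apply: bmeasB; exact: bmeas_put.
Qed.

Lemma put_spread_nd h y y' x : 0 < h -> y <= y' -> put_spread h y x <= put_spread h y' x.
Proof.
move=> h0 yy'; apply: ler_wpM2r; first by rewrite invr_ge0 ltW.
rewrite /put; set t := Num.max x 0.
have [?|?] := leP 0 (y + h - t); have [?|?] := leP 0 (y - t);
have [?|?] := leP 0 (y' + h - t); have [?|?] := leP 0 (y' - t); lra.
Qed.

Lemma stieltjes_probability (F : R -> R) : nondecreasing F ->
  right_continuous F -> F x @[x --> -oo] --> (0 : R) -> F x @[x --> +oo] --> (1 : R) ->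
  exists nu : probability R R, forall x, nu `]-oo, x]%classic = (F x)%:E.
Proof.
move=> ndF rcF F0 F1.
pose mix1 := isCumulative.Build R _ R F ndF rcF.
pose mix2 := isCumulativeBounded.Build R 0 1 F F0 F1.
pose G : cumulativeBounded (0 : R) (1 : R) := HB.pack F mix1 mix2.
(* The Stieltjes measure lives on [measurableTypeR R]; its image under the identity lives on [R]. *)
pose idR : measurableTypeR R -> R := idfun.
have mid : measurable_fun setT idR by exact: measurable_id.
pose idRm : {mfun measurableTypeR R >-> R} := HB.pack idR (isMeasurableFun.Build _ _ _ _ idR mid).
exists (distribution (lebesgue_stieltjes_measure G) idRm) => x.
exact: (cdf_lebesgue_stieltjes_id G x).
Qed.

Let sandwich_bound (a b c d0 s t : R) : s <= a - b <= t -> s <= c - d0 <= t ->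
  `|c - a - (d0 - b)| <= t - s.
Proof. by rewrite ler_norml; lra. Qed.

Let max0 (x : R) : R := Num.max x 0.

Let max0_mfun : {mfun R >-> R}.
Proof.
by apply: (HB.pack max0 (isMeasurableFun.Build _ _ _ _ max0 _)); exact: measurable_maxr.
Defined.

Let put_max0 y x : put y (max0 x) = put y x.
Proof. by rewrite /put /max0 -maxA maxxx. Qed.

Variables F Phi : R -> R.
Hypotheses (F_nd : nondecreasing F) (F_rc : right_continuous F).
Hypotheses (F_Ny : F x @[x --> -oo] --> (0 : R)) (F_y : F x @[x --> +oo] --> (1 : R)).
Hypothesis Phi0 : Phi 0 = 0.
Hypothesis Phi_step : forall z h, 0 < h -> h * F z <= Phi (z + h) - Phi z <= h * F (z + h).

(* [Phi] is the primitive of the distribution function [F] on [[0, +oo[]. *)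
Lemma put_primitive : exists rho : probability R R, rho `[0, +oo[%classic = 1%E /\
  forall y, 0 <= y -> \int[rho]_x put y x = Phi y.
Proof.
have [nu nuF] := stieltjes_probability F_nd F_rc F_Ny F_y.
have nuI z : \int[nu]_x (\1_(`]-oo, z]%classic) x : R) = F z.
  by rewrite integral_indic1// nuF.
have F_bounds z : 0 <= F z <= 1.
  by rewrite -lee_fin -(lee_fin _ 1) -nuF measure_ge0 probability_le1.
(* The image under x |-> max x 0 charges only [0, +oo[ and leaves the integrals of [put]
   unchanged. *)
pose rho : probability R R := distribution nu max0_mfun.
exists rho; split.
  rewrite /rho /= /distribution /pushforward (_ : _ @^-1` _ = setT) ?probability_setT//.
  by apply/seteqP; split=> // x _ /=; rewrite in_itv/= andbT /max0 le_max lexx orbT.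
move=> y y0; pose Psi z := \int[nu]_x put z x.
have -> : \int[rho]_x put y x = Psi y.
  rewrite integral_distr; last exact: bmeas_put.
  by apply: eq_Rintegral => x _; rewrite put_max0.
have bI z : bmeas (\1_(`]-oo, z]%classic) : R -> R) by exact: bmeas_indic.
have Psi_step z h : 0 <= z -> 0 < h -> h * F z <= Psi (z + h) - Psi z <= h * F (z + h).
  move=> z0 h0.
  have -> : Psi (z + h) - Psi z = h * \int[nu]_x put_spread h z x.
    rewrite -bintZl ?/Psi -?bintB; [|exact: bmeas_put..|exact: bmeas_put_spread].
    by apply: eq_Rintegral => x _; rewrite /put_spread mulrC divfK// gt_eqF.
  rewrite !ler_pM2l//; apply/andP; split.
    rewrite -nuI; apply: le_bint => [//||x]; first exact: bmeas_put_spread.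
    rewrite indicE.
    have [xz|xz] := boolP (x \in _); last by case/andP: (put_spread_bounds z x h0).
    by rewrite put_spread_eq1// ge_max z0 andbT; move: xz; rewrite inE/= in_itv.
  rewrite -nuI; apply: le_bint => [|//|x]; first exact: bmeas_put_spread.
  rewrite indicE.
  have [xz|xz] := boolP (x \in _); first by case/andP: (put_spread_bounds z x h0).
  rewrite put_spread_eq0// le_max ltW//; move: xz; rewrite notin_setE/= in_itv/= => /negP.
  by rewrite -ltNge.
pose Delta z := Phi z - Psi z.
(* The increments of [Phi] and [Psi] both lie between h F(z) and h F(z + h). *)
have Delta_step z h : 0 <= z -> 0 < h -> `|Delta (z + h) - Delta z| <= h * (F (z + h) - F z).
  move=> z0 h0; rewrite /Delta mulrBr.
  exact: sandwich_bound (Psi_step z h z0 h0) (Phi_step z h0).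
have Delta0 : Delta 0 = 0.
  rewrite /Delta /Psi Phi0 sub0r; under eq_Rintegral do rewrite put_le0//.
  by rewrite bint_cst oppr0.
(* Over n + 1 steps of length h = y / (n + 1) the bounds telescope to h (F y - F 0) <= h, and n is
   arbitrary. *)
have Delta_small n : `|Delta y| <= y / n.+1%:R.
  have [->|y_neq0] := eqVneq y 0; first by rewrite Delta0 normr0 mul0r.
  have ygt0 : 0 < y by rewrite lt_neqAle eq_sym y_neq0.
  pose h := y / n.+1%:R; have h0 : 0 < h by rewrite divr_gt0.
  have H i : `|Delta (i%:R * h)| <= h * (F (i%:R * h) - F 0).
    elim: i => [|i IH]; first by rewrite mul0r Delta0 normr0 subrr mulr0.
    rewrite -natr1 mulrDl mul1r.
    have ih0 : 0 <= i%:R * h by rewrite mulr_ge0// ltW.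
    rewrite -[X in `|X|](subrK (Delta (i%:R * h))).
    apply: le_trans (ler_normD _ _) _; apply: le_trans (lerD (Delta_step _ _ ih0 h0) IH) _.
    by rewrite -mulrDr addrA subrK.
  have := H n.+1; rewrite [n.+1%:R * h]mulrC divfK ?pnatr_eq0// => /le_trans; apply.
  rewrite ler_piMr ?(ltW h0)// lerBlDr.
  have /andP[F00 _] := F_bounds 0; have /andP[_ Fy1] := F_bounds y.
  by rewrite ler_wpDr.
apply/esym/eqP; rewrite -subr_eq0 -normr_le0; apply/ler_addgt0Pr => e e0; rewrite add0r.
apply: le_trans (Delta_small (Num.truncn (y / e))) _.
rewrite ler_pdivrMr ?ltr0n// mulrC -ler_pdivrMr//.
by apply: ltW; rewrite real_truncnS_gt// num_real.
Qed.

End put_primitive.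

(** * Existence of the limit law *)

Section helly.
Context {R : realType}.

(** The limit is not known in advance, hence the Cauchy criterion. *)
Lemma cvg_of_approx (u : nat -> R) : (forall e : R, 0 < e ->
    exists2 v : nat -> R, cvgn v & forall n, `|v n - u n| <= e) -> cvgn u.
Proof.
move=> H; apply/cauchy_cvgP/cauchy_exP => e e0.
have e20 : 0 < e / 2 by rewrite divr_gt0.
have [v cv uv] := H _ e20; exists (limn v).
have /cvgrPdist_lt/(_ _ e20) := cv; apply: filterS => n vn.
rewrite /ball/=; have -> : limn v - u n = (limn v - v n) + (v n - u n) by ring.
by apply: le_lt_trans (ler_normD _ _) _; have := uv n; lra.
Qed.

Let difference_bound (a b c d0 z y h e : R) : - (z - y) <= a - b ->
  c - d0 <= z - y -> z < y + h * e / 4 -> c - a - (d0 - b) <= e / 2 * h.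
Proof. lra. Qed.

Let increment_bound (a b c d0 e : R) : c <= a -> a <= b + e / 2 -> b < d0 + e / 2 ->
  c - d0 <= e.
Proof. lra. Qed.

Variables (dT : nat -> measure_display) (T : forall k, measurableType (dT k)).
Variables (P : forall k, probability (T k) R) (S : forall k, T k -> R).
Hypothesis mS : forall k, measurable_fun setT (@S k).
Hypothesis S_ge0 : forall k w, 0 <= @S k w.
Hypothesis S_tight : forall e : R, 0 < e ->
  exists K, \forall k \near \oo, fine (P k [set w | K < S w]) <= e.
Hypothesis S_laplace : forall n : nat,
  cvgn (fun k => \int[P k]_w expR (- (n%:R * S w))).

Let bmeas_S (f : R -> R) k : bmeas f -> bmeas (fun w => f (@S k w)).
Proof. by move=> bf; exact: (bmeas_comp bf (@mS k)). Qed.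

Let bmeas_expS n k : bmeas (fun w => expR (- (n%:R * @S k w))).
Proof. by apply: bmeas_expRN => [|w]; [exact: measurable_funM|rewrite mulr_ge0]. Qed.

Let horner_expS (p : {poly R}) k w :
  p.[expR (- @S k w)] = \sum_(i < size p) p`_i * expR (- (i%:R * S w)).
Proof.
rewrite horner_coef; apply: eq_bigr => i _; congr (_ * _).
by rewrite -expRM_natl mulrN.
Qed.

Let bmeas_poly (p : {poly R}) k : bmeas (fun w => p.[expR (- @S k w)]).
Proof.
apply: (@bmeas_ext _ _ _ (fun w => \sum_(i < size p) p`_i * expR (- (i%:R * S w)))).
  by move=> w; rewrite horner_expS.
by apply: bmeas_sum => i; apply: bmeasM; [exact: bmeas_cst|exact: bmeas_expS].
Qed.

Let cvg_poly (p : {poly R}) : cvgn (fun k => \int[P k]_w p.[expR (- S w)]).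
Proof.
rewrite (_ : (fun _ => _) =
    fun k => \sum_(i < size p) p`_i * \int[P k]_w expR (- (i%:R * S w))).
  suff H (s : seq 'I_(size p)) :
      cvgn (fun k => \sum_(i <- s) p`_i * \int[P k]_w expR (- (i%:R * S w))) by exact: H.
  elim: s => [|i s IH].
    by under eq_fun do rewrite big_nil; exact: is_cvg_cst.
  under eq_fun do rewrite big_cons; apply: is_cvgD => //.
  by apply: is_cvgM; [exact: is_cvg_cst|exact: S_laplace].
apply/funext => k; under eq_Rintegral do rewrite horner_expS.
rewrite bint_sum => [|i]; last by apply: bmeasM; [exact: bmeas_cst|exact: bmeas_expS].
by apply: eq_bigr => i _; rewrite bintZl.
Qed.

Let cvg_put y : cvgn (fun k => \int[P k]_w put y (S w)).
Proof.
have [y0|/ltW y0] := leP y 0.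
  rewrite (_ : (fun _ => _) = fun=> 0); first exact: is_cvg_cst.
  by apply/funext => k; under eq_Rintegral do rewrite put_le0//; rewrite bint_cst.
apply: cvg_of_approx => e e0; have [p pe] := put_approx y0 e0.
exists (fun k => \int[P k]_w p.[expR (- S w)]); first exact: cvg_poly.
move=> k; have bput := bmeas_S k (bmeas_put y).
apply: le_trans (normr_integralB_le _ (bmeas_poly p k) bput) _.
apply: integral_le_cst; first by apply: bmeas_norm; exact: bmeasB.
by move=> w; exact: pe.
Qed.

Let Phi (y : R) : R := limn (fun k => \int[P k]_w put y (S w)).

Let Phi_cvg y : \int[P k]_w put y (S w) @[k --> \oo] --> Phi y.
Proof. exact: cvg_put. Qed.

Let D (h y : R) : R := (Phi (y + h) - Phi y) / h.

Let D_cvg h y : \int[P k]_w put_spread h y (S w) @[k --> \oo] --> D h y.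
Proof.
rewrite (_ : (fun _ => _) = (fun k => (\int[P k]_w put (y + h) (S w) -
    \int[P k]_w put y (S w)) / h)).
  by apply: cvgM; [apply: cvgB; exact: Phi_cvg|exact: cvg_cst].
have bS z k : bmeas (fun w => put z (@S k w)) by apply: bmeas_S; exact: bmeas_put.
by apply/funext => k; rewrite -bintB// -bintZr//; exact: bmeasB.
Qed.

Let D_le h y h' y' : (forall x, put_spread h y x <= put_spread h' y' x) -> D h y <= D h' y'.
Proof.
move=> rr; apply: (ler_cvg_to (@D_cvg h y) (@D_cvg h' y')); apply: nearW => k.
by apply: le_bint => [|| w]; [exact: bmeas_S (bmeas_put_spread _ _)|exact: bmeas_S (bmeas_put_spread _ _)|exact: rr].
Qed.

Let D_bounds h y : 0 < h -> 0 <= D h y <= 1.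
Proof.
move=> h0; apply/andP; split.
  apply: (ler_cvg_to (cvg_cst (0 : R)) (@D_cvg h y)); apply: nearW => k.
  by apply: Rintegral_ge0 => w _; case/andP: (put_spread_bounds y (S w) h0).
apply: (ler_cvg_to (@D_cvg h y) (cvg_cst (1 : R))); apply: nearW => k.
apply: integral_le_cst => [|w]; first exact: bmeas_S (bmeas_put_spread _ _).
by case/andP: (put_spread_bounds y (S w) h0).
Qed.

(** Right derivative of [Phi], which is convex as a limit of means of convex functions of [y]: the
    difference quotients increase with [h], so their infimum is their limit at 0. *)
Let F (y : R) : R := inf [set D h y | h in [set h | 0 < h]].

Let F_has_inf y : has_inf [set D h y | h in [set h | 0 < h]].
Proof.
split; first by exists (D 1 y); exists 1 => //=.
by exists 0 => _ [h /= h0 <-]; case/andP: (D_bounds y h0).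
Qed.

Let F_le h y : 0 < h -> F y <= D h y.
Proof. by move=> h0; apply: ge_inf; [case: (F_has_inf y)|exists h]. Qed.

Let F_ge c y : (forall h, 0 < h -> c <= D h y) -> c <= F y.
Proof.
move=> H; apply: lb_le_inf; first by case: (F_has_inf y).
by move=> _ [h /= h0 <-]; exact: H.
Qed.

(** The indicator of max x 0 <= y + h separates the spreads pointwise: the spread of width [h] at
    [y] lies below it, every spread at y + h lies above. *)
Let D_le_F h y : 0 < h -> D h y <= F (y + h).
Proof.
move=> h0; apply: F_ge => h' h'0; apply: D_le => x.
have [xy|yx] := leP (Num.max x 0) (y + h).
  by rewrite [leRHS]put_spread_eq1//; case/andP: (put_spread_bounds y x h0).
rewrite put_spread_eq0 //; last exact: ltW.
by case/andP: (put_spread_bounds (y + h) x h'0).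
Qed.

Let F_nd : nondecreasing F.
Proof.
move=> y y' yy'; apply: F_ge => h h0; apply: le_trans (F_le y h0) _.
by apply: D_le => x; exact: put_spread_nd.
Qed.

Let F_bounds y : 0 <= F y <= 1.
Proof.
apply/andP; split; first by apply: F_ge => h h0; case/andP: (D_bounds y h0).
by apply: le_trans (F_le y ltr01) _; case/andP: (D_bounds y (@ltr01 R)).
Qed.

Let Phi_lip y z : `|Phi y - Phi z| <= `|y - z|.
Proof.
have H : `|\int[P k]_w put y (S w) - \int[P k]_w put z (S w)| @[k --> \oo] --> `|Phi y - Phi z|.
  by apply: cvg_norm; apply: cvgB; exact: Phi_cvg.
apply: (ler_cvg_to H (cvg_cst _)); apply: nearW => k.
have bS u : bmeas (fun w => put u (@S k w)) by apply: bmeas_S; exact: bmeas_put.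
apply: le_trans (normr_integralB_le _ (bS y) (bS z)) _.
by apply: integral_le_cst => [|w]; [apply: bmeas_norm; exact: bmeasB|exact: put_dist].
Qed.

(** Fix [h] with D h y < F y + e/2. As [Phi] is 1-Lipschitz, D h moves by at most 2 (z - y) / h <=
    e/2 from [y] to [z] when z - y < h e / 4, and D h z bounds F z. *)
Let F_rc : right_continuous F.
Proof.
move=> y; apply/cvgrPdist_le => e e0.
have [_ [h /= h0 <-] hF] : exists2 u, [set D h y | h in [set h | 0 < h]] u & u < F y + e / 2.
  by apply: inf_adherent => //; rewrite divr_gt0.
have del0 : 0 < h * e / 4 by rewrite divr_gt0// mulr_gt0.
near=> z.
have yz : y < z by near: z; exact: nbhs_right_gt.
have zy : z < y + h * e / 4 by near: z; apply: nbhs_right_lt; rewrite ltrDl.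
rewrite distrC ger0_norm ?subr_ge0; last exact: F_nd (ltW yz).
have Dz : D h z <= D h y + e / 2.
  rewrite /D -lerBlDl -mulrBl ler_pdivrMr//.
  have := Phi_lip (z + h) (y + h); have := Phi_lip z y.
  have -> : z + h - (y + h) = z - y by ring.
  have zy0 : 0 <= z - y by rewrite subr_ge0 ltW.
  rewrite (ger0_norm zy0).
  rewrite !ler_norml => /andP[+ _] /andP[_ +].
  by move=> A B; exact: difference_bound A B zy.
exact: increment_bound (F_le z h0) Dz hF.
Unshelve. all: by end_near. Qed.

Let F_lt0 y : y < 0 -> F y = 0.
Proof.
move=> y0; apply/eqP; rewrite eq_le; have /andP[-> _] := F_bounds y; rewrite andbT.
have h0 : 0 < - y by rewrite oppr_gt0.
apply: le_trans (F_le y h0) _; rewrite /D addrN.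
have -> : Phi 0 = Phi y; last by rewrite subrr mul0r.
congr (limn _); apply/funext => k; apply: eq_Rintegral => w _.
by rewrite !put_le0// ltW.
Qed.

Let F_Ny : F x @[x --> -oo] --> (0 : R).
Proof.
apply: cvg_near_cst; near=> x; apply: F_lt0.
by near: x; apply: nbhs_ninfty_lt; exact: num_real.
Unshelve. all: by end_near. Qed.

(** Tightness keeps the mass from escaping: for y >= K every spread at [y] equals 1 on S <= K, an
    event of probability at least 1 - e for large k. *)
Let F_y : F x @[x --> +oo] --> (1 : R).
Proof.
apply/cvgrPdist_le => e e0; have [K HK] := S_tight e0.
near=> y.
have Ky : Num.max K 0 <= y by near: y; apply: nbhs_pinfty_ge; exact: num_real.
have /andP[_ F1] := F_bounds y.
rewrite ger0_norm ?subr_ge0// lerBlDr -lerBlDl; apply: F_ge => h h0.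
apply: (ler_cvg_to (cvg_cst (1 - e)) (@D_cvg h y)).
move: HK; apply: filterS => k Pk.
have mA : measurable [set w | K < @S k w].
  rewrite (_ : [set _ | _] = @S k @^-1` `]K, +oo[).
    by rewrite -[X in measurable X]setTI; apply: mS.
  by apply/seteqP; split => w /=; rewrite in_itv/= andbT.
have bI : bmeas (\1_[set w | K < @S k w] : T k -> R) by exact: bmeas_indic.
apply: (@le_trans _ _ (\int[P k]_w (1 - \1_[set w | K < @S k w] w))).
  rewrite bintB//; last exact: bmeas_cst.
  by rewrite bint_cst integral_indic1// lerB.
apply: le_bint => [||w]; first by apply: bmeasB => //; exact: bmeas_cst.
  exact: bmeas_S (bmeas_put_spread _ _).
rewrite indicE; have [wK|wK] := boolP (w \in _).
  by rewrite subrr; case/andP: (put_spread_bounds y (S w) h0).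
rewrite subr0 put_spread_eq1//; rewrite notin_setE/= in wK.
have {}wK : S w <= K by rewrite leNgt; apply/negP.
by rewrite ge_max; apply/andP; split; apply: le_trans Ky; rewrite le_max ?wK ?lexx ?orbT.
Unshelve. all: by end_near. Qed.

Lemma exists_put_limit : exists rho : probability R R, rho `[0, +oo[%classic = 1%E /\
  forall y, \int[P k]_w put y (S w) @[k --> \oo] --> \int[rho]_x put y x.
Proof.
have Phi0 : Phi 0 = 0.
  rewrite /Phi (_ : (fun k => _) = fun=> 0) ?lim_cst//.
  apply/funext => k; under eq_Rintegral do rewrite put_le0//.
  by rewrite bint_cst.
have Phi_step z h : 0 < h -> h * F z <= Phi (z + h) - Phi z <= h * F (z + h).
  move=> h0; apply/andP; split; rewrite mulrC.
    by rewrite -ler_pdivlMr//; exact: (F_le z h0).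
  by rewrite -ler_pdivrMr//; exact: (D_le_F z h0).
have [rho [rho1 rhoP]] := put_primitive F_nd F_rc F_Ny F_y Phi0 Phi_step.
exists rho; split => // y; have [y0|/ltW y0] := leP y 0; last first.
  by rewrite (rhoP y y0); exact: Phi_cvg.
rewrite (_ : (fun _ => _) = fun=> 0).
  under eq_Rintegral do rewrite put_le0//.
  by rewrite bint_cst; exact: cvg_cst.
by apply/funext => k; under eq_Rintegral do rewrite put_le0//; rewrite bint_cst.
Qed.

End helly.

(** * From put payoffs to bounded continuous functions *)

Section weak_limit.
Context {R : realType}.
Variables (dT : nat -> measure_display) (T : forall k, measurableType (dT k)).
Variables (P : forall k, probability (T k) R) (S : forall k, T k -> R).
Hypothesis mS : forall k, measurable_fun setT (@S k).
Hypothesis S_ge0 : forall k w, 0 <= @S k w.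
Variable rho : probability R R.
Hypothesis rho_ge0 : rho `[0, +oo[%classic = 1%E.
Hypothesis put_cvg : forall y, \int[P k]_w put y (S w) @[k --> \oo] --> \int[rho]_x put y x.

(** A deterministic sequence of laws is viewed as a random one over the one-point space [unit], so
    that the closure properties of [L1_cvg] apply to it. *)
Let Phi k (z : unit * T k) : R := S z.2.

Let mPhi k : measurable_fun setT (@Phi k).
Proof. exact: (measurableT_comp (@mS k) measurable_snd). Qed.

Let Pr (k : nat) : probability (unit : measurableType _) R := \d_ tt.

Local Notation L1 := (L1_cvg Pr P Phi rho).

Let L1P (g : R -> R) :
  L1 g <-> \int[P k]_w g (S w) @[k --> \oo] --> \int[rho]_x g x.
Proof.
rewrite /L1_cvg (_ : (fun k => Rintegral _ _ _) =
    fun k => `|\int[P k]_w g (S w) - \int[rho]_x g x|); last first.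
  by apply/funext => k; rewrite -[RHS](bint_cst (Pr k)).
split => [H|H].
  by apply/subr_cvg0; apply: norm_cvg0.
by rewrite -(normr0 R); apply: cvg_norm; apply/subr_cvg0.
Qed.

Let L1_spread h y : L1 (put_spread h y).
Proof.
rewrite (_ : put_spread h y = fun x => h^-1 * (put (y + h) x + -1 * put y x)); last first.
  by apply/funext => x; rewrite /put_spread mulN1r mulrC.
have bp z : bmeas (fun x : R => -1 * put z x) by apply: bmeasM; [exact: bmeas_cst|exact: bmeas_put].
apply: (L1_cvgZ mPhi); first by apply: bmeasD => //; exact: bmeas_put.
apply: (L1_cvgD mPhi) => //; [exact: bmeas_put|exact/L1P/put_cvg|].
by apply: (L1_cvgZ mPhi); [exact: bmeas_put|exact/L1P/put_cvg].
Qed.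

Let L1_sum (g : nat -> R -> R) n : (forall i, bmeas (g i)) -> (forall i, L1 (g i)) ->
  L1 (fun x => \sum_(0 <= i < n) g i x).
Proof.
move=> bg Lg; elim: n => [|n IH].
  have -> : (fun x => \sum_(0 <= i < 0) g i x) = put 0.
    by apply/funext => x; rewrite big_geq// put_le0.
  exact/L1P/put_cvg.
have -> : (fun x => \sum_(0 <= i < n.+1) g i x) = fun x => \sum_(0 <= i < n) g i x + g n x.
  by apply/funext => x; rewrite big_nat_recr.
exact: (L1_cvgD mPhi (bmeas_sum _ bg) (bg n) IH (Lg n)).
Qed.

(* [f] is compared with its piecewise linear interpolation on the grid of
   step [h], whose hat functions are differences of [put_spread]s. *)
Let L1_continuous (f : R -> R) (M : R) : continuous f -> (forall x, `|f x| <= M) ->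
  L1 (fun x => f (Num.max x 0)).
Proof.
move=> cf fM; have M0 : 0 <= M := le_trans (normr_ge0 _) (fM 0).
have mf : measurable_fun setT f by exact: continuous_measurable_fun.
have bf0 : bmeas (fun x : R => f (Num.max x 0)).
  by split; [apply: measurableT_comp => //; exact: measurable_maxr|exists M].
have bv n : bmeas (fun x : R => M * (1 - put_spread 1 n%:R x)).
  by apply: bmeasM; [exact: bmeas_cst|apply: bmeasB; [exact: bmeas_cst|exact: bmeas_put_spread]].
apply: (L1_cvg_dominated mPhi) => // e e0.
have e20 : 0 < e / 2 by rewrite divr_gt0.
have cvg0 : \int[rho]_x (M * (1 - put_spread 1 n%:R x)) @[n --> \oo] --> (0 : R).
  rewrite -(bint_cst rho 0); apply: (@bounded_cvg_integral _ _ _ _ _ _ M).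
  - by move=> n; case: (bv n).
  - exact: measurable_cst.
  - move=> n x; have /andP[? ?] := put_spread_bounds n%:R x (@ltr01 R).
    by rewrite ger0_norm ?mulr_ge0 ?subr_ge0// ler_piMr// lerBlDr lerDl.
  - move=> x; apply: cvg_near_cst; near=> n.
    rewrite put_spread_eq1 ?subrr ?mulr0//.
    by near: n; exact: nbhs_infty_ger.
have /cvgr0Pnorm_le/(_ _ e20)[n _ /(_ n (leqnn n)) /= nM] := cvg0.
have [del del0 fdel] := compact_uniformly_continuous (@segment_compact R 0 n.+1%:R) cf e20.
(* The step is the inverse of an integer, so that n + 1 is a grid point. *)
pose m := (Num.truncn del^-1).+1; pose h : R := m%:R^-1.
have mR : 0 < m%:R :> R by rewrite ltr0n.
have h0 : 0 < h by rewrite invr_gt0.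
have hdel : h < del.
  by rewrite -[ltRHS]invrK ltf_pV2 ?posrE ?invr_gt0// real_truncnS_gt// num_real.
(* The hats are tents at k h for 0 <= k < N. They telescope to the spread at n + 1, which is 1 on
   [0, n + 1], because [Q 0], the spread at - h, vanishes. *)
pose N := (n.+1 * m).+1.
pose Q (k : nat) (x : R) : R := put_spread h (k%:R * h - h) x.
have QN x : Q N x = put_spread h n.+1%:R x.
  by rewrite /Q /N -natr1 mulrDl mul1r addrK natrM /h mulfK// gt_eqF.
have Q0 x : Q 0%N x = 0.
  by rewrite /Q /put_spread mul0r sub0r addNr !put_le0 ?subrr ?mul0r// oppr_le0 ltW.
pose hat (k : nat) (x : R) : R := Q k.+1 x - Q k x.
have hat_ge0 k x : 0 <= hat k x.
  by rewrite subr_ge0; apply: put_spread_nd => //; rewrite lerD2r ler_pM2r// ler_nat.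
have bhat k : bmeas (hat k) by apply: bmeasB; exact: bmeas_put_spread.
have Lhat k : L1 (hat k).
  rewrite (_ : hat k = fun x => Q k.+1 x + -1 * Q k x); last first.
    by apply/funext => x; rewrite mulN1r.
  apply: (L1_cvgD mPhi); [exact: bmeas_put_spread| |exact: L1_spread|].
    by apply: bmeasM; [exact: bmeas_cst|exact: bmeas_put_spread].
  by apply: (L1_cvgZ mPhi); [exact: bmeas_put_spread|exact: L1_spread].
have sum_hat x : \sum_(0 <= k < N) hat k x = put_spread h n.+1%:R x.
  by rewrite telescope_sumr// QN Q0 subr0.
pose g (x : R) : R := \sum_(0 <= k < N) f (k%:R * h) * hat k x.
have bterm k : bmeas (fun x : R => f (k%:R * h) * hat k x) by apply: bmeasM => //; exact: bmeas_cst.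
exists g, (fun x : R => M * (1 - put_spread 1 n%:R x) + e / 2); split.
- split; first exact: bmeas_sum.
  exact: (L1_sum N bterm (fun k => L1_cvgZ mPhi (f (k%:R * h)) (bhat k) (Lhat k))).
- have be : bmeas (fun _ : R => e / 2) by exact: bmeas_cst.
  split; first exact: bmeasD.
  apply/L1P; rewrite bintD// bint_cst.
  rewrite (_ : (fun _ => _) = fun k => \int[P k]_w (M * (1 - put_spread 1 n%:R (S w))) + e / 2).
    apply: cvgD; last exact: cvg_cst; apply/(L1P (fun x => M * (1 - put_spread 1 n%:R x))).
    apply: (L1_cvgZ mPhi); first by apply: bmeasB; [exact: bmeas_cst|exact: bmeas_put_spread].
    have -> : (fun x => 1 - put_spread 1 n%:R x) = fun x : R => 1 + -1 * put_spread 1 n%:R x.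
      by apply/funext => x; rewrite mulN1r.
    apply: (L1_cvgD mPhi); [exact: bmeas_cst| | |].
    + by apply: bmeasM; [exact: bmeas_cst|exact: bmeas_put_spread].
    + apply/L1P; rewrite bint_cst; under eq_fun do rewrite bint_cst; exact: cvg_cst.
    + by apply: (L1_cvgZ mPhi); [exact: bmeas_put_spread|exact: L1_spread].
  apply/funext => k; rewrite bintD ?bint_cst//; last exact: bmeas_cst.
  exact: (bmeas_comp (bv n) (@mS k)).
- move=> x; set y := Num.max x 0.
  have y0 : 0 <= y by rewrite le_max lexx orbT.
  have c01 := put_spread_bounds n.+1%:R x h0.
  have cc : 1 - put_spread h n.+1%:R x <= 1 - put_spread 1 n%:R x.
    rewrite lerD2l lerN2.
    have [xy|yx] := leP y n.+1%:R.
      by rewrite [leRHS]put_spread_eq1//; case/andP: (put_spread_bounds n%:R x (@ltr01 R)).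
    rewrite put_spread_eq0//; first by case/andP: c01.
    by rewrite natr1 ltW.
  have -> : f y - g x = f y * (1 - put_spread h n.+1%:R x) +
      \sum_(0 <= k < N) (f y - f (k%:R * h)) * hat k x.
    have -> : \sum_(0 <= k < N) (f y - f (k%:R * h)) * hat k x =
        f y * \sum_(0 <= k < N) hat k x - g x.
      by rewrite mulr_sumr -sumrB; apply: eq_bigr => k _; rewrite mulrBl.
    by rewrite sum_hat; ring.
  apply: le_trans (ler_normD _ _) _; apply: lerD.
    rewrite normrM; apply: ler_pM => //.
    by rewrite ger0_norm//; case/andP: c01; rewrite subr_ge0.
  apply: le_trans (ler_norm_sum _ _ _) _.
  apply: (@le_trans _ _ (\sum_(0 <= k < N) e / 2 * hat k x)); last first.
    by rewrite -mulr_sumr sum_hat; apply: ler_piMr; [exact: ltW|case/andP: c01].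
  rewrite !big_nat; apply: ler_sum => k /andP[_ kN].
  rewrite normrM [X in _ * X]ger0_norm//.
  have kh0 : 0 <= k%:R * h by rewrite mulr_ge0// ltW.
  have [y1|y1] := leP y (k%:R * h - h).
    rewrite /hat /Q [put_spread _ (k.+1%:R * h - h) _]put_spread_eq1 ?put_spread_eq1 ?subrr ?mulr0//.
    by apply: le_trans y1 _; rewrite lerD2r ler_pM2r// ler_nat.
  have [y2|y2] := leP (k%:R * h + h) y.
    rewrite /hat /Q !put_spread_eq0 ?subrr ?mulr0// ?subrK.
      by apply: le_trans y2; rewrite lerDl ltW.
    by apply: le_trans y2; rewrite -natr1 mulrDl mul1r.
  (* The grid point lies in [0, n + 1], whereas [y] may exceed n + 1 by less than [h]. *)
  apply: ler_wpM2r => //; rewrite distrC; apply: fdel.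
    rewrite /= in_itv/= kh0/= /h ler_pdivrMr// -natrM ler_nat.
    by rewrite -ltnS.
  by rewrite /ball/= ltr_distl; apply/andP; split; lra.
- have be : bmeas (fun _ : R => e / 2) by exact: bmeas_cst.
  rewrite bintD// bint_cst; have := ler_norm (\int[rho]_x (M * (1 - put_spread 1 n%:R x))).
  by lra.
Unshelve. all: by end_near. Qed.

Lemma weak_limit_of_put (f : R -> R) : continuous f -> bounded_fun f ->
  \int[P k]_w f (S w) @[k --> \oo] --> \int[rho]_x f x.
Proof.
move=> cf bdf; have bf : bmeas f by exact: bmeas_continuous.
have [M fM] := bf.2; have /L1P := L1_continuous cf fM.
have bf0 : bmeas (fun x : R => f (Num.max x 0)).
  by apply: (bmeas_comp bf); exact: measurable_maxr.
have -> : \int[rho]_x f (Num.max x 0) = \int[rho]_x f x.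
  apply: (eq_integral_on _ rho_ge0) => // x.
  by rewrite /= in_itv/= andbT => /max_idPl ->.
suff -> : (fun k => \int[P k]_w f (Num.max (S w) 0)) = fun k => \int[P k]_w f (S w) by [].
by apply/funext => k; apply: eq_Rintegral => w _; rewrite (max_idPl _).
Qed.

End weak_limit.

(** * Random projections *)

Section laplace.
Context {R : realType}.
Variables (dT : nat -> measure_display) (T : forall k, measurableType (dT k)).
Variables (P : forall k, probability (T k) R) (S : forall k, T k -> R).
Hypothesis mS : forall k, measurable_fun setT (@S k).
Hypothesis S_ge0 : forall k w, 0 <= @S k w.

Definition tight := forall e : R, 0 < e ->
  exists K, \forall k \near \oo, fine (P k [set w | K < S w]) <= e.

Lemma laplace_weak_limit : tight ->
  (forall n : nat, cvgn (fun k => \int[P k]_w expR (- (n%:R * S w)))) ->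
  exists rho : probability R R, rho `[0, +oo[%classic = 1%E /\
    forall f : R -> R, continuous f -> bounded_fun f ->
      \int[P k]_w f (S w) @[k --> \oo] --> \int[rho]_x f x.
Proof.
move=> St Sl; have [rho [rho1 put_lim]] := exists_put_limit mS S_ge0 St Sl.
by exists rho; split => // f cf bf; exact: (weak_limit_of_put mS S_ge0 rho1 put_lim).
Qed.

End laplace.

(** * Projections of a fixed vector on a uniform frame *)

Section stiefel.
Context {R : realType} {d q : nat}.

Lemma measurable_mulmxr_cV (t : 'cV[R]_d) :
  measurable_fun [set: 'M[R]_(q, d)] (fun g => g *m t).
Proof.
apply: measurable_fun_mx => i j.
rewrite (_ : (fun _ => _) = (fun g : 'M[R]_(q, d) => \sum_k g i k * t k j)).
  by apply: measurable_sum => k; apply: measurable_funM => //; exact: measurable_coord.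
by apply/funext => g; rewrite mxE.
Qed.

Lemma measurable_mulmx2 dT (T : measurableType dT) (g : T -> 'M[R]_(q, d)) (x : T -> 'cV[R]_q) :
  measurable_fun setT g -> measurable_fun setT x ->
  measurable_fun setT (fun z => (g z)^T *m x z).
Proof.
move=> mg mx; apply: measurable_fun_mx => i j.
rewrite (_ : (fun _ => _) = (fun z => \sum_k g z k i * x z k j)).
  apply: measurable_sum => k; apply: measurable_funM.
    exact: (measurableT_comp (@measurable_coord R q d k i) mg).
  exact: (measurableT_comp (@measurable_coord R q 1 k j) mx).
by apply/funext => z; rewrite mxE; apply: eq_bigr => k _; rewrite mxE.
Qed.

Lemma measurable_stiefel : measurable [set g : 'M[R]_(q, d) | g^T *m g = 1%:M].
Proof.
have -> : [set g : 'M[R]_(q, d) | g^T *m g = 1%:M] =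
    \bigcap_(ij in [set: 'I_d * 'I_d]) (fun g : 'M[R]_(q, d) => (g^T *m g) ij.1 ij.2) @^-1`
      [set (1%:M : 'M[R]_d) ij.1 ij.2].
  apply/seteqP; split => [g /= gg [i j] _ /=|g gg]; first by rewrite gg.
  by apply/matrixP => i j; have := gg (i, j) Logic.I.
apply: fin_bigcap_measurable; first exact: finite_finset.
move=> [i j] _ /=; rewrite -[X in measurable X]setTI.
have mf : measurable_fun setT (fun g : 'M[R]_(q, d) => (g^T *m g) i j).
  rewrite (_ : (fun _ => _) = (fun g : 'M[R]_(q, d) => \sum_k g k i * g k j)).
    by apply: measurable_sum => k; apply: measurable_funM; exact: measurable_coord.
  by apply/funext => g; rewrite mxE; apply: eq_bigr => k _; rewrite mxE.
exact: mf.
Qed.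

Lemma dot_trmx_mulmx (g : 'M[R]_(q, d)) t x : dot t (g^T *m x) = dot (g *m t) x.
Proof. by rewrite dot_mulmx. Qed.

Lemma scaled_sqnormE (x : 'cV[R]_q) : scaled_sqnorm x = dot x x / q%:R.
Proof. by rewrite /scaled_sqnorm enorm_dot. Qed.

Lemma scaled_sqnorm_ge0 (x : 'cV[R]_q) : 0 <= scaled_sqnorm x.
Proof. by rewrite scaled_sqnormE divr_ge0 ?dot_ge0. Qed.

Hypothesis q_gt0 : (0 < q)%N.
Variables (dO : measure_display) (Omega : measurableType dO) (Pr : probability Omega R).
Variable Gamma : {RV Pr >-> 'M[R]_(q, d)}.
Hypothesis Gamma_unif : uniform_on_stiefel (distribution Pr Gamma).

Let image_mfun (t : 'cV[R]_d) : {mfun 'M[R]_(q, d) >-> 'cV[R]_q}.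
Proof.
by apply: (HB.pack (fun g : 'M[R]_(q, d) => g *m t)
  (isMeasurableFun.Build _ _ _ _ _ (measurable_mulmxr_cV t))).
Defined.

Let nu t : probability 'cV[R]_q R := distribution (distribution Pr Gamma) (image_mfun t).

Let nu_inv t : rotation_invariant (nu t).
Proof.
move=> U UU A mA; have mA' : measurable ((image_mfun t) @^-1` A).
  by rewrite -[X in measurable X]setTI; exact: (measurable_mulmxr_cV t).
rewrite [RHS](_ : _ = distribution (distribution Pr Gamma) (mulmx U) ((image_mfun t) @^-1` A)); last first.
  by rewrite (Gamma_unif.2 U UU).
rewrite /nu /distribution /pushforward; congr (Pr _); apply/seteqP.
by split => w /=; rewrite mulmxA.
Qed.

Let nu_sphere t : nu t [set w | dot w w = dot t t] = 1%E.
Proof.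
apply/eqP; rewrite eq_le probability_le1; last exact: measurable_sphere.
rewrite -Gamma_unif.1 /nu /distribution /pushforward; apply: le_measure; rewrite ?inE.
- exact: measurable_stiefel.
- exact: (measurable_funPTI (image_mfun t) (measurable_sphere _)).
- by move=> w /= h; rewrite dot_isometry.
Qed.

Let integral_nu t (f : 'cV[R]_q -> R) : bmeas f ->
  \int[nu t]_w f w = \int[Pr]_w f (Gamma w *m t).
Proof.
move=> bf; rewrite integral_distr// integral_distr//.
exact: (bmeas_comp bf (measurable_mulmxr_cV t)).
Qed.

Lemma stiefel_cos (t : 'cV[R]_d) (x : 'cV[R]_q) :
  `|\int[Pr]_w cos (dot t ((Gamma w)^T *m x)) - expR (- (dot t t / 2 * scaled_sqnorm x))| <=
  3 * (dot t t * scaled_sqnorm x) ^+ 2 / q%:R.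
Proof.
under eq_Rintegral do rewrite dot_trmx_mulmx.
rewrite -(integral_nu t (f := fun w => cos (dot w x))); last first.
  by apply: bmeas_cos; exact: measurable_dot.
have -> : dot t t / 2 * scaled_sqnorm x = (dot t t * scaled_sqnorm x) / 2 by ring.
by apply: (sphere_cos (nu_inv t) (nu_sphere t) q_gt0); rewrite scaled_sqnormE mulrA.
Qed.

Lemma stiefel_cos_shift (t : 'cV[R]_d) (x : 'cV[R]_q) th :
  \int[Pr]_w cos (dot t ((Gamma w)^T *m x) + th) =
  cos th * \int[Pr]_w cos (dot t ((Gamma w)^T *m x)).
Proof.
under eq_Rintegral do rewrite dot_trmx_mulmx.
under [in RHS]eq_Rintegral do rewrite dot_trmx_mulmx.
rewrite -(integral_nu t (f := fun w => cos (dot w x))); last first.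
  by apply: bmeas_cos; exact: measurable_dot.
rewrite -(integral_nu t (f := fun w => cos (dot w x + th))); last first.
  by apply: bmeas_cos; apply: measurable_funD => //; exact: measurable_dot.
exact: (integral_cos_shift (nu_inv t)).
Qed.

(** This serves tightness: a vector of large norm has, with probability bounded below, a projection
    along [t] that is not small. *)
Lemma stiefel_min (t : 'cV[R]_d) (x : 'cV[R]_q) (kappa a : R) : 0 <= kappa ->
  a = kappa * (dot t t * scaled_sqnorm x) ->
  a - 3 / 4 * a ^+ 2 <= \int[Pr]_w Num.min 1 (kappa * dot t ((Gamma w)^T *m x) ^+ 2).
Proof.
move=> k0 aE; under eq_Rintegral do rewrite dot_trmx_mulmx.
rewrite -(integral_nu t (f := fun w => Num.min 1 (kappa * dot w x ^+ 2))); last first.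
  apply: bmeas_min => // [|w]; last by rewrite mulr_ge0// sqr_ge0.
  by apply: measurable_funM => //; apply: measurable_funX; exact: measurable_dot.
apply: (sphere_min (nu_inv t) (nu_sphere t) q_gt0) => //.
by rewrite aE scaled_sqnormE; congr (_ * _); rewrite mulrA.
Qed.

End stiefel.

Lemma cvg0_approx_near (R : realType) (u : nat -> R) :
  (forall e : R, 0 < e -> exists2 v, v n @[n --> \oo] --> (0 : R) &
    \forall n \near \oo, `|u n| <= v n + e) -> u n @[n --> \oo] --> (0 : R).
Proof.
move=> H; apply/cvgr0Pnorm_le => e e0.
have [v v0 uv] := H (e / 2) (divr_gt0 e0 (ltr0n _ 2)).
have /cvgr0Pnorm_le/(_ _ (divr_gt0 e0 (ltr0n _ 2))) := v0.
by move: uv; apply: filterS2 => n uvn vn; have := ler_norm (v n); lra.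
Qed.

Lemma cvg_ext (R : realType) (u v : nat -> R) (l : R) : u =1 v ->
  u n @[n --> \oo] --> l -> v n @[n --> \oo] --> l.
Proof. by move=> /funext ->. Qed.

Lemma cvgr_unique (R : realType) (u : nat -> R) (l l' : R) :
  u n @[n --> \oo] --> l -> u n @[n --> \oo] --> l' -> l = l'.
Proof. by move=> /(cvg_lim (@Rhausdorff R)) <- /(cvg_lim (@Rhausdorff R)) <-. Qed.

Lemma measurable_gt_set (R : realType) dT (T : measurableType dT) (f : T -> R) (c : R) :
  measurable_fun setT f -> measurable [set x | c < f x].
Proof.
move=> mf; rewrite (_ : [set _ | _] = f @^-1` `]c, +oo[).
  by rewrite -[X in measurable X]setTI; apply: mf.
by apply/seteqP; split => x /=; rewrite in_itv/= andbT.
Qed.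

Lemma cosM (R : realType) (a b : R) : cos a * cos b = 1 / 2 * (cos (a - b) + cos (a + b)).
Proof. by rewrite cosB cosD; field. Qed.

Lemma comb_arith (R : realType) (a b c r K : R) : a <= K -> b <= K ->
  4 * K < a + b + 2 * c * r -> 0 <= a + b + 2 * - c * r -> false.
Proof. by move=> aK bK Kr s0; lra. Qed.

Section marginals.
Context {R : realType} d1 d2 (T1 : measurableType d1) (T2 : measurableType d2).
Variables (P1 : probability T1 R) (P2 : probability T2 R).

Lemma integral_fst (f : T1 -> R) : bmeas f ->
  \int[(P1 \x P2)%E]_z f z.1 = \int[P1]_x f x.
Proof.
move=> bf; rewrite (integral_prod12 P1 P2 (f := fun z => f z.1)); last first.
  exact: (bmeas_comp bf measurable_fst).
by apply: eq_Rintegral => x _; rewrite /= bint_cst.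
Qed.

Lemma integral_snd (f : T2 -> R) : bmeas f ->
  \int[(P1 \x P2)%E]_z f z.2 = \int[P2]_x f x.
Proof.
move=> bf; rewrite (integral_prod21 P1 P2 (f := fun z => f z.2)); last first.
  exact: (bmeas_comp bf measurable_snd).
by apply: eq_Rintegral => x _; rewrite /= bint_cst.
Qed.

Lemma integral_prodM (f : T1 -> R) (g : T2 -> R) : bmeas f -> bmeas g ->
  \int[(P1 \x P2)%E]_z (f z.1 * g z.2) = \int[P1]_x f x * \int[P2]_y g y.
Proof.
move=> bf bg; rewrite (integral_prod12 P1 P2 (f := fun z => f z.1 * g z.2)); last first.
  by apply: bmeasM; [exact: (bmeas_comp bf measurable_fst)|exact: (bmeas_comp bg measurable_snd)].
under eq_Rintegral do rewrite /= bintZl//.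
by rewrite bintZr.
Qed.

End marginals.

Section random_projections.
Context {R : realType}.
Variables (d : nat) (q : nat -> nat) (dO : nat -> measure_display).
Variables (Om : forall k, measurableType (dO k)) (Pr : forall k, probability (Om k) R).
Variable Gamma : forall k, {RV (Pr k) >-> 'M[R]_(q k, d)}.
Hypothesis q_gt0 : forall k, (0 < q k)%N.
Hypothesis q_oo : (q k)%:R^-1 @[k --> \oo] --> (0 : R).
Hypothesis Gamma_unif : forall k, uniform_on_stiefel (distribution (Pr k) (Gamma k)).

Definition stiefel_proj k (z : Om k * 'cV[R]_(q k)) : 'cV[R]_d := (Gamma k z.1)^T *m z.2.

Lemma measurable_stiefel_proj k : measurable_fun setT (@stiefel_proj k).
Proof.
apply: measurable_mulmx2; last exact: measurable_snd.
exact: measurableT_comp measurable_fst.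
Qed.

(** Characteristic function of the projection of a fixed vector, real because that law is symmetric;
    [gauss_char] is its Gaussian counterpart. *)
Definition stiefel_char t k (x : 'cV[R]_(q k)) := \int[Pr k]_w cos (dot t (stiefel_proj (w, x))).

Definition gauss_char (t : 'cV[R]_d) k (x : 'cV[R]_(q k)) :=
  expR (- (dot t t / 2 * scaled_sqnorm x)).

Lemma bmeas_cos_proj t th k : bmeas (fun z => cos (dot t (@stiefel_proj k z) + th)).
Proof.
apply: bmeas_cos; apply: measurable_funD => //.
exact: (measurableT_comp (measurable_dotr t) (measurable_stiefel_proj (k := k))).
Qed.

Lemma stiefel_charE t k (x : 'cV[R]_(q k)) :
  stiefel_char t x = \int[Pr k]_w cos (dot t (stiefel_proj (w, x)) + 0).
Proof. by apply: eq_Rintegral => w _; rewrite addr0. Qed.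

Lemma bmeas_stiefel_char t k : bmeas (@stiefel_char t k).
Proof.
have := bmeas_integral1 (Pr k) (bmeas_cos_proj t 0 k); apply: bmeas_ext => x.
by rewrite stiefel_charE.
Qed.

Lemma bmeas_gauss_char t k : bmeas (@gauss_char t k).
Proof.
apply: bmeas_expRN => [|x]; first exact: measurable_funM.
by rewrite mulr_ge0 ?scaled_sqnorm_ge0// divr_ge0 ?dot_ge0.
Qed.

Lemma stiefel_char_le1 t k (x : 'cV[R]_(q k)) : `|stiefel_char t x| <= 1.
Proof.
rewrite stiefel_charE; apply: normr_integral_le_cst => [|w]; last exact: cos_max.
exact: (bmeas_section2 (bmeas_cos_proj t 0 k) x).
Qed.

Lemma gauss_char_le1 t k (x : 'cV[R]_(q k)) : 0 <= gauss_char t x <= 1.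
Proof.
rewrite /gauss_char expR_ge0 expR_le1 oppr_le0 /=.
by rewrite mulr_ge0 ?scaled_sqnorm_ge0// divr_ge0 ?dot_ge0.
Qed.

(** Stated for any random vector [Y], since X, X + Xt and X - Xt all occur. Where the scaled squared
    norm is at most K the difference is at most 3 (|t|^2 K)^2 / q, elsewhere at most 2, and
    tightness makes the latter event rare. *)
Lemma stiefel_char_cvg t (dT : nat -> measure_display) (T : forall k, measurableType (dT k))
    (m : forall k, probability (T k) R) (Y : forall k, T k -> 'cV[R]_(q k)) :
  (forall k, measurable_fun setT (@Y k)) -> tight m (fun k z => scaled_sqnorm (Y k z)) ->
  \int[m k]_z stiefel_char t (Y k z) - \int[m k]_z gauss_char t (Y k z)
    @[k --> \oo] --> (0 : R).
Proof.
move=> mY mt; apply: cvg0_approx_near => e e0.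
have [K HK] := mt (e / 2) (divr_gt0 e0 (ltr0n _ 2)).
exists (fun k => 3 * (dot t t * K) ^+ 2 * (q k)%:R^-1); first exact: cvg0_scale.
move: HK; apply: filterS => k HK.
have bA : bmeas (fun z => stiefel_char t (Y k z)) by apply: bmeas_comp (bmeas_stiefel_char t k) (mY k).
have bG : bmeas (fun z => gauss_char t (Y k z)) by apply: bmeas_comp (bmeas_gauss_char t k) (mY k).
have mS : measurable [set z | K < scaled_sqnorm (Y k z)].
  by apply: measurable_gt_set; exact: measurableT_comp.
set S := [set z | _] in HK mS.
apply: le_trans (normr_integralB_le _ bA bG) _.
apply: (@le_trans _ _ (\int[m k]_z (2 * \1_S z + 3 * (dot t t * K) ^+ 2 * (q k)%:R^-1))).
  apply: le_bint => [|| z].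
  - by apply: bmeas_norm; exact: bmeasB.
  - apply: bmeasD; last exact: bmeas_cst.
    by apply: bmeasM; [exact: bmeas_cst|exact: bmeas_indic].
  rewrite indicE; have [|zS] := boolP (z \in S).
    move=> _; rewrite mulr1; apply: (@le_trans _ _ 2).
      apply: le_trans (ler_normB _ _) _; have := stiefel_char_le1 t (Y k z).
      have /andP[g0 g1] := gauss_char_le1 t (Y k z); rewrite (ger0_norm g0); lra.
    by rewrite lerDl mulr_ge0 ?invr_ge0// mulr_ge0// sqr_ge0.
  rewrite mulr0 add0r; apply: le_trans (stiefel_cos (q_gt0 k) (Gamma_unif k) _ _) _.
  have sK : scaled_sqnorm (Y k z) <= K by move: zS; rewrite notin_setE /S /= => /negP; rewrite -leNgt.
  have s0 := scaled_sqnorm_ge0 (Y k z).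
  apply: ler_wpM2r; first by rewrite invr_ge0.
  rewrite ler_pM2l//; apply: lerXn2r; last by apply: ler_wpM2l => //; exact: dot_ge0.
    by rewrite nnegrE mulr_ge0// dot_ge0.
  by rewrite nnegrE mulr_ge0 ?dot_ge0// (le_trans s0).
rewrite bintD; last 2 first.
- by apply: bmeasM; [exact: bmeas_cst|exact: bmeas_indic].
- exact: bmeas_cst.
rewrite bint_cst bintZl; last exact: bmeas_indic.
by rewrite integral_indic1// addrC lerD2l; move: HK; lra.
Qed.

Variable P : forall k, probability 'cV[R]_(q k) R.

Let PP k : probability ('cV[R]_(q k) * 'cV[R]_(q k))%type R := (P k \x P k)%E.

(** The values c = 1 and c = -1 give the sum and the difference of two independent copies, treated
    together. *)
Definition comb k (c : R) (z : 'cV[R]_(q k) * 'cV[R]_(q k)) := z.1 + c *: z.2.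

Lemma measurable_comb k c : measurable_fun setT (@comb k c).
Proof.
apply: measurable_fun_mx => i j.
rewrite (_ : (fun _ => _) = (fun z : 'cV[R]_(q k) * 'cV[R]_(q k) => z.1 i j + c * z.2 i j)).
  apply: measurable_funD; first exact: (measurableT_comp (@measurable_coord R _ _ i j) measurable_fst).
  apply: measurable_funM => //.
  exact: (measurableT_comp (@measurable_coord R _ _ i j) measurable_snd).
by apply/funext => z; rewrite !mxE.
Qed.

Lemma scaled_sqnorm_comb k c (z : 'cV[R]_(q k) * 'cV[R]_(q k)) : c ^+ 2 = 1 ->
  scaled_sqnorm (comb c z) = scaled_sqnorm z.1 + scaled_sqnorm z.2
    + 2 * c * (dot z.1 z.2 / (q k)%:R).
Proof.
move=> c1; rewrite !scaled_sqnormE /comb dotDl !dotDr !dotZl !dotZr (dotC z.2 z.1).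
by rewrite !mulrA -expr2 c1; ring.
Qed.

(** Parallelogram law: s(x + c y) + s(x - c y) = 2 s(x) + 2 s(y), so s(x + c y) > 4 K forces s(x) or
    s(y) above K. *)
Lemma tight_comb c : c ^+ 2 = 1 -> tight P (fun k => @scaled_sqnorm R (q k)) ->
  tight PP (fun k z => scaled_sqnorm (comb c z)).
Proof.
move=> c1 Pt e e0; have [K HK] := Pt (e / 2) (divr_gt0 e0 (ltr0n _ 2)).
exists (4 * K); move: HK; apply: filterS => k HK.
have mS : measurable [set x : 'cV[R]_(q k) | K < scaled_sqnorm x].
  exact: measurable_gt_set.
set S := [set x | _] in HK mS.
have mC : measurable [set z | 4 * K < scaled_sqnorm (@comb k c z)].
  by apply: measurable_gt_set; apply: measurableT_comp => //; exact: measurable_comb.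
have bS : bmeas (\1_S : _ -> R) := bmeas_indic mS.
have bS1 : bmeas (fun z : 'cV[R]_(q k) * 'cV[R]_(q k) => \1_S z.1 : R).
  exact: (bmeas_comp bS measurable_fst).
have bS2 : bmeas (fun z : 'cV[R]_(q k) * 'cV[R]_(q k) => \1_S z.2 : R).
  exact: (bmeas_comp bS measurable_snd).
rewrite -(integral_indic1 (PP k) mC).
apply: (@le_trans _ _ (\int[PP k]_z (\1_S z.1 + \1_S z.2))).
  apply: le_bint => [|| z]; [exact: bmeas_indic|exact: bmeasD|].
  rewrite !indicE; have [|_] := boolP (z \in _); last by rewrite addr_ge0.
  rewrite inE /= => Kz; have [//|zS1] := boolP (z.1 \in S); first by rewrite lerDl.
  have [//|zS2] := boolP (z.2 \in S); first by rewrite add0r.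
  have sK1 : scaled_sqnorm z.1 <= K by move: zS1; rewrite notin_setE /S /= => /negP; rewrite -leNgt.
  have sK2 : scaled_sqnorm z.2 <= K by move: zS2; rewrite notin_setE /S /= => /negP; rewrite -leNgt.
  have := scaled_sqnorm_ge0 (comb (- c) z).
  move: Kz; rewrite !scaled_sqnorm_comb ?sqrrN// => Kz s0.
  by have := comb_arith sK1 sK2 Kz s0.
rewrite bintD// (integral_fst (P k) (P k) bS) (integral_snd (P k) (P k) bS).
by rewrite !integral_indic1// [e]splitr lerD.
Qed.

Lemma bmeas_proj_mean t th k : bmeas (fun w => \int[P k]_x cos (dot t (stiefel_proj (w, x)) + th)).
Proof. exact: (bmeas_integral2 (P k) (bmeas_cos_proj t th k)). Qed.

Lemma cos_proj_mean t th k :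
  \int[Pr k]_w \int[P k]_x cos (dot t (stiefel_proj (w, x)) + th) =
  cos th * \int[P k]_x stiefel_char t x.
Proof.
rewrite (integral_swap (Pr k) (P k) (bmeas_cos_proj t th k)).
under eq_Rintegral do rewrite (stiefel_cos_shift (Gamma_unif k)).
by rewrite bintZl//; exact: bmeas_stiefel_char.
Qed.

Lemma bmeas_stiefel_char_comb t c k : bmeas (fun z => stiefel_char t (@comb k c z)).
Proof. exact: bmeas_comp (bmeas_stiefel_char t k) (measurable_comb (k := k) c). Qed.

(* The square is an integral over two independent copies x, y, and the product
   of cosines turns it into averages over [x - y] and [x + y]. *)
Lemma cos_proj_sqr t th k :
  \int[Pr k]_w (\int[P k]_x cos (dot t (stiefel_proj (w, x)) + th)) ^+ 2 =
  1 / 2 * (\int[PP k]_z stiefel_char t (comb (-1) z) +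
           cos (2 * th) * \int[PP k]_z stiefel_char t (comb 1 z)).
Proof.
pose h c s (p : Om k * ('cV[R]_(q k) * 'cV[R]_(q k))) : R :=
  cos (dot t (stiefel_proj (p.1, comb c p.2)) + s).
have bh c s : bmeas (h c s).
  apply: (bmeas_comp (k := fun p => (p.1, comb c p.2)) (bmeas_cos_proj t s k)).
  apply: measurable_fun_pair; first exact: measurable_fst.
  exact: (measurableT_comp (measurable_comb (k := k) c) measurable_snd).
have E w : (\int[P k]_x cos (dot t (stiefel_proj (w, x)) + th)) ^+ 2 =
    \int[PP k]_z (1 / 2 * (h (-1) 0 (w, z) + h 1 (2 * th) (w, z))).
  have bw := bmeas_section1 (bmeas_cos_proj t th k) w.
  rewrite expr2 -(integral_prodM (P k) (P k) bw bw); apply: eq_Rintegral => z _.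
  rewrite cosM /h /comb /stiefel_proj /= scale1r scaleN1r mulmxBr mulmxDr dotBr dotDr addr0.
  by congr (_ * (cos _ + cos _)); ring.
under eq_Rintegral do rewrite E.
have bs : bmeas (fun p : Om k * _ => 1 / 2 * (h (-1) 0 p + h 1 (2 * th) p)).
  by apply: bmeasM; [exact: bmeas_cst|exact: bmeasD].
rewrite (integral_swap (Pr k) (PP k) bs).
have F z : \int[Pr k]_w (1 / 2 * (h (-1) 0 (w, z) + h 1 (2 * th) (w, z))) =
    1 / 2 * (stiefel_char t (comb (-1) z) + cos (2 * th) * stiefel_char t (comb 1 z)).
  have b2 c s := bmeas_section2 (bh c s) z.
  rewrite bintZl; last exact: bmeasD.
  rewrite bintD//; congr (_ * (_ + _)); first by rewrite stiefel_charE.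
  by rewrite /h /stiefel_char /stiefel_proj /= (stiefel_cos_shift (Gamma_unif k)).
under eq_Rintegral do rewrite F.
have b1 := bmeas_stiefel_char_comb t 1 k; have bN1 := bmeas_stiefel_char_comb t (-1) k.
have bc : bmeas (fun z => cos (2 * th) * stiefel_char t (@comb k 1 z)).
  by apply: bmeasM => //; exact: bmeas_cst.
by rewrite bintZl ?bintD ?bintZl//; exact: bmeasD.
Qed.

End random_projections.

(** * Normal mixtures *)

Section normal_mixtures.
Context {R : realType} {d : nat}.
Variable rho : probability R R.

Definition mix_map (x : R * 'cV[R]_d) : 'cV[R]_d := Num.sqrt x.1 *: x.2.

Lemma measurable_mix_map : measurable_fun setT mix_map.
Proof.
apply: measurable_fun_mx => i j.
rewrite (_ : (fun _ => _) = (fun x : R * 'cV[R]_d => Num.sqrt x.1 * x.2 i j)).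
  apply: measurable_funM.
    apply: (measurableT_comp (f := Num.sqrt : R -> R)); last exact: measurable_fst.
    by apply: continuous_measurable_fun; exact: sqrt_continuous.
  exact: (measurableT_comp (@measurable_coord R _ _ i j) measurable_snd).
by apply/funext => x; rewrite !mxE.
Qed.

HB.instance Definition _ := isMeasurableFun.Build _ _ _ _ mix_map measurable_mix_map.

(** The law of sqrt V Z, with V of law [rho] and Z standard normal, independent of V: a probability
    by construction, whose integrals are reached by Fubini. [mixture_lawE] identifies it with
    [normal_mixture]. *)
Definition mixture_law : probability 'cV[R]_d R :=
  distribution (rho \x std_normal R d)%E mix_map.

(** Clipping keeps the integrand bounded on the whole line and matches the identity (sqrt v)^2 = max
    v 0, valid for negative [v] too. *)
Definition laplace (l : R) := \int[rho]_v expR (- (l * Num.max v 0)).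

Lemma bmeas_laplace (l : R) : 0 <= l -> bmeas (fun v : R => expR (- (l * Num.max v 0))).
Proof.
move=> l0; apply: bmeas_expRN => [|v]; last by rewrite mulr_ge0// le_max lexx orbT.
by apply: measurable_funM => //; apply: measurable_maxr.
Qed.

Lemma mixture_cos t th :
  \int[mixture_law]_x cos (dot t x + th) = cos th * laplace (dot t t / 2).
Proof.
have bc : bmeas (fun x : 'cV[R]_d => cos (dot t x + th)).
  by apply: bmeas_cos; apply: measurable_funD => //; exact: measurable_dotr.
rewrite /mixture_law integral_distr//.
rewrite (integral_prod12 rho (std_normal R d) (bmeas_comp bc measurable_mix_map)).
rewrite /laplace -bintZl; last by apply: bmeas_laplace; rewrite divr_ge0// dot_ge0.
apply: eq_Rintegral => v _; rewrite /mix_map /=.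
under eq_Rintegral do rewrite dotZr -dotZl.
rewrite std_normal_cos dotZl dotZr mulrA -expr2; congr (_ * expR (- _)).
have -> : Num.sqrt v ^+ 2 = Num.max v 0.
  have [v0|v0] := leP 0 v; last by rewrite ltr0_sqrtr// expr0n.
  by rewrite sqr_sqrtr.
by ring.
Qed.

Lemma mixture_lawE A : rho `[0, +oo[%classic = 1%E -> measurable A ->
  mixture_law A = normal_mixture rho A.
Proof.
move=> rho1 mA; rewrite /mixture_law /distribution /pushforward /=.
have mE : measurable (mix_map @^-1` A) by exact: (measurable_funPTI mix_map mA).
have m0 : measurable (`[0, +oo[%classic : set R) by [].
rewrite /product_measure1 /normal_mixture.
rewrite (@ge0_negligible_integral _ _ R rho setT (~` `[0, +oo[)) //.
- rewrite setTD setCK; apply: eq_integral => v _.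
  by rewrite /normal_cV /distribution /pushforward /= /xsection; congr (std_normal R d _);
    apply/seteqP; split => z /=; rewrite ?inE.
- exact: measurableC.
- exact: measurable_fun_xsection.
- by rewrite [LHS](probability_setC _ m0) rho1 subee.
Qed.

End normal_mixtures.

Section L1_moments.
Context {R : realType} (dO dS : nat -> measure_display).
Variables (Om : forall k, measurableType (dO k)) (S : forall k, measurableType (dS k)).
Variables (Pr : forall k, probability (Om k) R) (P : forall k, probability (S k) R).
Context dV (V : measurableType dV).
Variable Phi : forall k, Om k * S k -> V.
Hypothesis mPhi : forall k, measurable_fun setT (@Phi k).
Variable Q : probability V R.

Lemma L1_cvg_mean g : bmeas g -> L1_cvg Pr P Phi Q g ->
  \int[Pr k]_w \int[P k]_s g (Phi (w, s)) @[k --> \oo] --> \int[Q]_x g x.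
Proof.
move=> bg Lg; apply/subr_cvg0; apply: cvg0_le Lg => k.
have bi := bmeas_integral2 (P k) (bmeas_image mPhi k bg).
rewrite -[X in _ - X](bint_cst (Pr k)).
by apply: normr_integralB_le => //; exact: bmeas_cst.
Qed.

(** |z^2 - l^2| <= 2 M |z - l| when both numbers are bounded by M. *)
Lemma L1_cvg_sqr g : bmeas g -> L1_cvg Pr P Phi Q g ->
  \int[Pr k]_w (\int[P k]_s g (Phi (w, s))) ^+ 2 @[k --> \oo] --> (\int[Q]_x g x) ^+ 2.
Proof.
move=> bg Lg; have [M gM] := bg.2; apply/subr_cvg0.
apply: cvg0_le (cvg0_scale (2 * M) Lg) => k.
have bi := bmeas_integral2 (P k) (bmeas_image mPhi k bg).
have bE := bmeas_norm (bmeas_image_error P mPhi Q k bg).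
rewrite -[X in _ - X](bint_cst (Pr k)) -bintZl//.
have bi2 := bmeasX 2 bi.
apply: le_trans (normr_integralB_le (Pr k) bi2 (bmeas_cst _ ((\int[Q]_x g x) ^+ 2))) _.
apply: le_bint => [|| w].
- by apply: bmeas_norm; apply: bmeasB; [exact: bmeasX|exact: bmeas_cst].
- by apply: bmeasM => //; exact: bmeas_cst.
rewrite subr_sqr normrM mulrC; apply: ler_wpM2r => //.
apply: le_trans (ler_normD _ _) _; rewrite mulrDl mul1r; apply: lerD.
  by apply: normr_integral_le_cst => //; exact: (bmeas_section1 (bmeas_image mPhi k bg) w).
exact: normr_integral_le_cst.
Qed.

End L1_moments.

(** This passes from a second moment to an L1 norm at the cost of an additive [e]. *)
Lemma quot_bound (R : realType) (a e : R) : 0 < e -> `|a| <= e + a ^+ 2 / e.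
Proof.
move=> e0; rewrite -real_normK ?num_real//; have := normr_ge0 a; set b := `|a| => b0.
rewrite -(ler_pM2r e0) mulrDl divfK ?gt_eqF//; nra.
Qed.

Lemma sqr_expand (R : realType) (z l : R) : (z - l) ^+ 2 = z ^+ 2 - 2 * l * z + l ^+ 2.
Proof. by ring. Qed.

Lemma cos2x (R : realType) (th : R) : cos (2 * th) = 2 * cos th ^+ 2 - 1.
Proof. by rewrite mulr_natl cos_mulr2n mulr_natl. Qed.

Lemma variance_arith (R : realType) (c psi : R) :
  0 = 1 / 2 * (psi ^+ 2 + (2 * c ^+ 2 - 1) * psi ^+ 2)
    - 2 * (c * psi) * (c * psi) + (c * psi) ^+ 2.
Proof. by field. Qed.

Lemma dist_arith (R : realType) (l a b r c e : R) : 0 <= l -> 0 < e -> c ^+ 2 = 1 -> `|r| <= e / (2 * l + 1) ->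
  `|l * (a + b + 2 * c * r) - (l * a + l * b)| <= e.
Proof.
move=> l0 e0 c1 re.
have -> : l * (a + b + 2 * c * r) - (l * a + l * b) = 2 * l * (c * r) by ring.
have cr : `|c * r| = `|r|.
  rewrite normrM; have -> : `|c| = 1; last by rewrite mul1r.
  by apply/eqP; rewrite -(@eqrXn2 _ 2)// real_normK ?num_real// c1 expr1n.
rewrite normrM cr ger0_norm ?mulr_ge0//.
move: re; rewrite ler_pdivlMr; last by lra.
have := normr_ge0 r; nra.
Qed.

(** * From (A2) to (A1) *)

Section weak_to_L1.
Context {R : realType}.
Variables (d : nat) (q : nat -> nat) (dO : nat -> measure_display).
Variables (Om : forall k, measurableType (dO k)) (Pr : forall k, probability (Om k) R).
Variable Gamma : forall k, {RV (Pr k) >-> 'M[R]_(q k, d)}.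
Hypothesis q_gt0 : forall k, (0 < q k)%N.
Hypothesis q_oo : (q k)%:R^-1 @[k --> \oo] --> (0 : R).
Hypothesis Gamma_unif : forall k, uniform_on_stiefel (distribution (Pr k) (Gamma k)).
Variable P : forall k, probability 'cV[R]_(q k) R.
Variable rho : probability R R.
Hypothesis norm_cvg : forall f : R -> R, continuous f -> bounded_fun f ->
  \int[P k]_x f (scaled_sqnorm x) @[k --> \oo] --> \int[rho]_v f v.
Hypothesis dot_cvg : forall e : R, 0 < e ->
  fine ((P k \x P k)%E [set z | e < `|dot z.1 z.2 / (q k)%:R|]) @[k --> \oo] --> (0 : R).

(** Weak convergence tests continuous functions only, so the indicator of s > n + 1 is replaced by
    the larger ramp [F n], which rises from 0 at n to 1 at n + 1 and whose [rho]-mean tends to 0. *)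
Lemma tight_of_cvg : tight P (fun k => @scaled_sqnorm R (q k)).
Proof.
move=> e e0.
pose F (n : nat) (v : R) : R := Num.min 1 (Num.max 0 (v - n%:R)).
have F01 n v : 0 <= F n v <= 1 by rewrite le_min ler01 le_max lexx/= ge_min lexx.
have cF n : continuous (F n).
  have c1 : continuous (fun x : R => x - n%:R).
    move=> x; apply: (@continuousB _ R^o _ id (cst n%:R)); last exact: cst_continuous.
    by move=> y; exact: cvg_id.
  move=> x; apply: (@continuous_min _ _ (cst 1) (cst 0 \max (fun x : R => x - n%:R))).
    exact: cst_continuous.
  by apply: continuous_max; [exact: cst_continuous|exact: c1].
have bdF n : bounded_fun (F n).
  by apply: (bounded_fun_of (M := 1)) => x; have /andP[? ?] := F01 n x; rewrite ger0_norm.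
have cvgF : \int[rho]_v F n v @[n --> \oo] --> (0 : R).
  rewrite -(bint_cst rho 0); apply: (@bounded_cvg_integral _ _ _ _ _ _ 1).
  - by move=> n; have [] := bmeas_continuous (cF n) (bdF n).
  - exact: measurable_cst.
  - by move=> n x; have /andP[? ?] := F01 n x; rewrite ger0_norm.
  - move=> x; apply: cvg_near_cst; near=> n.
    have nx : x <= n%:R by near: n; exact: nbhs_infty_ger.
    by rewrite /F (max_idPl _) ?subr_le0// (min_idPr _).
have /cvgr0Pnorm_le/(_ _ (divr_gt0 e0 (ltr0n _ 2)))[n _ /(_ n (leqnn n)) /= nF] := cvgF.
exists (n%:R + 1).
have e20 : 0 < e / 2 by rewrite divr_gt0.
have /cvgrPdist_le/(_ _ e20) := norm_cvg (cF n) (bdF n).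
apply: filterS => k Hk.
have bF : bmeas (fun x : 'cV[R]_(q k) => F n (scaled_sqnorm x)).
  by apply: (bmeas_comp (bmeas_continuous (cF n) (bdF n))).
have mS : measurable [set x : 'cV[R]_(q k) | n%:R + 1 < scaled_sqnorm x].
  exact: measurable_gt_set.
apply: (@le_trans _ _ (\int[P k]_x F n (scaled_sqnorm x))); last first.
  move: Hk nF; set a := \int[rho]_v _; set b := \int[P k]_x _.
  rewrite ler_distlC => /andP[_ ba] /(le_trans (ler_norm _)) ae.
  by rewrite (le_trans ba)// [leRHS]splitr lerD2r.
rewrite -integral_indic1//; apply: le_bint => [||x] //; first exact: bmeas_indic.
rewrite indicE; have [|_] := boolP (x \in _); last by have /andP[] := F01 n (scaled_sqnorm x).
rewrite inE /= => nx; rewrite /F le_min lexx /= le_max; apply/orP; right.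
by rewrite lerBrDl ltW.
Unshelve. all: by end_near. Qed.

Lemma gauss_char_cvg (t : 'cV[R]_d) :
  \int[P k]_x gauss_char t x @[k --> \oo] --> laplace rho (dot t t / 2).
Proof.
have l0 : 0 <= dot t t / 2 by rewrite divr_ge0// dot_ge0.
pose f (v : R) : R := expR (- (dot t t / 2) * Num.max v 0).
have cf : continuous f.
  have c1 : continuous (fun v : R => - (dot t t / 2) * Num.max v 0).
    have cm : continuous (fun v : R => Num.max v 0).
      move=> x; apply: (@continuous_max _ _ (id : R -> R) (cst 0)); last exact: cst_continuous.
      exact: cvg_id.
    move=> x; apply: cvgM; [exact: cvg_cst|exact: cm].
  by move=> x; apply: continuous_comp; [exact: c1|exact: continuous_expR].
have bf : bounded_fun f.
  apply: (bounded_fun_of (M := 1)) => x.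
  by rewrite ger0_norm ?expR_ge0// expR_le1 mulNr oppr_le0 mulr_ge0// le_max lexx orbT.
have -> : laplace rho (dot t t / 2) = \int[rho]_v f v.
  by apply: eq_Rintegral => v _; rewrite /f mulNr.
apply: cvg_ext (norm_cvg cf bf) => k; apply: eq_Rintegral => x _.
by rewrite /f /gauss_char (max_idPl _) ?mulNr// scaled_sqnorm_ge0.
Qed.

(** Tightness reduces the integral to that of [gauss_char]. Off the rare event where the scaled
    inner product exceeds [del], s(x + c y) is close to s(x) + s(y) and the Gaussian factor nearly
    splits. The sign of [c] leaves no trace in the limit. *)
Lemma stiefel_char_comb_cvg (t : 'cV[R]_d) c : c ^+ 2 = 1 ->
  \int[(P k \x P k)%E]_z stiefel_char Gamma t (comb c z) @[k --> \oo] -->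
    laplace rho (dot t t / 2) ^+ 2.
Proof.
move=> c1; have Pt := tight_of_cvg.
have l0 : 0 <= dot t t / 2 by rewrite divr_ge0// dot_ge0.
have C1 := stiefel_char_cvg q_gt0 q_oo Gamma_unif t (fun k => measurable_comb (k := k) c)
  (tight_comb c1 Pt).
have C2 : \int[(P k \x P k)%E]_z gauss_char t (comb c z) -
    \int[P k]_x gauss_char t x * \int[P k]_x gauss_char t x @[k --> \oo] --> (0 : R).
  apply: cvg0_approx => e e0.
  (* Chosen for [dist_arith]: with l = |t|^2 / 2 and |r| <= del, the exponent changes by at most 2 l
     |r| <= e; the 1 allows for l = 0. *)
  pose del := e / (2 * (dot t t / 2) + 1).
  have del0 : 0 < del by rewrite divr_gt0// ltr_wpDl// mulr_ge0.
  exists (fun k => fine ((P k \x P k)%E [set z | del < `|dot z.1 z.2 / (q k)%:R|])).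
    exact: (dot_cvg del0).
  move=> k; have bg := bmeas_gauss_char q t k.
  rewrite -(integral_prodM (P k) (P k) bg bg).
  have bc : bmeas (fun z => gauss_char t (@comb _ q k c z)).
    exact: bmeas_comp bg (measurable_comb (k := k) c).
  have b12 : bmeas (fun z : 'cV[R]_(q k) * 'cV[R]_(q k) => gauss_char t z.1 * gauss_char t z.2).
    by apply: bmeasM; [exact: (bmeas_comp bg measurable_fst)|exact: (bmeas_comp bg measurable_snd)].
  have mA : measurable [set z : 'cV[R]_(q k) * 'cV[R]_(q k) | del < `|dot z.1 z.2 / (q k)%:R|].
    apply: measurable_gt_set; apply: measurableT_comp => //; apply: measurable_funM => //.
    by apply: measurable_dot2.
  apply: le_trans (normr_integralB_le _ bc b12) _.
  rewrite -(integral_indic1 _ mA) -[e in leRHS](bint_cst (P k \x P k)%E).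
  rewrite -bintD; [|exact: bmeas_indic|exact: bmeas_cst].
  apply: le_bint => [|| z].
  - by apply: bmeas_norm; exact: bmeasB.
  - by apply: bmeasD; [exact: bmeas_indic|exact: bmeas_cst].
  rewrite indicE; have [_|] := boolP (z \in _).
    have /andP[a0 a1] := gauss_char_le1 t (comb c z).
    have /andP[b0 b1] := gauss_char_le1 t z.1; have /andP[c0 c1'] := gauss_char_le1 t z.2.
    apply: (@le_trans _ _ 1); last by rewrite lerDl ltW.
    rewrite ler_distl; apply/andP; split.
      by rewrite lerBlDr (le_trans (mulr_ile1 _ _ _ _))// lerDr.
    by rewrite (le_trans a1)// lerDr mulr_ge0.
  rewrite notin_setE /= => /negP; rewrite -leNgt => zdel; rewrite add0r.
  rewrite /gauss_char -expRD -opprD; apply: le_trans (expRN_dist _ _) _.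
  - by apply: mulr_ge0 => //; exact: scaled_sqnorm_ge0.
  - by apply: addr_ge0; apply: mulr_ge0 => //; exact: scaled_sqnorm_ge0.
  by rewrite scaled_sqnorm_comb//; exact: dist_arith.
have C3 : \int[P k]_x gauss_char t x * \int[P k]_x gauss_char t x @[k --> \oo] -->
    laplace rho (dot t t / 2) ^+ 2.
  by rewrite expr2; apply: cvgM; exact: gauss_char_cvg.
rewrite -[X in _ --> X]add0r.
apply: cvg_ext (cvgD (cvg0_addn C1 C2) C3) => k /=.
by rewrite subrKA subrK.
Qed.

(** The mean tends to cos th psi and the second moment to (1 + cos (2 th)) / 2 psi^2, which is (cos
    th psi)^2 by the duplication formula; hence the mean squared error vanishes in the limit, and
    [quot_bound] yields L1. *)
Lemma L1_cvg_cos t th :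
  L1_cvg Pr P (stiefel_proj Gamma) (mixture_law rho) (fun x => cos (dot t x + th)).
Proof.
set psi := laplace rho (dot t t / 2).
apply: cvg0_approx => e e0.
exists (fun k => \int[Pr k]_w (image_error P (stiefel_proj Gamma) (mixture_law rho)
    (fun x => cos (dot t x + th)) w) ^+ 2 / e); last first.
  move=> k; rewrite ger0_norm; last by apply: Rintegral_ge0.
  have bE : bmeas (@image_error _ _ _ _ _ P _ _ (stiefel_proj Gamma) (mixture_law rho)
    (fun x => cos (dot t x + th)) k).
    apply: bmeasB; last exact: bmeas_cst.
    exact: bmeas_proj_mean.
  rewrite -[X in _ + X](bint_cst (Pr k)) -bintZr; last exact: bmeasX.
  have bq : bmeas (fun w => (@image_error _ _ _ _ _ P _ _ (stiefel_proj Gamma) (mixture_law rho)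
    (fun x => cos (dot t x + th)) k w) ^+ 2 / e).
    by apply: bmeasM; [exact: bmeasX|exact: bmeas_cst].
  rewrite -bintD//; last exact: bmeas_cst.
  apply: le_bint => [|| w]; [exact: bmeas_norm|by apply: bmeasD => //; exact: bmeas_cst|].
  by rewrite addrC; exact: quot_bound.
rewrite -[X in _ --> X](mul0r e^-1); apply: cvgM; last exact: cvg_cst.
have E k : \int[Pr k]_w (image_error P (stiefel_proj Gamma) (mixture_law rho)
    (fun x => cos (dot t x + th)) w) ^+ 2 =
  1 / 2 * (\int[(P k \x P k)%E]_z stiefel_char Gamma t (comb (-1) z) +
     cos (2 * th) * \int[(P k \x P k)%E]_z stiefel_char Gamma t (comb 1 z))
  - 2 * (cos th * psi) * (cos th * \int[P k]_x stiefel_char Gamma t x) + (cos th * psi) ^+ 2.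
  rewrite -cos_proj_sqr// -cos_proj_mean// /image_error mixture_cos -/psi.
  under eq_Rintegral do rewrite sqr_expand.
  have bZ := bmeas_proj_mean Gamma P t th k.
  have bZ2 : bmeas (fun w => 2 * (cos th * psi) * \int[P k]_x cos (dot t (stiefel_proj Gamma (w, x)) + th)).
    by apply: bmeasM => //; exact: bmeas_cst.
  rewrite bintD; [|by apply: bmeasB => //; exact: bmeasX|exact: bmeas_cst].
  by rewrite bintB ?bint_cst ?bintZl//; exact: bmeasX.
apply: (cvg_ext (fun k => esym (E k))).
have C1 := @stiefel_char_comb_cvg t 1 (expr1n _ 2).
have N1 : (-1 : R) ^+ 2 = 1 by rewrite sqrrN expr1n.
have CN1 := @stiefel_char_comb_cvg t (-1) N1.
have C0 : \int[P k]_x stiefel_char Gamma t x @[k --> \oo] --> psi.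
  have C := stiefel_char_cvg q_gt0 q_oo Gamma_unif t
    (fun k => @measurable_id _ _ setT) tight_of_cvg.
  rewrite -[X in _ --> X]add0r.
  by apply: cvg_ext (cvgD C (@gauss_char_cvg t)) => k /=; rewrite subrK.
have -> : 0 = 1 / 2 * (psi ^+ 2 + cos (2 * th) * psi ^+ 2)
    - 2 * (cos th * psi) * (cos th * psi) + (cos th * psi) ^+ 2 :> R.
  by rewrite cos2x; exact: variance_arith.
apply: cvgD; last exact: cvg_cst.
apply: cvgB.
  apply: cvgM; first exact: cvg_cst.
  by apply: cvgD; [exact: CN1|apply: cvgM; [exact: cvg_cst|exact: C1]].
apply: cvgM; first exact: cvg_cst.
by apply: cvgM; [exact: cvg_cst|exact: C0].
Qed.

Lemma L1_cvg_mixture f : continuous f -> bounded_fun f ->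
  L1_cvg Pr P (stiefel_proj Gamma) (mixture_law rho) f.
Proof.
exact: (L1_cvg_bounded_continuous (fun k => measurable_stiefel_proj Gamma (k := k)) L1_cvg_cos).
Qed.

End weak_to_L1.

(* [exp u + exp (- u) - 2] is the square of [exp (u / 2) - exp (- u / 2)]. *)
Lemma expR_addN_ge (R : realType) (u : R) : u ^+ 2 / 4 <= expR u + expR (- u) - 2.
Proof.
wlog u0 : u / 0 <= u => [H|].
  have [u0|u0] := leP 0 u; first exact: H.
  by have := H (- u); rewrite opprK sqrrN (addrC (expR (- u))); apply; rewrite oppr_ge0 ltW.
have v0 : 0 <= u / 2 by rewrite divr_ge0.
have e1 : expR (u / 2) * expR (- (u / 2)) = 1 by rewrite expRN mulfV// gt_eqF ?expR_gt0.
have -> : u = u / 2 + u / 2 by lra.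
rewrite opprD !expRD.
have h1 := expR_ge1Dx (u / 2).
have h2 : expR (- (u / 2)) <= 1 by rewrite expR_le1 oppr_le0.
by move: e1 h1 h2; set a := expR _; set b := expR _; nra.
Qed.

(** Factoring out exp (- (a + b)) leaves exp (2 r) + exp (- 2 r) - 2 >= r^2. Here a and b stand for
    the scaled squared norms of two vectors and r for their scaled inner product. *)
Lemma gap_arith (R : realType) (a b r : R) :
  expR (- (a + b)) * ((2 * r) ^+ 2 / 4) <=
  expR (- (a + b + 2 * 1 * r)) + expR (- (a + b + 2 * -1 * r)) - 2 * (expR (- a) * expR (- b)).
Proof.
have -> : a + b + 2 * 1 * r = (a + b) + 2 * r by ring.
have -> : a + b + 2 * -1 * r = (a + b) - 2 * r by ring.
rewrite -expRD -opprD !(opprD (a + b)) opprK !(expRD (- (a + b))).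
have := expR_addN_ge (2 * r); have := expR_gt0 (- (a + b)).
set E := expR (- (a + b)); set x := expR (2 * r); set y := expR _; nra.
Qed.

Lemma mul2_half (R : realType) (x : R) : 2 * (1 / 2 * x) = x.
Proof. by field. Qed.

Lemma gap_ring (R : realType) (a b x y z : R) :
  b + a - ((a - x) + (b - y)) - 2 * (z * z) = x + y - 2 * (z * z).
Proof. by ring. Qed.

(** A Chebyshev-type bound: where a and b are at most K and |r| > e, the lower bound of [gap_arith]
    is at least e^2 exp (- 2 K). *)
Lemma indic_arith (R : realType) (a b r e K : R) : 0 < e -> a <= K -> b <= K -> e < `|r| ->
  1 <= expR (2 * K) / e ^+ 2 * (expR (- (a + b)) * ((2 * r) ^+ 2 / 4)).
Proof.
move=> e0 aK bK er.
have -> : (2 * r) ^+ 2 / 4 = `|r| ^+ 2 by rewrite real_normK ?num_real//; field.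
have E1 : 1 <= expR (2 * K) * expR (- (a + b)).
  by rewrite -expRD -[leLHS]expR0 ler_expR; lra.
have R1 : 1 <= `|r| ^+ 2 / e ^+ 2.
  by rewrite ler_pdivlMr ?exprn_gt0// mul1r lerXn2r ?nnegrE ?ltW// (lt_trans e0).
rewrite (_ : _ * _ = expR (2 * K) * expR (- (a + b)) * (`|r| ^+ 2 / e ^+ 2)); last by field; lra.
by rewrite -[X in X <= _]mulr1 ler_pM.
Qed.

(** * From (A1) to (A2) *)

Section L1_to_weak.
Context {R : realType}.
Variables (d : nat) (q : nat -> nat) (dO : nat -> measure_display).
Hypothesis d_gt0 : (0 < d)%N.
Variables (Om : forall k, measurableType (dO k)) (Pr : forall k, probability (Om k) R).
Variable Gamma : forall k, {RV (Pr k) >-> 'M[R]_(q k, d)}.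
Hypothesis q_gt0 : forall k, (0 < q k)%N.
Hypothesis q_oo : (q k)%:R^-1 @[k --> \oo] --> (0 : R).
Hypothesis Gamma_unif : forall k, uniform_on_stiefel (distribution (Pr k) (Gamma k)).
Variable P : forall k, probability 'cV[R]_(q k) R.
Variable Q : probability 'cV[R]_d R.
Hypothesis proj_cvg : forall f : 'cV[R]_d -> R, continuous f -> bounded_fun f ->
  L1_cvg Pr P (stiefel_proj Gamma) Q f.

(** One direction suffices: the multiples of [e0] reach every value of |t|^2, the only feature of
    [t] that [gauss_char] sees. *)
Let e0 : 'cV[R]_d := delta_mx (Ordinal d_gt0) 0.

Let dot_e0 : dot e0 e0 = 1.
Proof. by rewrite dot_delta mxE !eqxx. Qed.

Let continuous_coord0 : continuous (fun y : 'cV[R]_d => dot e0 y).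
Proof.
rewrite (_ : (fun y => _) = (fun y : 'cV[R]_d => y (Ordinal d_gt0) 0 : R)).
  by move=> y; exact: coord_continuous.
by apply/funext => y; rewrite dotC dot_delta.
Qed.

Let continuous_cos_dot c th : continuous (fun y : 'cV[R]_d => cos (dot (c *: e0) y + th)).
Proof.
have cl : continuous (fun y : 'cV[R]_d => dot (c *: e0) y + th).
  move=> y; apply: (@continuousD _ R^o _ (fun y => dot (c *: e0) y) (cst th)).
    rewrite (_ : (fun y => _) = (fun y : 'cV[R]_d => c * dot e0 y)).
      apply: (@continuousM _ _ (cst c) (fun y : 'cV[R]_d => dot e0 y)); first exact: cst_continuous.
      exact: continuous_coord0.
    by apply/funext => z; rewrite dotZl.
  exact: cst_continuous.
by move=> y; apply: continuous_comp; [exact: cl|exact: continuous_cos].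
Qed.

Let bounded_cos_dot c th : bounded_fun (fun y : 'cV[R]_d => cos (dot (c *: e0) y + th)).
Proof. by apply: (bounded_fun_of (M := 1)) => y; exact: cos_max. Qed.

Let mproj k := measurable_stiefel_proj Gamma (k := k).

(** The factor 2 / (3 s), with s the scaled squared norm of [x], makes a = 2/3 in [stiefel_min], the
    maximizer of a - 3/4 a^2, with value 1/3. As K < s, passing to 2 / (3 K) only enlarges the
    integrand. *)
Let tight_bound (K : R) (k : nat) (x : 'cV[R]_(q k)) : 0 < K -> K < scaled_sqnorm x ->
  1 / 3 <= \int[Pr k]_w Num.min 1 (2 / (3 * K) * dot e0 (stiefel_proj Gamma (w, x)) ^+ 2).
Proof.
move=> K0 Ks; have s0 : 0 < scaled_sqnorm x by exact: lt_trans Ks.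
have kap0 : 0 <= 2 / (3 * scaled_sqnorm x) by rewrite divr_ge0// mulr_ge0// ltW.
have aE : 2 / 3 = 2 / (3 * scaled_sqnorm x) * (dot e0 e0 * scaled_sqnorm x).
  by rewrite dot_e0; field; rewrite gt_eqF.
have := stiefel_min (q_gt0 k) (Gamma_unif k) kap0 aE.
rewrite (_ : 2 / 3 - _ = 1 / 3); last by field.
move/le_trans; apply.
have b (c : R) : 0 <= c -> bmeas (fun w => Num.min 1 (c * dot e0 (stiefel_proj Gamma (w, x)) ^+ 2)).
  move=> c0; apply: bmeas_min => // [|w]; last by rewrite mulr_ge0// sqr_ge0.
  apply: measurable_funM => //; apply: measurable_funX.
  apply: (measurableT_comp (measurable_dotr e0)).
  have m2 : measurable_fun setT (fun w : Om k => (w, x)) by exact: pair2_measurable.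
  exact: (measurableT_comp (mproj (k := k)) m2).
apply: le_bint => [|| w].
- exact: b.
- by apply: b; rewrite divr_ge0// mulr_ge0// ltW.
rewrite le_min ge_min lexx /= ge_min; apply/orP; right.
apply: ler_wpM2r; first exact: sqr_ge0.
apply: ler_wpM2l => //; rewrite lef_pV2; [|by rewrite posrE; apply: mulr_gt0..].
by rewrite ler_pM2l// ltW.
Qed.

(** By [tight_bound] and Fubini the probability of s > n + 1 is at most three times the mean of
    [F n] at the projection. That mean tends to the [Q]-integral of [F n], which is small for large
    n. *)
Lemma tight_of_L1_cvg : tight P (fun k => @scaled_sqnorm R (q k)).
Proof.
move=> e eps0.
pose F (n : nat) (y : 'cV[R]_d) : R := Num.min 1 (2 / (3 * n.+1%:R) * dot e0 y ^+ 2).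
have kap0 n : 0 <= 2 / (3 * n.+1%:R) :> R by rewrite divr_ge0.
have F01 n y : 0 <= F n y <= 1 by rewrite le_min ler01 ge_min lexx /= mulr_ge0// sqr_ge0.
have cF n : continuous (F n).
  move=> y; apply: (@continuous_min _ _ (cst 1) (fun y : 'cV[R]_d => 2 / (3 * n.+1%:R) * dot e0 y ^+ 2)).
    exact: cst_continuous.
  apply: (@continuousM _ _ (cst (2 / (3 * n.+1%:R))) (fun y : 'cV[R]_d => dot e0 y ^+ 2)).
    exact: cst_continuous.
  by apply: (@continuous_comp _ _ _ (fun y => dot e0 y) (fun a : R => a ^+ 2));
    [exact: continuous_coord0|exact: exprn_continuous].
have bdF n : bounded_fun (F n).
  by apply: (bounded_fun_of (M := 1)) => x; have /andP[? ?] := F01 n x; rewrite ger0_norm.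
have bF n : bmeas (F n) by exact: bmeas_continuous.
have cvgF : \int[Q]_y F n y @[n --> \oo] --> (0 : R).
  rewrite -(bint_cst Q 0); apply: (@bounded_cvg_integral _ _ _ _ _ _ 1).
  - by move=> n; have [] := bF n.
  - exact: measurable_cst.
  - by move=> n x; have /andP[? ?] := F01 n x; rewrite ger0_norm.
  - move=> y; apply: (cvg0_le (v := fun n => 2 / 3 * dot e0 y ^+ 2 * n.+1%:R^-1)).
      move=> n; have /andP[? ?] := F01 n y; rewrite ger0_norm// ge_min; apply/orP; right.
      by rewrite le_eqVlt; apply/orP; left; apply/eqP; field.
    by apply: cvg0_scale; exact: cvg_harmonic.
have e6 : 0 < e / 6 by rewrite divr_gt0.
have /cvgr0Pnorm_le/(_ _ e6)[n _ /(_ n (leqnn n)) /= nF] := cvgF.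
exists n.+1%:R.
have /cvgrPdist_le/(_ _ e6) := L1_cvg_mean mproj (bF n) (proj_cvg (cF n) (bdF n)).
apply: filterS => k Hk.
have bFp := bmeas_image mproj k (bF n).
rewrite (integral_swap (Pr k) (P k) bFp) in Hk.
have mS : measurable [set x : 'cV[R]_(q k) | n.+1%:R < scaled_sqnorm x] by exact: measurable_gt_set.
have bi := bmeas_integral1 (Pr k) bFp.
apply: (@le_trans _ _ (3 * \int[P k]_x \int[Pr k]_w F n (stiefel_proj Gamma (w, x)))); last first.
  move: Hk nF; set a := \int[Q]_v _; set b := \int[P k]_x _.
  rewrite ler_distlC => /andP[_ ba] /(le_trans (ler_norm _)) ae.
  have -> : e = 3 * (e / 6 + e / 6) by field.
  by rewrite ler_pM2l// (le_trans ba)// lerD2r.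
rewrite -integral_indic1// -bintZl//; apply: le_bint => [||x]; first exact: bmeas_indic.
  by apply: bmeasM => //; exact: bmeas_cst.
rewrite indicE; have [|_] := boolP (x \in _); last first.
  by rewrite mulr_ge0//; apply: Rintegral_ge0 => w _; have /andP[] := F01 n (stiefel_proj Gamma (w, x)).
rewrite inE /= => nx; have n0 : 0 < n.+1%:R :> R by [].
by have := tight_bound n0 nx; rewrite -ler_pdivrMl// mulrC.
Qed.

Let char_cvg c : \int[P k]_x stiefel_char Gamma (c *: e0) x @[k --> \oo] -->
  \int[Q]_y cos (dot (c *: e0) y + 0).
Proof.
have bc th : bmeas (fun y : 'cV[R]_d => cos (dot (c *: e0) y + th)) by exact: bmeas_continuous.
have C := L1_cvg_mean mproj (bc 0) (proj_cvg (@continuous_cos_dot c 0) (bounded_cos_dot c 0)).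
apply: cvg_ext C => k.
by rewrite cos_proj_mean// cos0 mul1r.
Qed.

Let gauss_cvg c : \int[P k]_x gauss_char (c *: e0) x @[k --> \oo] -->
  \int[Q]_y cos (dot (c *: e0) y + 0).
Proof.
have C := stiefel_char_cvg q_gt0 q_oo Gamma_unif (c *: e0)
  (fun k => @measurable_id _ _ setT) tight_of_L1_cvg.
rewrite -[X in _ --> X]subr0.
by apply: cvg_ext (cvgB (@char_cvg c) C) => k /=; rewrite subKr.
Qed.

Lemma norm_cvg_of_L1 : exists rho : probability R R, rho `[0, +oo[%classic = 1%E /\
  forall f : R -> R, continuous f -> bounded_fun f ->
    \int[P k]_x f (scaled_sqnorm x) @[k --> \oo] --> \int[rho]_v f v.
Proof.
apply: laplace_weak_limit tight_of_L1_cvg _ => [k //|k x|n]; first exact: scaled_sqnorm_ge0.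
(* This multiple of [e0] has |t|^2 / 2 = n. *)
apply/cvg_ex; exists (\int[Q]_y cos (dot (Num.sqrt (2 * n%:R) *: e0) y + 0)).
apply: cvg_ext (@gauss_cvg (Num.sqrt (2 * n%:R))) => k; apply: eq_Rintegral => x _.
rewrite /gauss_char dotZl dotZr dot_e0 mulr1 -expr2 sqr_sqrtr ?mulr_ge0//.
by rewrite [2 * _]mulrC mulfK.
Qed.

Lemma dot_cvg_of_L1 (e : R) : 0 < e ->
  fine ((P k \x P k)%E [set z | e < `|dot z.1 z.2 / (q k)%:R|]) @[k --> \oo] --> (0 : R).
Proof.
(* With |t|^2 / 2 = 1, [gauss_char t x] is exp (- s(x)). *)
move=> eps0; pose c : R := Num.sqrt 2; pose t := c *: e0.
have tt : dot t t / 2 = 1 by rewrite dotZl dotZr dot_e0 mulr1 -expr2 sqr_sqrtr// divff.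
pose psi := \int[Q]_y cos (dot t y + 0).
pose B s k := \int[(P k \x P k)%E]_z stiefel_char Gamma t (comb s z).
have bc th : bmeas (fun y : 'cV[R]_d => cos (dot t y + th)).
  exact: (bmeas_continuous (@continuous_cos_dot c th)).
have sqr_cvg th : 1 / 2 * (B (-1) k + cos (2 * th) * B 1 k) @[k --> \oo] -->
    (\int[Q]_y cos (dot t y + th)) ^+ 2.
  apply: cvg_ext (L1_cvg_sqr mproj (bc th) (proj_cvg (@continuous_cos_dot c th) (bounded_cos_dot c th))) => k.
  exact: cos_proj_sqr.
have sin0 : \int[Q]_y cos (dot t y + pi / 2) = 0.
  have := L1_cvg_mean mproj (bc (pi / 2)) (proj_cvg (@continuous_cos_dot c (pi / 2)) (bounded_cos_dot c (pi / 2))).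
  move=> h; apply: (cvgr_unique h).
  have h0 : (fun _ : nat => 0 : R) n @[n --> \oo] --> (0 : R) by exact: cvg_cst.
  apply: cvg_ext h0 => k.
  by rewrite cos_proj_mean// cos_pihalf mul0r.
have Bsum : B (-1) k + B 1 k @[k --> \oo] --> 2 * psi ^+ 2.
  have h := sqr_cvg 0.
  have h2 : 2 * (1 / 2 * (B (-1) k + cos (2 * 0) * B 1 k)) @[k --> \oo] --> 2 * psi ^+ 2.
    by apply: cvgM; [exact: cvg_cst|exact: h].
  apply: cvg_ext h2 => k; by rewrite mulr0 cos0 [1 * B _ _]mul1r; exact: mul2_half.
have gauss_comb s : s ^+ 2 = 1 ->
    B s k - \int[(P k \x P k)%E]_z gauss_char t (comb s z) @[k --> \oo] --> (0 : R).
  move=> s1; exact: (stiefel_char_cvg q_gt0 q_oo Gamma_unif t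
    (fun k => measurable_comb (k := k) s) (tight_comb s1 tight_of_L1_cvg)).
have N1 : (-1 : R) ^+ 2 = 1 by rewrite sqrrN expr1n.
(* Its mean tends to 2 psi^2 - 2 psi^2: the sum over both signs is the limit of a second moment, the
   product the square of the limit of a first moment. *)
pose gap k (z : 'cV[R]_(q k) * 'cV[R]_(q k)) :=
  gauss_char t (comb 1 z) + gauss_char t (comb (-1) z) - 2 * (gauss_char t z.1 * gauss_char t z.2).
have bg k s : bmeas (fun z => gauss_char t (@comb _ q k s z)).
  exact: bmeas_comp (bmeas_gauss_char q t k) (measurable_comb (k := k) s).
have bgM k : bmeas (fun z : 'cV[R]_(q k) * 'cV[R]_(q k) => gauss_char t z.1 * gauss_char t z.2).
  by apply: bmeasM; [exact: (bmeas_comp (bmeas_gauss_char q t k) measurable_fst)|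
    exact: (bmeas_comp (bmeas_gauss_char q t k) measurable_snd)].
have bgap k : bmeas (@gap k).
  by apply: bmeasB; [exact: bmeasD|apply: bmeasM => //; exact: bmeas_cst].
have gap_cvg : \int[(P k \x P k)%E]_z gap k z @[k --> \oo] --> (0 : R).
  have E k : (B (-1) k + B 1 k - ((B 1 k - \int[(P k \x P k)%E]_z gauss_char t (comb 1 z)) +
      (B (-1) k - \int[(P k \x P k)%E]_z gauss_char t (comb (-1) z)))) -
      2 * (\int[P k]_x gauss_char t x * \int[P k]_x gauss_char t x) =
      \int[(P k \x P k)%E]_z gap k z.
    rewrite bintB ?bintD ?bintZl//; [|exact: bmeasD|by apply: bmeasM => //; exact: bmeas_cst].
    rewrite (integral_prodM (P k) (P k)); [|exact: bmeas_gauss_char..].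
    exact: gap_ring.
  apply: (cvg_ext E).
  have G : \int[P k]_x gauss_char t x * \int[P k]_x gauss_char t x @[k --> \oo] --> psi ^+ 2.
    by rewrite expr2; apply: cvgM; exact: gauss_cvg.
  rewrite (_ : 0 = 2 * psi ^+ 2 - 0 - 2 * psi ^+ 2); last by rewrite subr0 subrr.
  apply: cvgB; last by apply: cvgM; [exact: cvg_cst|exact: G].
  apply: cvgB; first exact: Bsum.
  by apply: cvg0_addn; apply: gauss_comb; rewrite ?expr1n.
apply: cvg0_approx_near => eta eta0.
have [K HK] := tight_of_L1_cvg (divr_gt0 eta0 (ltr0n _ 2)).
exists (fun k => expR (2 * K) / e ^+ 2 * \int[(P k \x P k)%E]_z gap k z).
  exact: cvg0_scale.
move: HK; apply: filterS => k HK.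
have mS : measurable [set x : 'cV[R]_(q k) | K < scaled_sqnorm x] by exact: measurable_gt_set.
set S := [set x | _] in HK mS.
have bS : bmeas (\1_S : _ -> R) := bmeas_indic mS.
have bS1 : bmeas (fun z : 'cV[R]_(q k) * 'cV[R]_(q k) => \1_S z.1 : R).
  exact: (bmeas_comp bS measurable_fst).
have bS2 : bmeas (fun z : 'cV[R]_(q k) * 'cV[R]_(q k) => \1_S z.2 : R).
  exact: (bmeas_comp bS measurable_snd).
have mA : measurable [set z : 'cV[R]_(q k) * 'cV[R]_(q k) | e < `|dot z.1 z.2 / (q k)%:R|].
  apply: measurable_gt_set; apply: measurableT_comp => //; apply: measurable_funM => //.
  by apply: measurable_dot2.
have bC : bmeas (fun z => expR (2 * K) / e ^+ 2 * @gap k z).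
  by apply: bmeasM => //; exact: bmeas_cst.
rewrite ger0_norm ?fine_ge0// -(integral_indic1 _ mA).
have HS : \int[(P k \x P k)%E]_z (\1_S z.1 + \1_S z.2) <= eta.
  rewrite bintD// (integral_fst (P k) (P k) bS) (integral_snd (P k) (P k) bS).
  by rewrite !integral_indic1// [leRHS]splitr lerD.
(* The event is covered by those where a norm exceeds K, whose masses add up to at most eta, and by
   the set where [indic_arith] bounds the indicator by a multiple of the gap. *)
apply: (@le_trans _ _ (\int[(P k \x P k)%E]_z (expR (2 * K) / e ^+ 2 * gap k z + (\1_S z.1 + \1_S z.2)))); last first.
  rewrite bintD//; last exact: bmeasD.
  by rewrite bintZl// lerD2l.
apply: le_bint => [||z]; first exact: bmeas_indic.
  by apply: bmeasD => //; exact: bmeasD.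
have C0 : 0 <= expR (2 * K) / e ^+ 2 by rewrite divr_ge0 ?expR_ge0// exprn_ge0// ltW.
have gapE := gap_arith (scaled_sqnorm z.1) (scaled_sqnorm z.2) (dot z.1 z.2 / (q k)%:R).
have {}gapE : expR (- (scaled_sqnorm z.1 + scaled_sqnorm z.2)) *
    ((2 * (dot z.1 z.2 / (q k)%:R)) ^+ 2 / 4) <= gap k z.
  by rewrite /gap /gauss_char tt !mul1r !scaled_sqnorm_comb// expr1n.
have gap0 : 0 <= gap k z.
  by apply: le_trans gapE; rewrite mulr_ge0 ?expR_ge0// divr_ge0// sqr_ge0.
have CG0 := mulr_ge0 C0 gap0.
rewrite !indicE; have [|_] := boolP (z \in _); last by rewrite !addr_ge0.
rewrite inE /= => ez; have [_|zS1] := boolP (z.1 \in S).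
  by rewrite addrCA lerDl addr_ge0.
have [_|zS2] := boolP (z.2 \in S).
  by rewrite add0r lerDr.
have sK1 : scaled_sqnorm z.1 <= K by move: zS1; rewrite notin_setE /S /= => /negP; rewrite -leNgt.
have sK2 : scaled_sqnorm z.2 <= K by move: zS2; rewrite notin_setE /S /= => /negP; rewrite -leNgt.
rewrite !addr0; apply: le_trans (indic_arith eps0 sK1 sK2 ez) _.
by apply: ler_wpM2l.
Qed.

End L1_to_weak.

(** * The two assertions *)

Section weak_uniqueness.
Context {R : realType} {n : nat}.
Implicit Types (U : set 'cV[R]_n) (x y : 'cV[R]_n).

Let radii U x := [set r : R | 0 <= r <= 1 /\ (0 < r -> ball x r `<=` U)].

Definition depth U x : R := sup (radii U x).

Let radii0 U x : radii U x 0.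
Proof. by split; rewrite ?lexx ?ler01// ltxx. Qed.

Let radii_sup U x : has_sup (radii U x).
Proof. by split; [exists 0; exact: radii0|exists 1 => r [/andP[]]]. Qed.

Lemma depth01 U x : 0 <= depth U x <= 1.
Proof.
apply/andP; split; first by apply: ub_le_sup; [case: (radii_sup U x)|exact: radii0].
by apply: ge_sup; [exists 0; exact: radii0|move=> r [/andP[]]].
Qed.

Lemma depth_out U x : ~ U x -> depth U x = 0.
Proof.
move=> Ux; apply/eqP; rewrite eq_le; have /andP[-> _] := depth01 U x; rewrite andbT.
apply: ge_sup => [|r [/andP[r0 _] rU]]; first by exists 0; exact: radii0.
by rewrite leNgt; apply/negP => r1; apply: Ux; apply: (rU r1); exact: ballxx.
Qed.

Lemma depth_gt0 U x : open U -> U x -> 0 < depth U x.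
Proof.
rewrite openE => oU /oU /nbhs_ballP[r /= r0 rU].
apply: (@lt_le_trans _ _ (Num.min r 1)); first by rewrite lt_min r0 ltr01.
apply: ub_le_sup; first by case: (radii_sup U x).
split; first by rewrite le_min ge_min ler01 lexx orbT (ltW r0).
by move=> _ y xy; apply: rU; apply: le_ball xy; rewrite ge_min lexx.
Qed.

(** A ball of radius r around [x] contains the ball of radius r - e around any point within e of
    [x]. *)
Let depth_lip U x y (e : R) : 0 < e -> ball x e y -> depth U x <= depth U y + e.
Proof.
move=> e0 xy; apply: ge_sup => [|r [/andP[r0 r1] rU]]; first by exists 0; exact: radii0.
rewrite -lerBlDr; have [re|er] := leP r e.
  by apply: (@le_trans _ _ 0); [rewrite subr_le0|have /andP[] := depth01 U y].
apply: ub_le_sup; first by case: (radii_sup U y).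
split; first by rewrite subr_ge0 ltW//= (le_trans _ r1)// gerBl ltW.
move=> _ z yz; apply: rU; first exact: lt_trans er.
by rewrite -[r](subrKC e); exact: ball_triangle xy yz.
Qed.

Lemma continuous_depth U : continuous (depth U).
Proof.
move=> x; have xF : Filter (nbhs x) by exact: nbhs_filter.
apply/cvgrPdist_le => e e0.
have nb : nbhs x (ball x e) by apply/nbhs_ballP; exists e.
apply: (filterS _ nb) => y xy.
have := depth_lip U e0 xy; have := depth_lip U e0 (ball_sym xy).
by rewrite ler_distl lerBlDr => -> ->.
Qed.

(** Open sets are stable under intersection and generate the Borel sets; the indicator of an open
    [U] is the limit of the continuous functions min 1 (k depth U). *)
Lemma probability_unique (P Q : probability 'cV[R]_n R) :
  (forall f : 'cV[R]_n -> R, continuous f -> bounded_fun f ->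
    \int[P]_x f x = \int[Q]_x f x) ->
  forall A, measurable A -> P A = Q A.
Proof.
move=> PQ; apply: (measure_unique open (fun=> setT)) => //.
- exact: openI.
- by move=> _; exact: openT.
- by rewrite bigcup_const//; exists 0%N.
- move=> U oU; have mU : measurable U by apply: sub_sigma_algebra.
  pose F (k : nat) (x : 'cV[R]_n) : R := Num.min 1 (k%:R * depth U x).
  have F01 k x : 0 <= F k x <= 1.
    rewrite le_min ler01 ge_min lexx mulr_ge0//.
    by have /andP[] := depth01 U x.
  have cF k : continuous (F k).
    move=> x; apply: (@continuous_min _ _ (cst 1) (fun y => k%:R * depth U y)).
      exact: cst_continuous.
    apply: (@continuousM _ _ (cst k%:R) (depth U)); first exact: cst_continuous.
    exact: continuous_depth.
  have bF k : bounded_fun (F k).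
    by apply: (bounded_fun_of (M := 1)) => x; have /andP[? ?] := F01 k x; rewrite ger0_norm.
  have cvgF (m : probability 'cV[R]_n R) : \int[m]_x F k x @[k --> \oo] --> fine (m U).
    rewrite -(integral_indic1 m mU); apply: (@bounded_cvg_integral _ _ _ _ _ _ 1).
    + by move=> k; have [] := bmeas_continuous (cF k) (bF k).
    + exact: measurable_indic.
    + by move=> k x; have /andP[? ?] := F01 k x; rewrite ger0_norm.
    + move=> x; rewrite indicE; have [|] := boolP (x \in U).
        rewrite inE => Ux; apply: cvg_near_cst; near=> k; apply/min_idPl.
        have d0 := depth_gt0 oU Ux.
        by rewrite -ler_pdivrMr// mul1r; near: k; exact: nbhs_infty_ger.
      rewrite notin_setE => Ux; apply: cvg_near_cst; apply: nearW => k.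
      by rewrite /F depth_out// mulr0; apply/min_idPr.
  rewrite -[LHS](EFin_prob P mU) -[RHS](EFin_prob Q mU); congr EFin.
  apply: cvgr_unique (cvgF P) _; apply: cvg_ext (cvgF Q) => k.
  exact/esym/PQ.
- by move=> _; rewrite -ge0_fin_numE// fin_num_measure.
Unshelve. all: by end_near. Qed.

End weak_uniqueness.

Section convergence_in_probability.
Context {R : realType} (dO : nat -> measure_display).
Variables (Om : forall k, measurableType (dO k)) (Pr : forall k, probability (Om k) R).
Variables (Y : forall k, Om k -> R) (l C : R).
Hypothesis mY : forall k, measurable_fun setT (@Y k).
Hypothesis YC : forall k w, `|@Y k w| <= C.

Let bY k : bmeas (fun w => `|@Y k w - l|).
Proof. by apply: bmeas_norm; apply: bmeasB; [split => //; exists C|exact: bmeas_cst]. Qed.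

(** One way, |Y - l| is at most e plus C + |l| times the indicator of |Y - l| > e; the other way is
    Markov's inequality. *)
Lemma cvg_in_probability_L1 :
  cvg_in_probability Pr Y l <-> \int[Pr k]_w `|Y w - l| @[k --> \oo] --> (0 : R).
Proof.
have mA k e : measurable [set w | e < `|@Y k w - l|] by apply: measurable_gt_set; have [] := bY k.
split=> [H|H e e0].
  apply: cvg0_approx => e e0.
  exists (fun k => (C + `|l|) * fine (Pr k [set w | e < `|@Y k w - l|])).
    apply: cvg0_scale; exact: (fine_cvg (H e e0)).
  move=> k; rewrite ger0_norm; last by apply: Rintegral_ge0.
  rewrite -(integral_indic1 _ (mA k e)) -(bint_cst (Pr k) e) -bintZl; last exact: bmeas_indic.
  have bi : bmeas (fun w => (C + `|l|) * \1_[set w | (e : R) < `|@Y k w - l|] w).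
    by apply: bmeasM; [exact: bmeas_cst|exact: bmeas_indic].
  rewrite bint_cst -[X in _ + X](bint_cst (Pr k)) -bintD//; last exact: bmeas_cst.
  apply: le_bint => // [|w]; first by apply: bmeasD => //; exact: bmeas_cst.
  rewrite indicE; have [_|] := boolP (w \in _); last first.
    by rewrite notin_setE /= => /negP; rewrite -leNgt mulr0 add0r.
  rewrite mulr1; apply: (@le_trans _ _ (C + `|l|)); last by rewrite lerDl ltW.
  by apply: le_trans (ler_normB _ _) _; rewrite lerD2r.
apply: (@cvg_trans _ ((fine (Pr k [set w | e < `|@Y k w - l|]))%:E @[k --> \oo])).
  by apply: near_eq_cvg; apply: nearW => k; rewrite EFin_prob.
apply: cvg_EFin; first by apply: nearW.
have H' := cvg0_scale e^-1 H.
apply: cvg0_le H' => k; rewrite /= ger0_norm ?fine_ge0//.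
by rewrite mulrC; apply: markov_bmeas.
Qed.

End convergence_in_probability.

Section index_shift.
Context {R : realType} (d : nat).

Lemma cvg_in_probability_shift (dO : nat -> measure_display)
    (Om : forall q, measurableType (dO q)) (Pr : forall q, probability (Om q) R)
    (Y : forall q, Om q -> R) l :
  cvg_in_probability Pr Y l <->
  cvg_in_probability (fun k => Pr (k + d)%N) (fun k => @Y (k + d)%N) l.
Proof.
by split=> H e e0; have := H e e0;
  rewrite -(cvg_shiftn d (fun q => Pr q [set w | e < `|Y q w - l|])).
Qed.

Lemma cvgr_shift (u : nat -> R) (l : R) :
  u k @[k --> \oo] --> l <-> u (k + d)%N @[k --> \oo] --> l.
Proof. by rewrite -(cvg_shiftn d u). Qed.

Lemma cvg_shift_inv : (0 < d)%N -> (k + d)%:R^-1 @[k --> \oo] --> (0 : R).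
Proof.
move=> d0; apply: cvg0_le (@cvg_harmonic R) => k.
rewrite ger0_norm ?invr_ge0// /harmonic lef_pV2 ?posrE ?ltr0n ?addn_gt0 ?d0 ?orbT//.
by rewrite ler_nat -addn1 leq_add2l.
Qed.

End index_shift.

Section product_coordinates.
Context {R : realType} {q : nat}.
Variable P : probability 'cV[R]_q R.

(** The coordinates on the square of [P] form the canonical independent pair, available for every
    [q]. *)
Definition coord1 : {RV (P \x P)%E >-> 'cV[R]_q} :=
  HB.pack (@fst 'cV[R]_q 'cV[R]_q) (isMeasurableFun.Build _ _ _ _ (@fst 'cV[R]_q 'cV[R]_q) measurable_fst).

Definition coord2 : {RV (P \x P)%E >-> 'cV[R]_q} :=
  HB.pack (@snd 'cV[R]_q 'cV[R]_q) (isMeasurableFun.Build _ _ _ _ (@snd 'cV[R]_q 'cV[R]_q) measurable_snd).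

Lemma coord1_law : has_law coord1 P.
Proof.
move=> A mA; rewrite /distribution /pushforward.
have -> : coord1 @^-1` A = A `*` setT by apply/seteqP; split => [z ?|z []].
by rewrite [LHS](product_measure1E P P mA measurableT) [X in (_ * X)%E](probability_setT P) mule1.
Qed.

Lemma coord2_law : has_law coord2 P.
Proof.
move=> A mA; rewrite /distribution /pushforward.
have -> : coord2 @^-1` A = setT `*` A by apply/seteqP; split => [z ?|z []].
by rewrite [LHS](product_measure1E P P measurableT mA) [X in (X * _)%E](probability_setT P) mul1e.
Qed.

Lemma coord_independent : independent coord1 coord2.
Proof.
move=> A B mA mB; have := coord1_law mA; have := coord2_law mB.
rewrite /distribution /pushforward => -> ->.
exact: (product_measure1E P P mA mB).
Qed.

End product_coordinates.

Section independent_pair.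
Context {R : realType} {q : nat} (dO : measure_display).
Variables (Om : measurableType dO) (Pr : probability Om R).
Variables (X Xt : {RV Pr >-> 'cV[R]_q}) (P : probability 'cV[R]_q R).
Hypothesis (X_law : has_law X P) (Xt_law : has_law Xt P) (XXt : independent X Xt).

(** Independence gives the product formula on rectangles, which determines the measure. *)
Lemma joint_law E : measurable E -> Pr [set w | E (X w, Xt w)] = (P \x P)%E E.
Proof.
have mp : measurable_fun setT (fun w => (X w, Xt w)) by exact: measurable_fun_pair.
pose XX : {RV Pr >-> ('cV[R]_q * 'cV[R]_q)%type} :=
  HB.pack (fun w => (X w, Xt w)) (isMeasurableFun.Build _ _ _ _ _ mp).
move=> mE; apply/esym; apply: (@product_measure_unique _ _ _ _ _ P P (distribution Pr XX)) => // A B mA mB.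
have := XXt mA mB; have := X_law mA; have := Xt_law mB.
by rewrite /distribution /pushforward => -> ->.
Qed.

Lemma integral_law f : bmeas f -> \int[Pr]_w f (X w) = \int[P]_x f x.
Proof.
move=> bf; rewrite -(integral_distr Pr X bf) /Rintegral; congr fine.
by apply: eq_measure_integral => A mA _; exact: X_law.
Qed.

End independent_pair.

(** * The assertions in terms of product and image measures *)

Section reformulation.
Context {R : realType} (d : nat).
Variable P : forall q, probability 'cV[R]_q R.

(** (A2) depends on the pair only through the product measure: one direction takes the coordinate
    maps as the pair, the other uses [joint_law]. The shift by [d] keeps to the dimensions where the
    laws are prescribed. *)
Lemma norms_cvgP (rho : probability R R) : norms_cvg d P rho <->
  [/\ rho `[0, +oo[%classic = 1%E,
    (forall f : R -> R, continuous f -> bounded_fun f ->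
      \int[P (k + d)%N]_x f (scaled_sqnorm x) @[k --> \oo] --> \int[rho]_v f v) &
    (forall e : R, 0 < e ->
      fine ((P (k + d)%N \x P (k + d)%N)%E [set z | e < `|dot z.1 z.2 / (k + d)%:R|])
        @[k --> \oo] --> (0 : R))].
Proof.
have mA q (e : R) : measurable [set z : 'cV[R]_q * 'cV[R]_q | e < `|dot z.1 z.2 / q%:R|].
  apply: measurable_gt_set; apply: measurableT_comp => //; apply: measurable_funM => //.
  by apply: measurable_dot2.
have bs (f : R -> R) q : continuous f -> bounded_fun f -> bmeas (fun x : 'cV[R]_q => f (scaled_sqnorm x)).
  by move=> cf bf; apply: (bmeas_comp (bmeas_continuous cf bf)).
split=> [[rho1 H]|[rho1 H1 H2]].
  have [Hw Hp] := H _ _ (fun q => (P q \x P q)%E) (fun q => coord1 (P q)) (fun q => coord2 (P q))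
    (fun q _ => And3 (@coord1_law R q (P q)) (@coord2_law R q (P q)) (@coord_independent R q (P q))).
  split=> // [f cf bf|e e0].
    apply/(cvgr_shift d (fun q => \int[P q]_x f (scaled_sqnorm x))).
    apply: cvg_ext (Hw f cf bf) => q.
    rewrite integral_distr; last exact: bmeas_continuous.
    by rewrite -(integral_fst (P q) (P q) (bs f q cf bf)); apply: eq_Rintegral.
  apply/(cvgr_shift d (fun q => fine ((P q \x P q)%E [set z | e < `|dot z.1 z.2 / q%:R|]))).
  have Hf : fine ((P q \x P q)%E [set w | e < `|((coord1 (P q) w)^T *m coord2 (P q) w) 0 0 / q%:R - 0|])
      @[q --> \oo] --> (0 : R) by exact: (fine_cvg (Hp e e0)).
  apply: cvg_ext Hf => q.
  by congr (fine (_ _)); apply/seteqP; split => z /=; rewrite subr0.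
split=> // dO Om Pr X Xt H; split=> [f cf bf|e e0].
  apply/(cvgr_shift d); apply: cvg_ext (H1 f cf bf) => k.
  have [Xl _ _] := H (k + d)%N (leq_addl _ _).
  rewrite integral_distr; last exact: bmeas_continuous.
  by rewrite -(integral_law Xl (bs f _ cf bf)).
rewrite -(cvg_shiftn d); apply: (@cvg_trans _ ((fine ((P (k + d)%N \x P (k + d)%N)%E
    [set z | e < `|dot z.1 z.2 / (k + d)%:R|]))%:E @[k --> \oo])); last first.
  by apply: cvg_EFin; [exact: nearW|exact: H2].
apply: near_eq_cvg; apply: nearW => k.
have [Xl Xtl XXt] := H (k + d)%N (leq_addl _ _).
rewrite EFin_prob// -[LHS](joint_law Xl Xtl XXt (mA _ e)).
by congr (Pr _ _); apply/seteqP; split => w /=; rewrite subr0.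
Qed.

Variables (dO : nat -> measure_display) (Om : forall q, measurableType (dO q)).
Variable Pr : forall q, probability (Om q) R.
Variable Gamma : forall q, {RV (Pr q) >-> 'M[R]_(q, d)}.

(** The test integrals are uniformly bounded, so convergence in probability is convergence in L1;
    the measurability required of a random distribution is an instance of Fubini. *)
Lemma projections_cvgP Q : projections_cvg P Gamma Q <->
  forall f : 'cV[R]_d -> R, continuous f -> bounded_fun f ->
    L1_cvg (fun k => Pr (k + d)%N) (fun k => P (k + d)%N)
      (stiefel_proj (fun k => Gamma (k + d)%N)) Q f.
Proof.
have bG f q : bmeas f -> bmeas (fun z : Om q * 'cV[R]_q => f ((Gamma q z.1)^T *m z.2) : R).
  move=> bf; apply: (bmeas_comp bf); apply: measurable_mulmx2; last exact: measurable_snd.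
  exact: measurableT_comp measurable_fst.
have E f q w : bmeas f ->
    \int[projection (Gamma q w) (P q)]_x f x = \int[P q]_x f ((Gamma q w)^T *m x).
  by move=> bf; rewrite integral_distr.
have mG f q : bmeas f -> measurable_fun setT (fun w => \int[projection (Gamma q w) (P q)]_x f x).
  move=> bf; have [mf _] := bmeas_integral2 (P q) (bG f q bf).
  have -> : (fun w => \int[projection (Gamma q w) (P q)]_x f x) =
    (fun w => \int[P q]_x f ((Gamma q w)^T *m x)) by apply/funext => w; exact: E.
  exact: mf.
have key f : continuous f -> bounded_fun f ->
    cvg_in_probability Pr (fun q w => \int[projection (Gamma q w) (P q)]_x f x) (\int[Q]_x f x) <->
    L1_cvg (fun k => Pr (k + d)%N) (fun k => P (k + d)%N)
      (stiefel_proj (fun k => Gamma (k + d)%N)) Q f.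
  move=> cf bdf; have bf := bmeas_continuous cf bdf; have [C fC] := bf.2.
  apply: (iff_trans (cvg_in_probability_shift d _ _ _)).
  have L := @cvg_in_probability_L1 R _ _ (fun k => Pr (k + d)%N)
    (fun k w => \int[projection (Gamma (k + d)%N w) (P (k + d)%N)]_x f x) (\int[Q]_x f x) C.
  apply: (iff_trans (L _ _)) => [k|k w|]; first exact: mG.
    exact: normr_integral_le_cst.
  have EE k : \int[Pr (k + d)%N]_w
      `|\int[projection (Gamma (k + d)%N w) (P (k + d)%N)]_x f x - \int[Q]_x f x| =
    \int[Pr (k + d)%N]_w
      `|image_error (fun k => P (k + d)%N) (stiefel_proj (fun k => Gamma (k + d)%N)) Q f w|.
    by apply: eq_Rintegral => w _; rewrite E.
  by split; apply: cvg_ext => k; rewrite EE.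
split=> [[_ H] f cf bf|H]; first by apply/key => //; exact: H.
split=> [q f cf bf|f cf bf]; first by apply: mG; exact: bmeas_continuous.
by apply/key => //; exact: H.
Qed.

End reformulation.

Theorem theorem2p1 (R : realType) (d : nat) (d_gt0 : (0 < d)%N)
  (P : forall q : nat, probability 'cV[R]_q R)
  (dO : nat -> measure_display)
  (Omega : forall q : nat, measurableType (dO q))
  (Pr : forall q : nat, probability (Omega q) R)
  (Gamma : forall q : nat, {RV (Pr q) >-> 'M[R]_(q, d)})
  (Gamma_unif : forall q : nat, (d <= q)%N ->
     uniform_on_stiefel (distribution (Pr q) (Gamma q))) :
  ((exists Q : probability 'cV[R]_d R, projections_cvg P Gamma Q) <->
   (exists rho : probability R R, norms_cvg d P rho)) /\
  (forall (Q : probability 'cV[R]_d R) (rho : probability R R),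
     projections_cvg P Gamma Q -> norms_cvg d P rho ->
     forall A : set 'cV[R]_d, measurable A -> Q A = normal_mixture rho A).
Proof.
have q_gt0 k : (0 < k + d)%N by rewrite addn_gt0 d_gt0 orbT.
have q_oo := cvg_shift_inv (R := R) d_gt0.
have unif k := Gamma_unif (k + d)%N (leq_addl _ _).
(* This implication yields (A1) from (A2) and, by uniqueness of limits, identifies every [Q]. *)
have mixture rho : norms_cvg d P rho -> projections_cvg P Gamma (mixture_law rho).
  move=> /norms_cvgP[_ H1 H2]; apply/projections_cvgP.
  exact: (L1_cvg_mixture q_gt0 q_oo unif H1 H2).
split; [split=> [[Q /projections_cvgP H]|[rho /mixture H]]|].
- have [rho [rho1 H1]] := norm_cvg_of_L1 d_gt0 q_gt0 q_oo unif H.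
  exists rho; apply/norms_cvgP; split => // e e0.
  exact: (dot_cvg_of_L1 d_gt0 q_gt0 q_oo unif H e0).
- by exists (mixture_law rho).
move=> Q rho /projections_cvgP HQ Hrho A mA.
have rho1 : rho `[0, +oo[%classic = 1%E by case: Hrho.
rewrite -(mixture_lawE rho1 mA).
have /projections_cvgP Hmix := mixture _ Hrho.
apply: probability_unique mA => f cf bf.
have mp k := measurable_stiefel_proj (fun k => Gamma (k + d)%N) (k := k).
have bf' := bmeas_continuous cf bf.
(* The same sequence of means converges to the integrals of [f] under both laws. *)
exact: (cvgr_unique (L1_cvg_mean mp bf' (HQ f cf bf)) (L1_cvg_mean mp bf' (Hmix f cf bf))).
Qed.
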